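(* Let $Y_1,\dots,Y_n$ be observations from the deconvolution model described in the context, let $\Phi=\int\varphi(x)f(x)\,dx$, let $s\ge 0$, $B>0$, and suppose that $\|g\|_\infty=\sup_x g(x)<\infty$. Suppose there are constants $C_{g1}>0$, $C_{\varphi 2}>0$ and non-negative $\alpha,\beta,\gamma,a,b,d$ (with $\alpha>0$ and $\beta=0$ whenever $\gamma=0$, and $b=0$ whenever $d=0$) such that for all $\omega\in\mathbb R$ $$|g^*(\omega)|\ge C_{g1}(\omega^2+1)^{-\alpha/2}e^{-\gamma|\omega|^\beta},\qquad |\varphi^*(\omega)|\le C_{\varphi 2}(\omega^2+1)^{-a/2}e^{-d|\omega|^b}.$$ Then the estimator $\widehat\Phi_{h}$ with $h=\tilde h_n$ satisfies $$\sup_{f\in\Omega_s(B)}\mathbb E(\widehat\Phi_{\tilde h_n}-\Phi)^2\le C\,\Delta_n\Big(s+a+\tfrac{b-1}{2},\ \alpha-a,\ b,d,\beta,\gamma\Big),$$ where $C>0$ is independent of $n$ and the bandwidth $\tilde h_n$ and the rate $\Delta_n(A_1,A_2,b,d,\beta,\gamma)$ are given, with $A_1=s+a+(b-1)/2$ and $A_2=\alpha-a$, by the table in the context.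
   Context: Model: $Y_i=\theta_i+\xi_i$, $i=1,\dots,n$, where $\theta_i$ are i.i.d. with unknown pdf $f$, $\xi_i$ are i.i.d. with known pdf $g$, and the $\theta$'s and $\xi$'s are independent. For a function $t$, $t^*(\omega)=\int_{-\infty}^\infty e^{i\omega x}t(x)\,dx$. Denote by $q$ the pdf of $Y_i$, so $q^*=f^*g^*$. Functional: $\varphi$ is a known function with Fourier transform $\varphi^*$, and it is assumed that $\Phi=\int\varphi f=\frac1{2\pi}\int_{-\infty}^\infty f^*(\omega)\varphi^*(-\omega)\,d\omega$ with an absolutely convergent integral. Sobolev ball: $\Omega_s(B)$ is the set of pdfs $f$ with $\int|f^*(\omega)|^2(\omega^2+1)^s\,d\omega\le B^2$. Estimator: for $h\ge0$, $$\widehat\Phi_h=\frac1{2\pi}\int_{-\infty}^\infty\frac{\widehat{q^*}(\omega)}{g^*(\omega)}\varphi^*(-\omega)\,\mathbb I(|\omega|\le h^{-1})\,d\omega,\qquad \widehat{q^*}(\omega)=\frac1n\sum_{j=1}^ne^{i\omega Y_j},$$ where $h=0$ means no truncation (the case when $\varphi^*/g^*\in L^2$; the integral is then understood in the $L^2$ Fourier sense if necessary). Rates (for $n\to\infty$, i.e. for all sufficiently large $n$). These are the minimizing bandwidth and the order of the minimum over $h$ of $H(n,h)=h^{2A_1}e^{-2dh^{-b}}+n^{-1}\int_0^{1/h}(\omega^2+1)^{A_2}\exp(2\gamma\omega^\beta-2d\omega^b)\,d\omega$. Put $$h^*(n)=\Big[\tfrac1{2\gamma}\Big(\log n-\tfrac{2A_1+2A_2+1-\beta}{\beta}\log\log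 n\Big)\Big]^{-1/\beta},\qquad V_1=\tfrac{2A_1}{\beta}-\tfrac{d(2A_1+2A_2+1-\beta)}{\beta\gamma}.$$ Then: - $b>\beta$, or $b=\beta,\ d>\gamma>0$, or $b=\beta,\ d=\gamma,\ A_2<-1/2$: $\Delta_n=n^{-1}$, $\tilde h_n=0$; - $b=\beta>0,\ d=\gamma>0,\ A_2=-1/2$: $\Delta_n=n^{-1}\log\log n$, $\tilde h_n=[\log n/(2\gamma)]^{-1/\beta}$; - $b=\beta>0,\ d=\gamma>0,\ A_2>-1/2$: $\Delta_n=n^{-1}(\log n)^{(2A_2+1)/b}$, $\tilde h_n=[\log n/(2\gamma)]^{-1/\beta}$; - $b=\beta=0,\ d=\gamma=0,\ A_2=-1/2$: $\Delta_n=n^{-1}\log n$, $\tilde h_n=n^{-1/(2A_1)}$; - $b=\beta=0,\ d=\gamma=0,\ A_2>-1/2$: $\Delta_n=n^{-2A_1/(2A_1+2A_2+1)}$, $\tilde h_n=n^{-1/(2A_1+2A_2+1)}$; - $b=\beta>0,\ \gamma>d>0$: $\Delta_n=(\log n)^{-V_1}n^{-d/\gamma}$, $\tilde h_n=h^*(n)$; - $\beta>b>0,\ d>0,\ \gamma>0$: $\Delta_n=(\log n)^{-2A_1/\beta}\exp(-2d[h^*(n)]^{-b})$, $\tilde h_n=h^*(n)$; - $b=d=0,\ \beta>0,\ \gamma>0$: $\Delta_n=(\log n)^{-2A_1/\beta}$, $\tilde h_n=h^*(n)$. *)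

(* Defs.v *)
(* MathComp-Analysis, with complex numbers R[i] from mathcomp-real-closed. *)
From HB Require Import structures.
From mathcomp Require Import all_boot all_order all_algebra.
From mathcomp Require Import complex.
From mathcomp Require Import all_classical all_reals all_analysis.
Import Order.TTheory GRing.Theory Num.Theory.
Import numFieldNormedType.Exports.

Set Implicit Arguments.
Unset Strict Implicit.
Unset Printing Implicit Defensive.

Local Open Scope classical_set_scope.
Local Open Scope ring_scope.
Local Open Scope complex_scope.

Section Fourier.
Context {R : realType}.
Local Notation mu := (@lebesgue_measure R).
Implicit Types (t ts u : R -> R[i]).

Definition cabs (z : R[i]) : R := Normc.normc z.

(* The library integrates real-valued functions only; complex integrals are
   taken componentwise. *)
Definition cmeasurable t : Prop :=
  measurable_fun setT (fun x => complex.Re (t x)) /\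
  measurable_fun setT (fun x => complex.Im (t x)).

Definition cintegrable t : Prop :=
  mu.-integrable setT (fun x => (complex.Re (t x))%:E) /\
  mu.-integrable setT (fun x => (complex.Im (t x))%:E).

Definition cint (D : set R) t : R[i] :=
  (\int[mu]_(x in D) complex.Re (t x)) +i* (\int[mu]_(x in D) complex.Im (t x)).

Definition square_integrable t : Prop :=
  cmeasurable t /\ (\int[mu]_x ((cabs (t x)) ^+ 2)%:E < +oo)%E.

Definition expi (x : R) : R[i] := cos x +i* sin x.

Definition fourier t (w : R) : R[i] := cint setT (fun x => expi (w * x) * t x).

Definition rfourier (t : R -> R) : R -> R[i] := fourier (fun x => (t x)%:C).

(* [ts] is (a version of) the Fourier-Plancherel transform of [t]: the limit
   in L^2 of the Fourier transforms of the truncations of [t] to [-T, T]. *)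
Definition is_L2_fourier t ts : Prop :=
  [/\ square_integrable t, square_integrable ts &
      (\int[mu]_w ((cabs (ts w -
          cint `[- T, T] (fun x => expi (w * x) * t x))) ^+ 2)%:E)%E
        @[T --> +oo%R] --> 0%E].

(* A version of the Fourier-Plancherel transform; junk value 0 when [t] has
   none. *)
Definition L2_fourier t : R -> R[i] := xget (cst 0) [set ts | is_L2_fourier t ts].

Definition is_fourier (t : R -> R) ts : Prop :=
  (mu.-integrable setT (EFin \o t) /\ ts = rfourier t) \/
  is_L2_fourier (fun x => (t x)%:C) ts.

End Fourier.

Section Model.
Context {R : realType}.
Local Notation mu := (@lebesgue_measure R).

Definition is_pdf (f : R -> R) : Prop :=
  [/\ measurable_fun setT f, (forall x, 0 <= f x) &
      (\int[mu]_x (f x)%:E = 1)%E].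

Definition sobolev_ball (s B : R) : set (R -> R) :=
  [set f | is_pdf f /\
     (\int[mu]_w ((cabs (rfourier f w)) ^+ 2 * (w ^+ 2 + 1) `^ s)%:E
        <= (B ^+ 2)%:E)%E].

Definition has_pdf d (T : measurableType d) (P : probability T R)
    (X : {RV P >-> R}) (f : R -> R) : Prop :=
  forall A : set R, measurable A ->
    distribution P X A = (\int[mu]_(x in A) (f x)%:E)%E.

(* The product rule for subfamilies is the case where some [A i] are [setT]. *)
Definition mutually_independent d (T : measurableType d) (P : probability T R)
    (I : finType) (X : I -> {RV P >-> R}) : Prop :=
  forall A : I -> set R, (forall i, measurable (A i)) ->
    P (\bigcap_i (X i @^-1` A i)) = (\prod_(i : I) P (X i @^-1` A i))%E.

Definition deconvolution_model d (T : measurableType d) (P : probability T R)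
    (n : nat) (theta xi : 'I_n -> {RV P >-> R}) (f g : R -> R) : Prop :=
  [/\ forall i, has_pdf (theta i) f,
      forall i, has_pdf (xi i) g &
      mutually_independent
        (fun k : 'I_n + 'I_n =>
           match k with inl i => theta i | inr i => xi i end)].

Definition functional (phi f : R -> R) : R := \int[mu]_x (phi x * f x).

Definition empirical_cf (n : nat) (Y : 'I_n -> R) (w : R) : R[i] :=
  ((n%:R)^-1)%:C * \sum_(j < n) expi (w * Y j).

Definition fourier_ratio (gs phis : R -> R[i]) (w : R) : R[i] :=
  phis (- w) / gs w.

(* [gs] and [phis] stand for the Fourier transforms of g and phi.  No
   truncation takes place for h = 0; there, if phis(-w) / gs(w) is not
   absolutely integrable, the inverse Fourier integral
     (1 / (2 pi)) \int e^{iwx} phis(-w) / gs(w) dw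
   is taken in the L^2 sense (it has the same sign convention as [fourier])
   and averaged over x = Y_1, ..., Y_n. *)
Definition estimator (gs phis : R -> R[i]) (h : R) (n : nat) (Y : 'I_n -> R) :
    R[i] :=
  ((2 * pi)^-1)%:C *
  (if h != 0 then
     cint `[- h^-1, h^-1] (fun w => empirical_cf Y w / gs w * phis (- w))
   else if `[< cintegrable (fourier_ratio gs phis) >] then
     cint setT (fun w => empirical_cf Y w / gs w * phis (- w))
   else
     ((n%:R)^-1)%:C * \sum_(j < n) L2_fourier (fourier_ratio gs phis) (Y j)).

(* The model does not depend on the probability space on which the variables
   are realized, so the supremum runs over all realizations. *)
Definition max_risk (s B : R) (g phi : R -> R) (phis : R -> R[i]) (h : R)
    (n : nat) : \bar R :=
  ereal_sup [set r | exists f : R -> R, sobolev_ball s B f /\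
    exists (d : measure_display) (T : measurableType d) (P : probability T R)
           (theta xi : 'I_n -> {RV P >-> R}),
      deconvolution_model theta xi f g /\
      r = ('E_P[fun x => ((cabs
            (estimator (rfourier g) phis h (fun i => theta i x + xi i x)
               - (functional phi f)%:C)) ^+ 2)%R])%E].

End Model.

Section Rates.
Context {R : realType}.

Definition hstar (A1 A2 beta gamma : R) (n : nat) : R :=
  ((2 * gamma)^-1 * (ln n%:R -
     (2 * A1 + 2 * A2 + 1 - beta) / beta * ln (ln n%:R))) `^ (- beta^-1).

Definition V1 (A1 A2 d beta gamma : R) : R :=
  2 * A1 / beta - d * (2 * A1 + 2 * A2 + 1 - beta) / (beta * gamma).

(* [bandwidth_rate A1 A2 b d beta gamma h Delta]: the parameters fall in a
   regime whose bandwidths are [h n] and whose rates are [Delta n]. *)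
Inductive bandwidth_rate (A1 A2 b d beta gamma : R) :
    (nat -> R) -> (nat -> R) -> Prop :=
| Rate_parametric :
    beta < b \/ (b = beta /\ 0 < gamma < d) \/
      [/\ b = beta, d = gamma & A2 < - 2^-1] ->
    bandwidth_rate A1 A2 b d beta gamma
      (fun=> 0)
      (fun n => n%:R^-1)
| Rate_loglog :
    b = beta -> 0 < beta -> d = gamma -> 0 < gamma -> A2 = - 2^-1 ->
    bandwidth_rate A1 A2 b d beta gamma
      (fun n => (ln n%:R / (2 * gamma)) `^ (- beta^-1))
      (fun n => n%:R^-1 * ln (ln n%:R))
| Rate_parametric_log :
    b = beta -> 0 < beta -> d = gamma -> 0 < gamma -> - 2^-1 < A2 ->
    bandwidth_rate A1 A2 b d beta gamma
      (fun n => (ln n%:R / (2 * gamma)) `^ (- beta^-1))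
      (fun n => n%:R^-1 * (ln n%:R) `^ ((2 * A2 + 1) / b))
| Rate_log :
    b = 0 -> beta = 0 -> d = 0 -> gamma = 0 -> A2 = - 2^-1 ->
    bandwidth_rate A1 A2 b d beta gamma
      (fun n => n%:R `^ (- (2 * A1)^-1))
      (fun n => n%:R^-1 * ln n%:R)
| Rate_polynomial :
    b = 0 -> beta = 0 -> d = 0 -> gamma = 0 -> - 2^-1 < A2 ->
    bandwidth_rate A1 A2 b d beta gamma
      (fun n => n%:R `^ (- (2 * A1 + 2 * A2 + 1)^-1))
      (fun n => n%:R `^ (- (2 * A1) / (2 * A1 + 2 * A2 + 1)))
| Rate_same_exponent :
    b = beta -> 0 < beta -> 0 < d < gamma ->
    bandwidth_rate A1 A2 b d beta gamma
      (hstar A1 A2 beta gamma)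
      (fun n => (ln n%:R) `^ (- V1 A1 A2 d beta gamma) *
                n%:R `^ (- (d / gamma)))
| Rate_supersmooth :
    0 < b < beta -> 0 < d -> 0 < gamma ->
    bandwidth_rate A1 A2 b d beta gamma
      (hstar A1 A2 beta gamma)
      (fun n => (ln n%:R) `^ (- (2 * A1) / beta) *
                expR (- 2 * d * (hstar A1 A2 beta gamma n) `^ (- b)))
| Rate_logarithmic :
    b = 0 -> d = 0 -> 0 < beta -> 0 < gamma ->
    bandwidth_rate A1 A2 b d beta gamma
      (hstar A1 A2 beta gamma)
      (fun n => (ln n%:R) `^ (- (2 * A1) / beta)).

End Rates.

(* Main.v *)
(* The estimator is the average of K(Y_1), ..., K(Y_n), where K is the Fourier
   transform of the ratio phi^*(-w) / g^*(w) restricted to [-1/h, 1/h].  As the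
   density of Y_j is bounded by sup g, Plancherel's inequality bounds the
   variance by a multiple of the integral of the squared ratio divided by n.
   The bias is the tail of \int |f^*(w) phi^*(-w)| dw beyond 1/h, controlled by
   the Cauchy-Schwarz inequality on the Sobolev ball, except for b = d = 0 and
   A_1 <= 0: there the integrals themselves are uniformly bounded on the ball,
   by a gliding hump argument.  All integrals of (w^2+1)^A exp(c w^beta - e w^b)
   are estimated by comparison with derivatives of w^q exp(c w^beta - e w^b). *)
Require Import Defs.
From HB Require Import structures.
From mathcomp Require Import all_boot all_order all_algebra.
From mathcomp Require Import complex ring lra.
From mathcomp Require Import all_classical all_reals all_analysis.
From mathcomp Require Import measurable_realfun.
Import Order.TTheory GRing.Theory Num.Theory.
Import numFieldNormedType.Exports.
Local Open Scope classical_set_scope.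
Local Open Scope ring_scope.
Local Open Scope complex_scope.
Set Implicit Arguments.
Unset Strict Implicit.
Unset Printing Implicit Defensive.

(** [Phi_fourier] gives integrability one density at a time, with no bound uniform over the ball,
    and for b = d = 0, A_1 <= 0 the weight in Cauchy-Schwarz has infinite integral. There the target
    x^(-2 A_1), with x = 1/h, is at least 1 for x >= 1, so a bounded bias suffices; its uniformity
    comes from the ball being stable under infinite mixtures, one of which would otherwise violate
    integrability. Constants are absorbed in C, so Plancherel is needed only as an upper bound up to
    a factor. The bandwidth h* solves exp(2 gamma x^beta) = n (log n)^(-kappa) with kappa = (2 A_1 +
    2 A_2 + 1 - beta) / beta. As x is of order (log n)^(1/beta), this kappa gives the variance x^(2
    A_2 + 1 - beta) exp(2 gamma x^beta - 2 d x^b) / n and the squared bias x^(-2 A_1) exp(-2 d x^b)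
    the same order. With h = 0 the estimator is unbiased; for a kernel defined only in L^2 this is a
    limit over truncations, justified by the bounded density of the observations. *)

Lemma le_of_eq d (T : porderType d) (x y : T) : x = y -> (x <= y)%O.
Proof. by move=> ->. Qed.
(** * Parameter integrals and Fubini's theorem *)

Section dominated_fubini.
Context d1 d2 (T1 : measurableType d1) (T2 : measurableType d2) (R : realType).
Variables (m1 : {sigma_finite_measure set T1 -> \bar R})
  (m2 : {sigma_finite_measure set T2 -> \bar R}).
Variables (f : T1 -> T2 -> R) (a : T1 -> R) (b : T2 -> R).
Hypothesis mf : measurable_fun setT (fun z : T1 * T2 => f z.1 z.2).
Hypothesis ia : m1.-integrable setT (EFin \o a).
Hypothesis ib : m2.-integrable setT (EFin \o b).
Hypothesis f_le : forall x y, `|f x y| <= a x * b y.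

Let mf1 x : measurable_fun setT (f x).
Proof. exact: (measurableT_comp mf (pair1_measurable x)). Qed.

Lemma dominated_integrable1 x : m2.-integrable setT (EFin \o f x).
Proof.
apply: (@le_integrable _ _ _ _ _ _ _ (fun y => (a x)%:E * (b y)%:E)%E) => //.
- exact/measurable_EFinP.
- move=> y _ /=; rewrite lee_fin (le_trans (f_le x y))//; exact: ler_norm.
- exact: integrableZl.
Qed.

(** Tonelli: the iterated integral of |f| is at most the product of the integrals of |a| and |b|. *)
Lemma dominated_integrable_prod :
  (m1 \x m2)%E.-integrable setT (fun z => (f z.1 z.2)%:E).
Proof.
apply/integrable12ltyP; first exact/measurable_EFinP.
have [/integrableP[ma a_lty] /integrableP[mb b_lty]] := (ia, ib).
apply: (@le_lt_trans _ _ (\int[m1]_x (`|(a x)%:E| * \int[m2]_y `|(b y)%:E|))%E).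
  apply: ge0_le_integral => //.
  - by move=> x _; apply: integral_ge0 => y _; exact: abse_ge0.
  - apply: (measurable_fun_fubini_tonelli_F (fun z => `|(f z.1 z.2)%:E|%E)) => //=.
    by apply/measurable_EFinP; exact: measurableT_comp.
  - by apply: emeasurable_funM => //; apply: measurableT_comp.
  - move=> x _ /=; rewrite -ge0_integralZl//; last first.
      by apply/measurable_EFinP; apply: measurableT_comp => //; exact/measurable_EFinP.
    apply: ge0_le_integral => //.
    + by apply/measurable_EFinP; exact: measurableT_comp.
    + by apply: emeasurable_funM => //; apply/measurable_EFinP; apply: measurableT_comp => //; exact/measurable_EFinP.
    + by move=> y _ /=; rewrite lee_fin -normrM (le_trans (f_le x y))// ler_norm.
rewrite ge0_integralZr//; last 2 first.
  exact: measurableT_comp.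
  by apply: integral_ge0 => y _; exact: abse_ge0.
by apply: lte_mul_pinfty => //; [exact: integral_ge0|rewrite ge0_fin_numE//; exact: integral_ge0].
Qed.

Let innerE1 : (fun x => (\int[m2]_y f x y)%:E) = (fun x => \int[m2]_y (f x y)%:E)%E.
Proof.
by apply/funext => x; rewrite fineK//; exact/integrable_fin_num/dominated_integrable1.
Qed.

Lemma dominated_integrable_inner1 :
  m1.-integrable setT (EFin \o fun x => \int[m2]_y f x y).
Proof.
rewrite [X in _.-integrable _ X]innerE1.
exact: (integrable_fubini_F dominated_integrable_prod).
Qed.

End dominated_fubini.

Section dominated_fubini_swap.
Context d1 d2 (T1 : measurableType d1) (T2 : measurableType d2) (R : realType).
Variables (m1 : {sigma_finite_measure set T1 -> \bar R})
  (m2 : {sigma_finite_measure set T2 -> \bar R}).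
Variables (f : T1 -> T2 -> R) (a : T1 -> R) (b : T2 -> R).
Hypothesis mf : measurable_fun setT (fun z : T1 * T2 => f z.1 z.2).
Hypothesis ia : m1.-integrable setT (EFin \o a).
Hypothesis ib : m2.-integrable setT (EFin \o b).
Hypothesis f_le : forall x y, `|f x y| <= a x * b y.

Lemma dominated_integrable2 y : m1.-integrable setT (EFin \o f ^~ y).
Proof.
apply: (@dominated_integrable1 _ _ _ _ _ m1 (fun y x => f x y) b a) => //.
  exact: (measurableT_comp mf (@measurable_swap _ _ T2 T1)).
by move=> ? ?; rewrite mulrC.
Qed.

Lemma dominated_integrable_inner2 :
  m2.-integrable setT (EFin \o fun y => \int[m1]_x f x y).
Proof.
apply: (@dominated_integrable_inner1 _ _ _ _ _ m2 m1 (fun y x => f x y) b a) => //.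
  exact: (measurableT_comp mf (@measurable_swap _ _ T2 T1)).
by move=> ? ?; rewrite mulrC.
Qed.

Lemma dominated_Fubini :
  \int[m1]_x \int[m2]_y f x y = \int[m2]_y \int[m1]_x f x y.
Proof.
rewrite /Rintegral; congr fine.
transitivity (\int[m1]_x \int[m2]_y (f x y)%:E)%E.
  apply: eq_integral => x _; rewrite fineK//.
  apply: (integrable_fin_num measurableT).
  exact: (dominated_integrable1 mf ib f_le x).
rewrite (Fubini (f := fun z => (f z.1 z.2)%:E)); last exact: dominated_integrable_prod ia ib f_le.
apply: eq_integral => y _; rewrite fineK//.
apply: (integrable_fin_num measurableT).
exact: dominated_integrable2.
Qed.

End dominated_fubini_swap.

Section parameter_integral.
Context d1 d2 (T1 : measurableType d1) (T2 : measurableType d2) (R : realType).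
Variable m2 : {sigma_finite_measure set T2 -> \bar R}.

Lemma measurable_param_integral (f : T1 -> T2 -> R) :
  measurable_fun setT (fun z : T1 * T2 => f z.1 z.2) ->
  (forall x, m2.-integrable setT (EFin \o f x)) ->
  measurable_fun setT (fun x => \int[m2]_y f x y).
Proof.
move=> mf fi; apply/measurable_EFinP.
have mfE : measurable_fun setT (fun z : T1 * T2 => (f z.1 z.2)%:E) by exact/measurable_EFinP.
rewrite (_ : _ \o _ = (fun x => \int[m2]_y (fun z => (f z.1 z.2)%:E)^\+ (x, y) -
    \int[m2]_y (fun z => (f z.1 z.2)%:E)^\- (x, y))%E).
  apply: emeasurable_funB.
    by apply: (measurable_fun_fubini_tonelli_F (fun z => (f z.1 z.2)%:E)^\+%E) => //; exact: measurable_funepos.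
  by apply: (measurable_fun_fubini_tonelli_F (fun z => (f z.1 z.2)%:E)^\-%E) => //; exact: measurable_funeneg.
apply/funext => x /=; rewrite fineK; last exact: (integrable_fin_num measurableT (fi x)).
by rewrite [LHS]integralE; congr (_ - _)%E; apply: eq_integral => y _; rewrite ?funepos.unlock ?funeneg.unlock.
Qed.

Lemma integrable_bounded_mul (m : {measure set T2 -> \bar R}) (c u : T2 -> R) (M : R) :
  measurable_fun setT c -> (forall x, `|c x| <= M) ->
  m.-integrable setT (EFin \o u) -> m.-integrable setT (EFin \o (fun x => c x * u x)).
Proof.
move=> mc cM iu.
have mu : measurable_fun setT u by apply/measurable_EFinP; exact: measurable_int iu.
apply: (@le_integrable _ _ _ _ _ _ _ (fun x => M%:E * (u x)%:E)%E) => //.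
- by apply/measurable_EFinP; exact: measurable_funM.
- move=> x _ /=; rewrite lee_fin !normrM ler_wpM2r// (le_trans (cM x))//; exact: ler_norm.
- exact: integrableZl.
Qed.

End parameter_integral.

(** * Plancherel's inequality *)

Section ftc_misc.
Context {R : realType}.
Local Notation mu := (@lebesgue_measure R).

Lemma FTC2_is_derive (F f : R -> R) (a b : R) : a <= b ->
  {in `[a, b], forall x : R, is_derive x (1 : R) F (f x)} ->
  {in `[a, b], forall x : R, {for x, continuous f}} ->
  mu.-integrable `[a, b] (EFin \o f) /\ \int[mu]_(x in `[a, b]) f x = F b - F a.
Proof.
move=> ab dF cf.
have cfw : {within `[a, b], continuous f}.
  by apply: continuous_in_subspaceT => x /set_mem; exact: cf.
split.
  by apply: continuous_compact_integrable => //; exact: segment_compact.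
move: ab; rewrite le_eqVlt => /predU1P[<-|ab].
  by rewrite set_itv1 Rintegral_set1 subrr.
have cF x : x \in `[a, b] -> {for x, continuous F}.
  by move=> /dF [dFx _]; exact/differentiable_continuous/derivable1_diffP.
rewrite /Rintegral (@continuous_FTC2 _ f F)//.
- split.
  + by move=> x xab; have [] := dF x (subset_itv_oo_cc xab).
  + by apply: cvg_at_right_filter; apply: cF; rewrite in_itv/= lexx ltW.
  + by apply: cvg_at_left_filter; apply: cF; rewrite in_itv/= lexx ltW.
- move=> x xab; rewrite derive1E.
  by have [_ ->] := dF x (subset_itv_oo_cc xab).
Qed.

Lemma ge0_cvg_integral_itv (f : R -> \bar R) :
  measurable_fun setT f -> (forall x, 0 <= f x)%E ->
  (\int[mu]_(x in `[(- n%:R)%R, n%:R%R]) f x)%E @[n --> \oo] --> (\int[mu]_x f x)%E.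
Proof.
move=> mf f0.
have UT : \bigcup_n `[- n%:R, n%:R]%classic = [set: R].
  apply/seteqP; split => // x _; exists (Num.truncn `|x|).+1 => //=.
  rewrite in_itv/= -ler_norml; apply: ltW; exact: truncnS_gt.
have nd : nondecreasing_seq (fun n : nat => `[- n%:R, n%:R]%classic : set R).
  move=> m n mn; apply/subsetPset; apply: subset_itv; rewrite bnd_simp ?lerN2 ler_nat//.
have := @ge0_nondecreasing_set_cvg_integral _ (measurableTypeR R) _ _ f mu nd (fun=> measurable_itv _)
  (fun=> measurable_funTS mf) (fun _ x _ => f0 x).
by rewrite UT.
Qed.

Lemma ge0_integral_le_itv (f : R -> \bar R) (c : \bar R) :
  measurable_fun setT f -> (forall x, 0 <= f x)%E ->
  (forall n : nat, \int[mu]_(x in `[(- n%:R)%R, n%:R%R]) f x <= c)%E ->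
  (\int[mu]_x f x <= c)%E.
Proof.
move=> mf f0 fc; have cv := ge0_cvg_integral_itv mf f0.
rewrite -(cvg_lim _ cv)//.
apply: lime_le; first by apply/cvg_ex; eexists; exact: cv.
exact: nearW.
Qed.

(** The primitive is atan(T (x - c)), whose oscillation is at most pi. *)
Lemma cauchy_density_le (T c : R) : 0 < T ->
  (\int[mu]_x (T / (1 + (T * (x - c)) ^+ 2))%:E <= pi%:E)%E.
Proof.
move=> T0.
have D (x : R) : is_derive x (1 : R) (fun x : R => atan (T * (x - c))) (T / (1 + (T * (x - c)) ^+ 2)).
  apply: is_derive_eq; rewrite /GRing.scale/=; ring.
have C : continuous (fun x : R => T / (1 + (T * (x - c)) ^+ 2)).
  move=> x; apply: cvgM; first exact: cvg_cst.
  apply: cvgV; first by rewrite gt_eqF// ltr_wpDr// sqr_ge0.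
  apply: cvgD; first exact: cvg_cst.
  apply: (@cvg_comp _ _ _ (fun x => T * (x - c)) (fun x : R => x ^+ 2)); last exact: exprn_continuous.
  by apply: cvgM; [exact: cvg_cst|apply: cvgB; [exact: cvg_id|exact: cvg_cst]].
have ge0 x : 0 <= T / (1 + (T * (x - c)) ^+ 2).
  by rewrite divr_ge0 ?(ltW T0)// addr_ge0// sqr_ge0.
apply: ge0_integral_le_itv.
- by apply/measurable_EFinP; exact: continuous_measurable_fun.
- by move=> x; rewrite lee_fin.
move=> n.
have nn : - n%:R <= n%:R :> R by rewrite lerNl (le_trans _ (ler0n _ _))// oppr_le0.
have [i e] := FTC2_is_derive nn (fun x _ => D x) (fun x _ => C x).
rewrite -[leLHS]fineK; last exact: (integrable_fin_num _ i).
rewrite lee_fin -/(Rintegral _ _ _) e.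
have := atan_ltpi2 (T * (n%:R - c)); have := atan_gtNpi2 (T * (- n%:R - c)).
lra.
Qed.

(* The weight [1 - (y / T) ^ 2] on [- T, T] has a transform dominated by a
   multiple of the Cauchy density, which yields a non-sharp Plancherel
   inequality without any inversion theorem. *)
Definition parabola_ft (T w : R) : R :=
  \int[mu]_(y in `[- T, T]) ((1 - (y / T) ^+ 2) * cos (w * y)).

Let parabola_continuous (T : R) : continuous (fun y : R => 1 - (y / T) ^+ 2).
Proof.
move=> y; apply: cvgB; first exact: cvg_cst.
apply: (@cvg_comp _ _ _ (fun y => y / T) (fun x : R => x ^+ 2)); last exact: exprn_continuous.
by apply: cvgM; [exact: cvg_id|exact: cvg_cst].
Qed.

Let parabola_cont (T w : R) : continuous (fun y : R => (1 - (y / T) ^+ 2) * cos (w * y)).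
Proof.
move=> y; apply: cvgM; first exact: parabola_continuous.
apply: (@cvg_comp _ _ _ (fun y => w * y) cos); last exact: continuous_cos.
by apply: cvgM; [exact: cvg_cst|exact: cvg_id].
Qed.

Lemma parabola_bound (T y : R) : 0 < T -> y \in `[- T, T] -> 0 <= 1 - (y / T) ^+ 2 <= 1.
Proof.
move=> T0; rewrite in_itv/= => /andP[Ty yT].
have : `|y / T| <= 1 by rewrite normrM normfV (gtr0_norm T0) ler_pdivrMr// mul1r ler_norml Ty yT.
rewrite -real_normK ?num_real// => yT1.
have q1 : `|y / T| ^+ 2 <= 1 by exact: exprn_ile1.
have q0 : 0 <= `|y / T| ^+ 2 by exact: exprn_ge0.
apply/andP; split; lra.
Qed.

(** With X = T w the transform is 4 T (sin X / X^3 - cos X / X^2), at most 8 T / X^2 in modulus for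
    |X| > 1; for |X| <= 1 the trivial bound 2 T is used. The factor 20 covers both ranges with room
    to spare. *)
Lemma parabola_ft_le (T w : R) : 0 < T ->
  `|parabola_ft T w| <= 20 * (T / (1 + (T * w) ^+ 2)).
Proof.
move=> T0; have TT : - T <= T by lra.
have cts := @parabola_cont T w.
have [Tw|Tw] := leP (`|T * w|) 1.
  apply: (@le_trans _ _ (2 * T)); last first.
    have h1 : (T * w) ^+ 2 <= 1 by rewrite -real_normK ?num_real// exprn_ile1.
    have h0 := sqr_ge0 (T * w).
    rewrite (_ : 20 * _ = T * (20 / (1 + (T * w) ^+ 2))); last by ring.
    rewrite mulrC ler_pM2l// ler_pdivlMr; lra.
  have i1 : mu.-integrable `[- T, T] (EFin \o (fun y => (1 - (y / T) ^+ 2) * cos (w * y))).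
    apply: continuous_compact_integrable; first exact: segment_compact.
    by apply: continuous_in_subspaceT => x _; exact: cts.
  apply: (le_trans (le_normr_Rintegral _ i1)) => //.
  have c1 (x : R) : {for x, continuous (fun=> 1 : R)} by exact: cvg_cst.
  have [i2 e2] := @FTC2_is_derive id (fun=> 1) _ _ TT
    (fun x _ => is_derive_id x (1 : R)) (fun x _ => c1 x).
  have -> : 2 * T = \int[mu]_(y in `[- T, T]) 1 by rewrite [RHS]e2; ring.
  apply: le_Rintegral => //.
  - exact: (integrable_norm i1).
  move=> y /= yT; have /andP[p0 p1] := parabola_bound T0 yT.
  rewrite normrM ger0_norm// mulr_ile1//.
  by rewrite ler_norml cos_geN1 cos_le1.
have w0 : w != 0 by apply: contraTneq Tw => ->; rewrite mulr0 normr0 -leNgt.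
have T0' : T != 0 by rewrite gt_eqF.
(* Primitive obtained by two integrations by parts. *)
pose G (y : R) := (1 - (y / T) ^+ 2) * (sin (w * y) / w) - 2 * y * cos (w * y) / (T ^+ 2 * w ^+ 2)
    + 2 * sin (w * y) / (T ^+ 2 * w ^+ 3).
have D (y : R) : is_derive y (1 : R) G ((1 - (y / T) ^+ 2) * cos (w * y)).
  rewrite /G; apply: is_derive_eq; rewrite /GRing.scale/=; field.
  by rewrite T0' w0.
have [_ e] := FTC2_is_derive TT (fun x _ => D x) (fun x _ => cts x).
rewrite /parabola_ft e /G mulrN sinN cosN.
set X := T * w in Tw *.
have -> : sin (w * T) = sin X by rewrite mulrC.
have -> : cos (w * T) = cos X by rewrite mulrC.
rewrite (_ : _ - _ = T * (4 * (sin X / X ^+ 3 - cos X / X ^+ 2))); last first.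
  by rewrite /X; field; rewrite T0' w0.
clearbody X.
rewrite normrM (gtr0_norm T0) (_ : 20 * _ = T * (20 / (1 + X ^+ 2))); last by ring.
rewrite ler_pM2l//.
have X0 : 0 < `|X| by lra.
rewrite normrM (ger0_norm (ler0n R 4)).
have h : `|sin X / X ^+ 3 - cos X / X ^+ 2| <= 2 / `|X| ^+ 2.
  apply: (le_trans (ler_normB _ _)).
  rewrite !normrM !normfV !normrX.
  have s1 : `|sin X| <= 1 by rewrite ler_norml sin_geN1 sin_le1.
  have c1 : `|cos X| <= 1 by rewrite ler_norml cos_geN1 cos_le1.
  have X2 : 0 < `|X| ^+ 2 by rewrite exprn_gt0.
  rewrite [2](_ : _ = 1 + 1)// mulrDl; apply: lerD; last by rewrite ler_pM2r ?invr_gt0.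
  apply: ler_pM => //.
  rewrite lef_pV2 ?posrE ?exprn_gt0// exprS ler_peMl ?ltW//.
apply: (@le_trans _ _ (4 * (2 / `|X| ^+ 2))); first by rewrite ler_pM2l.
have -> : X ^+ 2 = `|X| ^+ 2 by rewrite real_normK ?num_real.
have X2 : 1 < `|X| ^+ 2 by rewrite exprn_egt1.
rewrite mulrA ler_pdivrMr; last by lra.
rewrite mulrAC ler_pdivlMr; lra.
Qed.

Lemma measurable_cos : measurable_fun setT (@cos R).
Proof. by apply: continuous_measurable_fun; exact: continuous_cos. Qed.

Lemma measurable_sin : measurable_fun setT (@sin R).
Proof. by apply: continuous_measurable_fun; exact: continuous_sin. Qed.

Lemma normr_Rintegral_le (f : R -> R) : measurable_fun setT f ->
  (`|\int[mu]_x f x|%:E <= \int[mu]_x `|f x|%:E)%E.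
Proof.
move=> mf; rewrite /Rintegral.
have /(le_trans _) := le_abse_integral mu measurableT ((measurable_EFinP _ _).2 mf).
(* An infinite integral has [fine] value 0, so measurability alone is enough. *)
by apply; case: (\int[mu]_x _)%E => //= *; rewrite ?normr0 ?leey.
Qed.

(** Real and imaginary parts of the transform of a real function; Plancherel's inequality is first
    proved for these. *)
Definition fcos (u : R -> R) (y : R) : R := \int[mu]_w (cos (w * y) * u w).
Definition fsin (u : R -> R) (y : R) : R := \int[mu]_w (sin (w * y) * u w).

Lemma measurable_cosM : measurable_fun setT (fun z : R * R => cos (z.1 * z.2)).
Proof.
apply: (measurableT_comp (f := cos)); first exact: measurable_cos.
by apply: measurable_funM; [exact: measurable_fst|exact: measurable_snd].
Qed.

Lemma measurable_sinM : measurable_fun setT (fun z : R * R => sin (z.1 * z.2)).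
Proof.
apply: (measurableT_comp (f := sin)); first exact: measurable_sin.
by apply: measurable_funM; [exact: measurable_fst|exact: measurable_snd].
Qed.

Lemma measurable_cosMr y : measurable_fun setT (fun w : R => cos (w * y)).
Proof. exact: (measurableT_comp measurable_cosM (pair2_measurable y)). Qed.

Lemma measurable_sinMr y : measurable_fun setT (fun w : R => sin (w * y)).
Proof. exact: (measurableT_comp measurable_sinM (pair2_measurable y)). Qed.

Lemma norm_cos_le1 (x : R) : `|cos x| <= 1.
Proof. by rewrite ler_norml cos_geN1 cos_le1. Qed.

Lemma norm_sin_le1 (x : R) : `|sin x| <= 1.
Proof. by rewrite ler_norml sin_geN1 sin_le1. Qed.

Lemma parabola01 (T y : R) : 0 < T ->
  0 <= ((fun y : R => 1 - (y / T) ^+ 2) \_ `[- T, T]) y <= 1.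
Proof.
move=> T0; rewrite patchE; case: ifPn => [|_]; last by rewrite lexx ler01.
by rewrite inE /=; exact: parabola_bound.
Qed.

Lemma measurable_parabola (T : R) :
  measurable_fun setT ((fun y : R => 1 - (y / T) ^+ 2) \_ `[- T, T]).
Proof.
apply/(measurable_restrictT _ _).1 => //.
by apply: measurable_funTS; apply: continuous_measurable_fun; exact: parabola_continuous.
Qed.

Lemma parabola_integrable (T : R) : 0 < T ->
  mu.-integrable setT (EFin \o ((fun y : R => 1 - (y / T) ^+ 2) \_ `[- T, T])).
Proof.
move=> T0; rewrite -restrict_EFin; apply/integrable_restrict => //=; rewrite ?setTI ?setIT.
apply: continuous_compact_integrable; first exact: segment_compact.
by apply: continuous_in_subspaceT => y _; exact: parabola_continuous.
Qed.

Section trig_transform.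
Variable u : R -> R.
Hypothesis iu : mu.-integrable setT (EFin \o u).

Let mu_u : measurable_fun setT u.
Proof. by apply/measurable_EFinP; exact: measurable_int iu. Qed.

Lemma integrable_cosM y : mu.-integrable setT (EFin \o fun w => cos (w * y) * u w).
Proof.
apply: (@integrable_bounded_mul _ _ _ _ _ _ 1) => //; first exact: measurable_cosMr.
by move=> w; exact: norm_cos_le1.
Qed.

Lemma integrable_sinM y : mu.-integrable setT (EFin \o fun w => sin (w * y) * u w).
Proof.
apply: (@integrable_bounded_mul _ _ _ _ _ _ 1) => //; first exact: measurable_sinMr.
by move=> w; exact: norm_sin_le1.
Qed.

Lemma measurable_fcos : measurable_fun setT (fcos u).
Proof.
apply: (@measurable_param_integral _ _ _ _ _ mu (fun y w => cos (w * y) * u w)) => [|y]; last exact: integrable_cosM.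
apply: measurable_funM; first exact: (measurableT_comp measurable_cosM (@measurable_swap _ _ _ _)).
by apply: measurableT_comp => //; exact: measurable_snd.
Qed.

Lemma measurable_fsin : measurable_fun setT (fsin u).
Proof.
apply: (@measurable_param_integral _ _ _ _ _ mu (fun y w => sin (w * y) * u w)) => [|y]; last exact: integrable_sinM.
apply: measurable_funM; first exact: (measurableT_comp measurable_sinM (@measurable_swap _ _ _ _)).
by apply: measurableT_comp => //; exact: measurable_snd.
Qed.

Let M := \int[mu]_w `|u w|.

Lemma fcos_le y : `|fcos u y| <= M.
Proof.
apply: (le_trans (le_normr_Rintegral _ (integrable_cosM y))) => //.
apply: le_Rintegral => //; [exact: (integrable_norm (integrable_cosM y))|exact: (integrable_norm iu)|].
by move=> w _ /=; rewrite normrM ler_piMl// norm_cos_le1.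
Qed.

Lemma fsin_le y : `|fsin u y| <= M.
Proof.
apply: (le_trans (le_normr_Rintegral _ (integrable_sinM y))) => //.
apply: le_Rintegral => //; [exact: (integrable_norm (integrable_sinM y))|exact: (integrable_norm iu)|].
by move=> w _ /=; rewrite normrM ler_piMl// norm_sin_le1.
Qed.

Section weighted.
Variable T : R.
Hypothesis T0 : 0 < T.

Let p : R -> R := (fun y => 1 - (y / T) ^+ 2) \_ `[- T, T].
Let p01 y : 0 <= p y <= 1 := parabola01 y T0.
Let mp : measurable_fun setT p := measurable_parabola T.
Let ip : mu.-integrable setT (EFin \o p) := parabola_integrable T0.

Let ft_p w : \int[mu]_y (p y * cos (w * y)) = parabola_ft T w.
Proof.
rewrite /parabola_ft [RHS]Rintegral_mkcond; apply: eq_Rintegral => y _.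
by rewrite /p !patchE; case: ifP => //; rewrite mul0r.
Qed.

(** Real part of exp(-iwy) times the transform of u at y. Multiplied by u(w) and integrated over w,
    it gives the squared modulus of that transform. *)
Let S w y := fcos u y * cos (w * y) + fsin u y * sin (w * y).

Let SE w y : S w y = \int[mu]_x (cos ((w - x) * y) * u x).
Proof.
rewrite /S /fcos /fsin mulrC [X in _ + X]mulrC.
rewrite -!RintegralZl//; [|exact: integrable_sinM|exact: integrable_cosM].
rewrite -RintegralD//.
- by apply: eq_Rintegral => x _; rewrite mulrBl cosB; ring.
- by have := integrableZl measurableT (cos (w * y)) (integrable_cosM y).
- by have := integrableZl measurableT (sin (w * y)) (integrable_sinM y).
Qed.

Let M0 : 0 <= M. Proof. by apply: Rintegral_ge0 => ? _. Qed.

Let S_le w y : `|S w y| <= 2 * M.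
Proof.
rewrite (le_trans (ler_normD _ _))// !normrM [2](_ : _ = 1 + 1)// mulrDl mul1r.
apply: lerD; (rewrite -[leRHS]mulr1; apply: ler_pM => //).
- exact: fcos_le.
- exact: norm_cos_le1.
- exact: fsin_le.
- exact: norm_sin_le1.
Qed.

Let mS : measurable_fun setT (fun z : R * R => S z.1 z.2).
Proof.
apply: measurable_funD; apply: measurable_funM.
- by apply: measurableT_comp; [exact: measurable_fcos|exact: measurable_snd].
- exact: measurable_cosM.
- by apply: measurableT_comp; [exact: measurable_fsin|exact: measurable_snd].
- exact: measurable_sinM.
Qed.

Let v w := \int[mu]_y (p y * S w y).

Let vE w : v w = \int[mu]_x (u x * parabola_ft T (w - x)).
Proof.
rewrite /v; transitivity (\int[mu]_y \int[mu]_x (p y * cos ((w - x) * y) * u x)).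
  apply: eq_Rintegral => y _; rewrite SE -RintegralZl//.
    by apply: eq_Rintegral => x _; rewrite mulrA.
  apply: (@integrable_bounded_mul _ _ _ _ _ _ 1) => //.
    apply: (measurableT_comp (f := cos)); first exact: measurable_cos.
    by apply: measurable_funM => //; exact: measurable_funB.
  by move=> x; exact: norm_cos_le1.
rewrite (@dominated_Fubini _ _ _ _ _ mu mu (fun y x => p y * cos ((w - x) * y) * u x) p (fun x => `|u x|)) //.
- apply: eq_Rintegral => x _.
  rewrite -ft_p -RintegralZl//.
    by apply: eq_Rintegral => y _; rewrite mulrC.
  have := (@integrable_bounded_mul _ _ _ mu (fun y => cos ((w - x) * y)) p 1).
  rewrite (_ : (fun y => cos ((w - x) * y) * p y) = (fun y => p y * cos ((w - x) * y))); last first.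
    by apply/funext => y; rewrite mulrC.
  apply => //; last by move=> y; exact: norm_cos_le1.
  apply: (measurableT_comp (f := cos)); first exact: measurable_cos.
  exact: measurable_funM.
- apply: measurable_funM; last by apply: measurableT_comp => //; exact: measurable_snd.
  apply: measurable_funM; first by apply: measurableT_comp => //; exact: measurable_fst.
  apply: (measurableT_comp (f := cos)); first exact: measurable_cos.
  apply: measurable_funM; last exact: measurable_fst.
  by apply: measurable_funB => //; exact: measurable_snd.
- exact: (integrable_norm iu).
- move=> y x; rewrite !normrM ler_wpM2r//.
  have /andP[p0 p1] := p01 y; rewrite (ger0_norm p0) ler_piMr//; exact: norm_cos_le1.
Qed.

(** The squared modulus of the transform is the double integral of u(w) u(x) cos((w - x) y);
    integrating in y against p first turns the cosine into [parabola_ft]. *)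
Lemma weighted_energyE :
  \int[mu]_y (p y * (fcos u y ^+ 2 + fsin u y ^+ 2)) =
  \int[mu]_w (u w * \int[mu]_x (u x * parabola_ft T (w - x))).
Proof.
transitivity (\int[mu]_y \int[mu]_w (u w * (p y * S w y))).
  apply: eq_Rintegral => y _.
  rewrite (_ : (fun w => _) = fun w => p y * (fcos u y * (cos (w * y) * u w) + fsin u y * (sin (w * y) * u w))); last first.
    by apply/funext => w; rewrite /S; ring.
  have i1 := integrableZl measurableT (fcos u y) (integrable_cosM y).
  have i2 := integrableZl measurableT (fsin u y) (integrable_sinM y).
  rewrite RintegralZl//; last by have := integrableD measurableT i1 i2.
  rewrite RintegralD//.
  rewrite (@RintegralZl _ _ _ mu setT (fun w => cos (w * y) * u w))//; last exact: integrable_cosM.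
  rewrite (@RintegralZl _ _ _ mu setT (fun w => sin (w * y) * u w))//; last exact: integrable_sinM.
rewrite (@dominated_Fubini _ _ _ _ _ mu mu (fun y w => u w * (p y * S w y)) (fun y => (2 * M) * p y) (fun w => `|u w|)) //.
- apply: eq_Rintegral => w _; rewrite -vE RintegralZl//.
  rewrite (_ : (fun y => p y * S w y) = (fun y => S w y * p y)); last first.
    by apply/funext => y; rewrite mulrC.
  apply: (@integrable_bounded_mul _ _ _ _ _ _ (2 * M)) => //.
  exact: (measurableT_comp mS (pair1_measurable w)).
- apply: measurable_funM; first by apply: measurableT_comp => //; exact: measurable_snd.
  apply: measurable_funM; first by apply: measurableT_comp => //; exact: measurable_fst.
  exact: (measurableT_comp mS (@measurable_swap _ _ _ _)).
- by have := integrableZl measurableT (2 * M) ip.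
- exact: (integrable_norm iu).
- move=> y w; rewrite !normrM mulrC ler_wpM2r//.
  have /andP[p0 p1] := p01 y; rewrite (ger0_norm p0) mulrC ler_wpM2r//; exact: S_le.
Qed.

Let mft : measurable_fun setT (parabola_ft T).
Proof.
rewrite (_ : parabola_ft T = fun w => \int[mu]_y (p y * cos (w * y))); last first.
  by apply/funext => w; rewrite -ft_p.
apply: (@measurable_param_integral _ _ _ _ _ mu (fun w y : R => p y * cos (w * y))) => [|w].
  apply: measurable_funM; last exact: measurable_cosM.
  by apply: measurableT_comp => //; exact: measurable_snd.
rewrite (_ : (fun y => _) = (fun y => cos (w * y) * p y)); last first.
  by apply/funext => y; rewrite mulrC.
apply: (@integrable_bounded_mul _ _ _ _ _ _ 1) => //; last by move=> y; exact: norm_cos_le1.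
exact: (measurableT_comp measurable_cosM (pair1_measurable w)).
Qed.

Let k x := 20 * (T / (1 + (T * x) ^+ 2)).

Let k_ge0 x : 0 <= k x.
Proof. by rewrite mulr_ge0// divr_ge0 ?(ltW T0)// addr_ge0// sqr_ge0. Qed.

Let mk : measurable_fun setT (fun z : R * R => k (z.1 - z.2)).
Proof.
apply: (measurableT_comp (f := k)); last first.
  by apply: measurable_funB; [exact: measurable_fst|exact: measurable_snd].
apply: continuous_measurable_fun => x; apply: cvgM; first exact: cvg_cst.
apply: cvgM; first exact: cvg_cst.
apply: cvgV; first by rewrite gt_eqF// ltr_wpDr// sqr_ge0.
apply: cvgD; first exact: cvg_cst.
apply: (@cvg_comp _ _ _ (fun x => T * x) (fun x : R => x ^+ 2)); last exact: exprn_continuous.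
by apply: cvgM; [exact: cvg_cst|exact: cvg_id].
Qed.

Let k_sym w x : k (w - x) = k (x - w).
Proof. by rewrite /k; congr (20 * (T / (1 + _))); ring. Qed.

Let mk1 (w : R) : measurable_fun (setT : set R) (fun x : R => k (w - x)).
Proof. exact: (measurableT_comp mk (pair1_measurable w)). Qed.

Let int_k w : (\int[mu]_x (k (w - x))%:E <= (20 * pi)%:E)%E.
Proof.
rewrite (_ : (fun x => _) = (fun x => 20%:E * (T / (1 + (T * (x - w)) ^+ 2))%:E)%E); last first.
  apply/funext => x; rewrite /k -EFinM; congr (20 * (T / (1 + _)))%:E; ring.
rewrite ge0_integralZl//.
- by rewrite EFinM lee_wpmul2l// ?lee_fin//; exact: cauchy_density_le.
- apply/measurable_EFinP.
  apply: (eq_measurable_fun (fun x : R => 20^-1 * k (w - x))).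
    by move=> x _; rewrite /k mulKf//; congr (T / (1 + _)); ring.
  by apply: measurable_funM => //; exact: mk1.
- by move=> x _; rewrite lee_fin divr_ge0 ?(ltW T0)// addr_ge0// sqr_ge0.
Qed.

(** Schur's test: |u(w) u(x)| <= (u(w)^2 + u(x)^2) / 2, and the symmetric kernel k(w - x) that
    dominates [parabola_ft] has mass at most 20 pi in either variable. *)
Lemma weighted_energy_le :
  ((\int[mu]_y (p y * (fcos u y ^+ 2 + fsin u y ^+ 2)))%:E <=
   (20 * pi)%:E * \int[mu]_w (u w ^+ 2)%:E)%E.
Proof.
rewrite weighted_energyE.
have m1 : measurable_fun setT (fun z : R * R => u z.2 * parabola_ft T (z.1 - z.2)).
  apply: measurable_funM; first by apply: measurableT_comp => //; exact: measurable_snd.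
  apply: measurableT_comp => //.
  by apply: measurable_funB; [exact: measurable_fst|exact: measurable_snd].
have i1 w : mu.-integrable setT (EFin \o fun x => u x * parabola_ft T (w - x)).
  rewrite (_ : (fun x => u x * _) = (fun x => parabola_ft T (w - x) * u x)); last first.
    by apply/funext => y; rewrite mulrC.
  apply: (@integrable_bounded_mul _ _ _ _ _ _ (20 * T)) => //.
    by apply: measurableT_comp => //; exact: measurable_funB.
  move=> x; apply: (le_trans (parabola_ft_le _ T0)); rewrite ler_pM2l//.
  rewrite ler_pdivrMr; last by rewrite ltr_wpDr// sqr_ge0.
  by rewrite ler_peMr ?(ltW T0)// lerDl sqr_ge0.
have m2 : measurable_fun setT (fun w : R => \int[mu]_x (u x * parabola_ft T (w - x))).
  exact: (@measurable_param_integral _ _ _ _ _ mu (fun w x : R => u x * parabola_ft T (w - x))).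
have mq : measurable_fun setT (fun w => u w ^+ 2 / 2) by apply: measurable_funM => //; apply: measurable_funX.
have mA : measurable_fun setT (fun z : R * R => (u z.1 ^+ 2 / 2 * k (z.1 - z.2))%:E).
  by apply/measurable_EFinP; apply: measurable_funM => //; apply: (measurableT_comp mq); exact: measurable_fst.
have mB : measurable_fun setT (fun z : R * R => (u z.2 ^+ 2 / 2 * k (z.1 - z.2))%:E).
  by apply/measurable_EFinP; apply: measurable_funM => //; apply: (measurableT_comp mq); exact: measurable_snd.
have pA z : (0 <= (u z.1 ^+ 2 / 2 * k (z.1 - z.2))%:E)%E by rewrite lee_fin mulr_ge0// divr_ge0// sqr_ge0.
have pB z : (0 <= (u z.2 ^+ 2 / 2 * k (z.1 - z.2))%:E)%E by rewrite lee_fin mulr_ge0// divr_ge0// sqr_ge0.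
have mS2 := emeasurable_funD mA mB.
have pS2 z : (0 <= (u z.1 ^+ 2 / 2 * k (z.1 - z.2))%:E + (u z.2 ^+ 2 / 2 * k (z.1 - z.2))%:E)%E by rewrite adde_ge0.
apply: (@le_trans _ _ (\int[mu]_w \int[mu]_x ((u w ^+ 2 / 2 * k (w - x))%:E + (u x ^+ 2 / 2 * k (w - x))%:E))%E).
  apply: (@le_trans _ _ (`|\int[mu]_w (u w * \int[mu]_x (u x * parabola_ft T (w - x)))|%R%:E)).
    by rewrite lee_fin ler_norm.
  apply: (le_trans (normr_Rintegral_le _)); first exact: measurable_funM.
  apply: ge0_le_integral => //.
  - by apply/measurable_EFinP; apply: measurableT_comp => //; exact: measurable_funM.
  - exact: (measurable_fun_fubini_tonelli_F (m2 := mu) _ mS2 pS2).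
  move=> w _; rewrite normrM EFinM.
  apply: (@le_trans _ _ (`|u w|%:E * \int[mu]_x `|u x * parabola_ft T (w - x)|%:E)%E).
    rewrite lee_wpmul2l// ?lee_fin//.
    by apply: normr_Rintegral_le; apply/measurable_EFinP; exact: measurable_int (i1 w).
  have mi : measurable_fun setT (fun x => `|u x * parabola_ft T (w - x)|%:E).
    by apply/measurable_EFinP; apply: measurableT_comp => //; apply/measurable_EFinP; exact: measurable_int (i1 w).
  rewrite -ge0_integralZl//.
  apply: ge0_le_integral => //.
  - exact: emeasurable_funM.
  - apply: emeasurable_funD; apply/measurable_EFinP; apply: measurable_funM => //; exact: mk1.
  move=> x _; rewrite -EFinM -EFinD lee_fin normrM -mulrDl.
  rewrite mulrA; apply: ler_pM => //; last exact: parabola_ft_le.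
  have : 0 <= (`|u w| - `|u x|) ^+ 2 by exact: sqr_ge0.
  by rewrite -(real_normK (num_real (u w))) -(real_normK (num_real (u x))); lra.
have half : (\int[mu]_w \int[mu]_x (u w ^+ 2 / 2 * k (w - x))%:E <= (20 * pi)%:E * \int[mu]_w (u w ^+ 2 / 2)%:E)%E.
  rewrite -ge0_integralZl//; last 3 first.
    by apply/measurable_EFinP.
    by move=> w _; rewrite lee_fin divr_ge0// sqr_ge0.
    by rewrite lee_fin mulr_ge0// pi_ge0.
  apply: ge0_le_integral => //.
  - by move=> w _; apply: integral_ge0 => x _; exact: (pA (w, x)).
  - exact: (measurable_fun_fubini_tonelli_F (m2 := mu) _ mA pA).
  - by apply: emeasurable_funM => //; apply/measurable_EFinP.
  move=> w _; under eq_integral do rewrite EFinM.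
  rewrite ge0_integralZl//; last 3 first.
    by apply/measurable_EFinP; exact: mk1.
    by move=> x _; rewrite lee_fin; exact: k_ge0.
    by rewrite lee_fin divr_ge0// sqr_ge0.
  by rewrite muleC lee_wpmul2r// lee_fin divr_ge0// sqr_ge0.
have half' : (\int[mu]_w \int[mu]_x (u x ^+ 2 / 2 * k (w - x))%:E <= (20 * pi)%:E * \int[mu]_w (u w ^+ 2 / 2)%:E)%E.
  rewrite [leLHS](fubini_tonelli (m1 := mu) (m2 := mu) (fun z : R * R => (u z.2 ^+ 2 / 2 * k (z.1 - z.2))%:E) mB pB).
  by under eq_integral => x _ do under eq_integral => w _ do rewrite /= k_sym.
have -> : (\int[mu]_w \int[mu]_x ((u w ^+ 2 / 2 * k (w - x))%:E + (u x ^+ 2 / 2 * k (w - x))%:E) =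
  \int[mu]_w \int[mu]_x (u w ^+ 2 / 2 * k (w - x))%:E + \int[mu]_w \int[mu]_x (u x ^+ 2 / 2 * k (w - x))%:E)%E.
  rewrite -ge0_integralD//; last 4 first.
  - by move=> w _; apply: integral_ge0 => x _; exact: (pA (w, x)).
  - exact: (measurable_fun_fubini_tonelli_F (m2 := mu) _ mA pA).
  - by move=> w _; apply: integral_ge0 => x _; exact: (pB (w, x)).
  - exact: (measurable_fun_fubini_tonelli_F (m2 := mu) _ mB pB).
  apply: eq_integral => w _; rewrite ge0_integralD//.
  - by move=> x _; exact: (pA (w, x)).
  - exact: (measurableT_comp mA (pair1_measurable w)).
  - by move=> x _; exact: (pB (w, x)).
  - exact: (measurableT_comp mB (pair1_measurable w)).
apply: (le_trans (leeD half half')).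
rewrite -ge0_muleDr; [|by apply: integral_ge0 => w _; rewrite lee_fin divr_ge0// sqr_ge0..].
rewrite -ge0_integralD//; last 4 first.
- by move=> w _; rewrite lee_fin divr_ge0// sqr_ge0.
- exact/measurable_EFinP.
- by move=> w _; rewrite lee_fin divr_ge0// sqr_ge0.
- exact/measurable_EFinP.
by under eq_integral do rewrite -EFinD -splitr.
Qed.

End weighted.

Lemma energy_itv_le (T : R) : 0 < T ->
  (\int[mu]_(y in `[(- T)%R, T]) (fcos u y ^+ 2 + fsin u y ^+ 2)%:E <=
   (40 * pi)%:E * \int[mu]_w (u w ^+ 2)%:E)%E.
Proof.
move=> T0; have T2 : 0 < 2 * T by rewrite mulr_gt0.
pose q y := fcos u y ^+ 2 + fsin u y ^+ 2.
have mq : measurable_fun setT q.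
  by apply: measurable_funD; apply: measurable_funX; [exact: measurable_fcos|exact: measurable_fsin].
have q0 y : 0 <= q y by rewrite addr_ge0// sqr_ge0.
have qM y : q y <= 2 * M ^+ 2.
  rewrite /q mulr2n mulrDl mul1r.
  rewrite -(real_normK (num_real (fcos u y))) -(real_normK (num_real (fsin u y))).
  have M0 : 0 <= M by exact: le_trans (fcos_le y).
  by apply: lerD; [have h := fcos_le y|have h := fsin_le y]; apply: lerXn2r; rewrite ?nnegrE.
(* Half-width 2 T: on [-T, T] this weight is at least 3/4, so twice the weight dominates 1 there,
   and 20 pi becomes 40 pi. *)
pose p := (fun y => 1 - (y / (2 * T)) ^+ 2) \_ `[- (2 * T), 2 * T].
have ip := parabola_integrable T2.
have p01 y : 0 <= p y <= 1 by exact: parabola01.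
have ipq : mu.-integrable setT (EFin \o fun y => p y * q y).
  rewrite (_ : (fun y => _) = (fun y => q y * p y)); last by apply/funext => y; rewrite mulrC.
  apply: (@integrable_bounded_mul _ _ _ _ _ _ (2 * M ^+ 2)) => //.
  by move=> y; rewrite ger0_norm.
have pq0 y : 0 <= p y * q y by rewrite mulr_ge0//; case/andP: (p01 y).
have := weighted_energy_le T2.
rewrite -/p -/(Rintegral _ _ _) /Rintegral fineK; last exact: (integrable_fin_num measurableT ipq).
move=> /(lee_wpmul2l (_ : 0%E <= 2%:E)%E) h.
apply: (le_trans (le_trans _ (h _))).
- rewrite -ge0_integralZl//; last 2 first.
    exact: (measurable_int mu ipq).
    by move=> y _; rewrite lee_fin; exact: pq0.
  rewrite [leLHS]integral_mkcond; apply: ge0_le_integral => //.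
  + by move=> y _; rewrite patchE; case: ifP => // _; rewrite lee_fin; exact: q0.
  + by apply/(measurable_restrictT _ _).1 => //; apply: measurable_funTS; exact/measurable_EFinP.
  + by apply: emeasurable_funM => //; exact: (measurable_int mu ipq).
  move=> y _; rewrite patchE; case: ifPn; last first.
    by move=> _; rewrite -EFinM lee_fin mulr_ge0 ?ler0n//; exact: pq0.
  rewrite inE /= in_itv/= => /andP[Ty yT].
  rewrite -EFinM lee_fin mulrA -/(q y) ler_peMl//.
  rewrite /p patchE mem_set; last by rewrite /= in_itv/=; apply/andP; split; lra.
  have : `|y / (2 * T)| <= 2^-1.
    rewrite normrM normfV (gtr0_norm T2) ler_pdivrMr// mulKf// ler_norml; exact/andP.
  move=> /(lerXn2r 2 (normr_ge0 _) _) => /(_ (_ : 0 <= _)).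
  by rewrite real_normK ?num_real// => /(_ _); lra.
- by rewrite lee_fin.
- by rewrite muleA -EFinM; have -> : 2 * (20 * pi) = 40 * pi :> R by ring.
Qed.

Lemma plancherel_le :
  (\int[mu]_y (fcos u y ^+ 2 + fsin u y ^+ 2)%:E <= (40 * pi)%:E * \int[mu]_w (u w ^+ 2)%:E)%E.
Proof.
apply: ge0_integral_le_itv.
- apply/measurable_EFinP.
  by apply: measurable_funD; apply: measurable_funX; [exact: measurable_fcos|exact: measurable_fsin].
- by move=> y; rewrite lee_fin addr_ge0// sqr_ge0.
(* For n = 0 the interval is a single point, while [energy_itv_le] asks for T > 0. *)
move=> [|n]; last exact: energy_itv_le.
rewrite mulr0n oppr0 set_itv1 integral_set1 mule_ge0 ?lee_fin ?mulr_ge0 ?pi_ge0//.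
by apply: integral_ge0 => y _; rewrite lee_fin sqr_ge0.
Qed.

End trig_transform.

End ftc_misc.

Section integral_shift.
Context {R : realType}.
Local Notation mu := (@lebesgue_measure R).

(** The image of Lebesgue measure under a translation has the same values on the intervals ]a, b],
    which determine it. *)
Lemma ge0_integral_shift (k : R -> \bar R) (c : R) :
  measurable_fun setT k -> (forall x, 0 <= k x)%E ->
  (\int[mu]_x k (c + x)%R = \int[mu]_x k x)%E.
Proof.
move=> mk k0.
have mc : measurable_fun (setT : set (measurableTypeR R)) (fun x => c + x : measurableTypeR R).
  by apply: measurable_funD.
pose sh : {mfun measurableTypeR R >-> measurableTypeR R} :=
  HB.pack (fun x => c + x : measurableTypeR R) (isMeasurableFun.Build _ _ _ _ _ mc).
have E : forall A, measurable A -> mu A = pushforward mu sh A.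
  apply: lebesgue_measure_unique => _ [[a b] _ <-] /=.
  rewrite /pushforward (_ : _ @^-1` _ = `]a - c, b - c]%classic); last first.
    by apply/seteqP; split => x /=; rewrite !in_itv/= ltrBlDl lerBrDl.
  rewrite !lebesgue_measure_itv/= !lte_fin ltrD2r.
  by case: ifP => // _; rewrite -!EFinB; congr EFin; ring.
rewrite [RHS](eq_measure_integral (pushforward mu sh)); last by move=> A mA _; exact: E.
by rewrite ge0_integral_pushforward.
Qed.

End integral_shift.

(** * Independence and risk of empirical means *)

Section pairs.
Context d d1 d2 (T : measurableType d) (S1 : measurableType d1) (S2 : measurableType d2)
  (R : realType) (P : probability T R).
Variables (X : {mfun T >-> S1}) (Y : {mfun T >-> S2}).

Let mXY : measurable_fun setT (fun t => (X t, Y t)).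
Proof. exact: measurable_fun_pair. Qed.

Let XY : {mfun T >-> (S1 * S2)%type} :=
  HB.pack (fun t => (X t, Y t)) (isMeasurableFun.Build _ _ _ _ _ mXY).

(** Two finite measures, the law of (X, Y) restricted to E and P(E) times that law, agree on the
    rectangles, a generating family closed under intersection. *)
Lemma indep_event_pair (E : set T) : measurable E ->
  (forall A B, measurable A -> measurable B ->
     P (X @^-1` A `&` Y @^-1` B `&` E) = P (X @^-1` A `&` Y @^-1` B) * P E)%E ->
  forall C, measurable C ->
    P ((fun t => (X t, Y t)) @^-1` C `&` E) = (P ((fun t => (X t, Y t)) @^-1` C) * P E)%E.
Proof.
move=> mE H C mC.
have PE0 : 0 <= fine (P E) by rewrite fine_ge0.
have PEE : P E = (fine (P E))%:E by rewrite fineK// fin_num_measure.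
pose m1 : {measure set (S1 * S2) -> \bar R} :=
  measure_function_pushforward__canonical__measure_function_Measure (mrestr P mE) mXY.
pose m2 := mscale (NngNum PE0) (distribution P XY).
pose G : set (set (S1 * S2)) := [set A `*` B | A in measurable & B in measurable].
suff : m1 C = m2 C.
  by rewrite /m1 /m2 /distribution /pushforward /mrestr /mscale/= -PEE muleC.
apply: (measure_unique G (fun=> setT)) => //.
- exact: measurable_prod_measurableType.
- move=> _ _ [A1 mA1 [B1 mB1 <-]] [A2 mA2 [B2 mB2 <-]].
  rewrite -setXI; exists (A1 `&` A2); first exact: measurableI.
  by exists (B1 `&` B2) => //; exact: measurableI.
- by move=> _; exists setT => //; exists setT => //; rewrite setXTT.
- by rewrite bigcup_const.
- move=> _ [A mA [B mB <-]].
  have -> : m1 (A `*` B) = P (X @^-1` A `&` Y @^-1` B `&` E) by [].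
  by rewrite H// [in LHS]PEE muleC.
- move=> _; have -> : m1 setT = P (XY @^-1` setT `&` E) by [].
  by rewrite preimage_setT setTI (le_lt_trans (probability_le1 _ _)) ?ltry.
Qed.

Hypothesis indepXY : forall A B, measurable A -> measurable B ->
  (P (X @^-1` A `&` Y @^-1` B) = P (X @^-1` A) * P (Y @^-1` B))%E.

Lemma indep_joint_law (C : set (S1 * S2)) : measurable C ->
  (distribution P X \x distribution P Y)%E C = distribution P XY C.
Proof. by apply: product_measure_unique => A B mA mB /=; exact: indepXY. Qed.

Lemma indep_ge0_integral (k : S1 * S2 -> \bar R) :
  measurable_fun setT k -> (forall z, 0 <= k z)%E ->
  (\int[P]_t k (X t, Y t) =
   \int[distribution P X]_x \int[distribution P Y]_y k (x, y))%E.
Proof.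
move=> mk k0.
have -> : (\int[P]_t k (X t, Y t) = \int[distribution P XY]_z k z)%E.
  by rewrite ge0_integral_distribution.
rewrite -(fubini_tonelli1 k)//.
by apply: eq_measure_integral => C mC _; exact/esym/indep_joint_law.
Qed.

Lemma indep_expectation (a : S1 -> R) (b : S2 -> R) :
  measurable_fun setT a -> measurable_fun setT b ->
  P.-integrable setT (EFin \o (a \o X)) -> P.-integrable setT (EFin \o (b \o Y)) ->
  P.-integrable setT (EFin \o (fun t => a (X t) * b (Y t))) /\
  \int[P]_t (a (X t) * b (Y t)) = (\int[P]_t a (X t)) * (\int[P]_t b (Y t)).
Proof.
move=> ma mb ia ib.
have mab : measurable_fun setT (fun z : S1 * S2 => a z.1 * b z.2).
  apply: measurable_funM; first by apply: measurableT_comp => //; exact: measurable_fst.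
  by apply: measurableT_comp => //; exact: measurable_snd.
have ia' : (distribution P X).-integrable setT (EFin \o a).
  by apply: integrable_pushforward => //; exact/measurable_EFinP.
have ib' : (distribution P Y).-integrable setT (EFin \o b).
  by apply: integrable_pushforward => //; exact/measurable_EFinP.
have iprod : (distribution P X \x distribution P Y)%E.-integrable setT (fun z => (a z.1 * b z.2)%:E).
  apply: (@dominated_integrable_prod _ _ _ _ _ _ _ (fun x y => a x * b y) (fun x => `|a x|) (fun y => `|b y|)) => //.
  - exact: (integrable_norm ia').
  - exact: (integrable_norm ib').
  - by move=> x y; rewrite normrM.
have iab : P.-integrable setT (EFin \o (fun t => a (X t) * b (Y t))).
  apply/integrableP; split.
    by apply/measurable_EFinP; apply: (measurableT_comp mab mXY).
  rewrite (indep_ge0_integral (k := fun z => (`|a z.1 * b z.2|)%:E))//.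
    by move/integrable12ltyP: iprod; apply; exact/measurable_EFinP.
  by apply/measurable_EFinP; apply: measurableT_comp.
split=> //.
have aE : \int[P]_t a (X t) = \int[distribution P X]_x a x.
  by rewrite /Rintegral integral_distribution//; exact/measurable_EFinP.
have bE : \int[P]_t b (Y t) = \int[distribution P Y]_y b y.
  by rewrite /Rintegral integral_distribution//; exact/measurable_EFinP.
have -> : \int[P]_t (a (X t) * b (Y t)) = fine (\int[distribution P XY]_z (a z.1 * b z.2)%:E)%E.
  by rewrite integral_distribution//; exact/measurable_EFinP.
rewrite (eq_measure_integral (distribution P X \x distribution P Y)%E); last first.
  by move=> C mC _; exact/esym/indep_joint_law.
rewrite -integral12_prod_meas1// /fubini_F/=.
transitivity (fine (\int[distribution P X]_x ((a x) * \int[distribution P Y]_y b y)%:E)%E).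
  congr fine; apply: eq_integral => x _.
  rewrite -(@RintegralZl _ _ _ _ setT b)// fineK//.
  have := integrableZl measurableT (a x) ib'.
  exact: (integrable_fin_num measurableT).
by rewrite aE bE -/(Rintegral _ _ _) RintegralZr.
Qed.

End pairs.

Section density.
Context d (T : measurableType d) (R : realType) (P : probability T R).
Local Notation mu := (@lebesgue_measure R).
Variables (X : {RV P >-> R}) (f : R -> R).
Hypotheses (f_pdf : is_pdf f) (X_f : has_pdf X f).

Lemma pdf_integrable (h : R -> R) : is_pdf h -> mu.-integrable setT (EFin \o h).
Proof.
move=> [mh h0 h1]; apply/integrableP; split; first exact/measurable_EFinP.
by under eq_integral => x _ do rewrite /= ger0_norm//; rewrite h1 ltry.
Qed.

(** [has_pdf] speaks of events only. It makes the law of X absolutely continuous, with f equal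
    almost everywhere to its Radon-Nikodym derivative, and this carries over to integrals. *)
Lemma pdf_ge0_integral (k : R -> \bar R) : measurable_fun setT k ->
  (forall x, 0 <= k x)%E ->
  (\int[P]_t k (X t) = \int[mu]_x (k x * (f x)%:E))%E.
Proof.
move=> mk k0; have [mf f0 f1] := f_pdf.
(* X is retyped with values in the measurable space that carries [mu]. *)
have mX : measurable_fun setT (X : T -> measurableTypeR R) by exact: (measurable_funPT X).
pose X' : {mfun T >-> measurableTypeR R} :=
  HB.pack (X : T -> measurableTypeR R) (isMeasurableFun.Build _ _ _ _ _ mX).
pose nu : {finite_measure set (measurableTypeR R) -> \bar R} := distribution P X'.
have dom : nu `<< mu.
  apply/null_content_dominatesP => A mA muA0.
  rewrite [LHS]X_f//; apply: null_set_integral => //.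
  by apply/measurable_EFinP; exact: measurable_funTS.
have -> : (\int[P]_t k (X t) = \int[nu]_x k x)%E.
  by rewrite ge0_integral_distribution.
rewrite -(Radon_Nikodym_SigmaFinite.change_of_variables dom)//.
have RN : ae_eq mu setT (Radon_Nikodym_SigmaFinite.f nu mu) (EFin \o f).
  apply: integral_ae_eq => //.
  - exact: Radon_Nikodym_SigmaFinite.f_integrable.
  - exact/measurable_EFinP.
  - by move=> A _ mA; rewrite -Radon_Nikodym_SigmaFinite.f_integral// [LHS]X_f.
apply: ae_eq_integral => //.
- apply: emeasurable_funM => //; apply: measurable_int.
  exact: Radon_Nikodym_SigmaFinite.f_integrable.
- by apply: emeasurable_funM => //; exact/measurable_EFinP.
- exact: ae_eqe_mul2l.
Qed.

Lemma bounded_rv_integrable (a : R -> R) : measurable_fun setT a -> (forall x, `|a x| <= 1) ->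
  P.-integrable setT (EFin \o (a \o X)).
Proof.
move=> ma a1; apply: (@le_integrable _ _ _ _ _ _ _ (cst 1%:E)) => //.
- by apply/measurable_EFinP; exact: measurableT_comp.
- by move=> t _ /=; rewrite lee_fin normr1.
- by apply: finite_measure_integrable_cst.
Qed.

Lemma pdf_bounded_integral (a : R -> R) : measurable_fun setT a -> (forall x, `|a x| <= 1) ->
  \int[P]_t a (X t) = \int[mu]_x (a x * f x).
Proof.
move=> ma a1; have [mf f0 f1] := f_pdf.
have i1 : P.-integrable setT (EFin \o cst (1 : R)) by apply: finite_measure_integrable_cst.
have ia := bounded_rv_integrable ma a1.
have if_ := pdf_integrable f_pdf.
have iaf : mu.-integrable setT (EFin \o fun x => a x * f x) by apply: (@integrable_bounded_mul _ _ _ _ _ _ 1).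
have a0 x : 0 <= 1 + a x by have := a1 x; rewrite ler_norml => /andP[? _]; lra.
(* Since 1 + a is non-negative, [pdf_ge0_integral] applies to it; the added 1 integrates to 1 on
   both sides and cancels. *)
have E : (\int[P]_t (1 + a (X t))%:E = \int[mu]_x ((1 + a x) * f x)%:E)%E.
  rewrite (pdf_ge0_integral (k := fun x => (1 + a x)%:E))//.
  by apply/measurable_EFinP; exact: measurable_funD.
have : \int[P]_t (1 + a (X t)) = \int[mu]_x (f x + a x * f x).
  by rewrite /Rintegral E; congr fine; apply: eq_integral => x _; congr EFin; ring.
rewrite !RintegralD//.
have -> : \int[P]_(_ in setT) (1 : R) = 1.
  by rewrite Rintegral_cst// [X in fine X](probability_setT P) mul1r.
have -> : \int[mu]_x f x = 1 by rewrite /Rintegral f1.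
exact: addrI.
Qed.

End density.

Section fourier_parts.
Context {R : realType}.
Local Notation mu := (@lebesgue_measure R).

Lemma rfourierE (f : R -> R) (w : R) : rfourier f w = fcos f w +i* fsin f w.
Proof.
rewrite /rfourier /fourier /cint /fcos /fsin; congr (_ +i* _); apply: eq_Rintegral => x _ /=.
  by rewrite mulr0 subr0 mulrC [x * w]mulrC mulrC.
by rewrite mulr0 add0r mulrC [x * w]mulrC mulrC.
Qed.

End fourier_parts.

Section model_sum.
Context d (T : measurableType d) (R : realType) (P : probability T R).
Local Notation mu := (@lebesgue_measure R).
Variables (X Z : {RV P >-> R}) (f g : R -> R).
Hypotheses (f_pdf : is_pdf f) (X_f : has_pdf X f) (g_pdf : is_pdf g) (Z_g : has_pdf Z g).
Hypothesis indepXZ : forall A B, measurable A -> measurable B ->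
  (P (X @^-1` A `&` Z @^-1` B) = P (X @^-1` A) * P (Z @^-1` B))%E.

(** Given X = x, the sum has the density g(y - x) <= G; translation invariance removes x, and the
    law of X has mass 1. *)
Lemma sum_ge0_integral_le (G : R) (k : R -> \bar R) : (forall x, g x <= G) ->
  measurable_fun setT k -> (forall x, 0 <= k x)%E ->
  (\int[P]_t k (X t + Z t)%R <= G%:E * \int[mu]_x k x)%E.
Proof.
move=> gG mk k0; have [mg g0 g1] := g_pdf.
have G0 : 0 <= G := le_trans (g0 0) (gG 0).
have mk2 : measurable_fun setT (fun z : R * R => k (z.1 + z.2)).
  apply: measurableT_comp => //.
  by apply: measurable_funD; [exact: measurable_fst|exact: measurable_snd].
rewrite (indep_ge0_integral indepXZ (k := fun z => k (z.1 + z.2)))//.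
apply: (@le_trans _ _ (\int[distribution P X]_x (G%:E * \int[mu]_x k x))%E); last first.
  rewrite integral_cst// [X in (_ * X)%E](_ : _ = 1%E) ?mule1//.
  exact: (@probability_setT _ _ _ (distribution P X)).
apply: ge0_le_integral => //.
- by move=> x _; apply: integral_ge0 => y _.
- exact: (measurable_fun_fubini_tonelli_F (m2 := distribution P Z) _ mk2 (fun z => k0 _)).
move=> x _ /=.
have mkx : measurable_fun setT (fun y => k (x + y)) by apply: measurableT_comp => //; exact: measurable_funD.
rewrite ge0_integral_distribution// -/(fun t => k (x + Z t)).
rewrite (pdf_ge0_integral g_pdf Z_g (k := fun y => k (x + y)%R))//.
rewrite -(ge0_integral_shift x mk k0) -ge0_integralZl//.
apply: ge0_le_integral => //.
- by move=> y _; rewrite mule_ge0// lee_fin.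
- by apply: emeasurable_funM => //; exact/measurable_EFinP.
- exact: emeasurable_funM.
- by move=> y _; rewrite muleC lee_wpmul2r// lee_fin.
Qed.

Let mcw (c : R -> R) (w : R) : measurable_fun setT c -> measurable_fun setT (fun x : R => c (w * x)).
Proof. by move=> mc; apply: (measurableT_comp mc); exact: measurable_funM. Qed.

Let ib (c : R -> R) (U : {RV P >-> R}) w : measurable_fun setT c -> (forall x, `|c x| <= 1) ->
  P.-integrable setT (EFin \o ((fun x => c (w * x)) \o U)).
Proof. by move=> mc c1; apply: bounded_rv_integrable => //; exact: mcw. Qed.

Let bE (c : R -> R) (U : {RV P >-> R}) h w : measurable_fun setT c -> (forall x, `|c x| <= 1) ->
  is_pdf h -> has_pdf U h -> \int[P]_t c (w * U t) = \int[mu]_x (c (x * w) * h x).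
Proof.
move=> mc c1 hp Uh; rewrite (pdf_bounded_integral hp Uh (mcw w mc))//.
by apply: eq_Rintegral => x _; rewrite [w * x]mulrC.
Qed.

Let mc := @measurable_cos R.
Let ms := @measurable_sin R.
Let c1 := @norm_cos_le1 R.
Let s1 := @norm_sin_le1 R.

(** Addition formula and independence. Together with [sin_sum_expectation] this is the factorization
    of the characteristic function of X + Z. *)
Lemma cos_sum_expectation w :
  \int[P]_t cos (w * (X t + Z t)) = fcos f w * fcos g w - fsin f w * fsin g w.
Proof.
have [i1 e1] := indep_expectation indepXZ (mcw w mc) (mcw w mc) (ib X w mc c1) (ib Z w mc c1).
have [i2 e2] := indep_expectation indepXZ (mcw w ms) (mcw w ms) (ib X w ms s1) (ib Z w ms s1).
rewrite /fcos /fsin -(bE w mc c1 f_pdf X_f) -(bE w mc c1 g_pdf Z_g) -(bE w ms s1 f_pdf X_f) -(bE w ms s1 g_pdf Z_g).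
rewrite -e1 -e2 -RintegralB//.
by apply: eq_Rintegral => t _; rewrite mulrDr cosD.
Qed.

Lemma sin_sum_expectation w :
  \int[P]_t sin (w * (X t + Z t)) = fsin f w * fcos g w + fcos f w * fsin g w.
Proof.
have [i1 e1] := indep_expectation indepXZ (mcw w ms) (mcw w mc) (ib X w ms s1) (ib Z w mc c1).
have [i2 e2] := indep_expectation indepXZ (mcw w mc) (mcw w ms) (ib X w mc c1) (ib Z w ms s1).
rewrite /fcos /fsin -(bE w mc c1 f_pdf X_f) -(bE w mc c1 g_pdf Z_g) -(bE w ms s1 f_pdf X_f) -(bE w ms s1 g_pdf Z_g).
rewrite -e1 -e2 -RintegralD//.
by apply: eq_Rintegral => t _; rewrite mulrDr sinD.
Qed.

End model_sum.

(** * Independence of blocks of variables *)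

Section mutual_independence.
Context d (T : measurableType d) (R : realType) (P : probability T R).
Variables (Ix : finType) (X : Ix -> {RV P >-> R}).
Hypothesis indX : mutually_independent X.

Lemma indep_block (J : {set Ix}) (A : Ix -> set R) : (forall i, measurable (A i)) ->
  P (\bigcap_(k in [set` J]) X k @^-1` A k) = (\prod_(k in J) P (X k @^-1` A k))%E.
Proof.
(* Coordinates outside J are padded with the whole line, whose preimage has probability 1. *)
move=> mA; pose A' k := if k \in J then A k else setT.
have mA' k : measurable (A' k) by rewrite /A'; case: ifP.
have := indX mA'.
rewrite (_ : \bigcap_i _ = \bigcap_(k in [set` J]) X k @^-1` A k); last first.
  apply/seteqP; split => t H k.
    by move=> kJ; have := H k I; rewrite /A' kJ.
  move=> _; rewrite /A'; case: ifPn => // kJ; exact: H.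
move=> ->; rewrite [RHS]big_mkcond/=; apply: eq_bigr => k _; rewrite /A'.
by case: ifP => // _; rewrite preimage_setT probability_setT.
Qed.

Lemma indep_blocks (J K : {set Ix}) (A : Ix -> set R) : (forall i, measurable (A i)) ->
  [disjoint J & K]%B ->
  P (\bigcap_(k in [set` J]) X k @^-1` A k `&` \bigcap_(k in [set` K]) X k @^-1` A k) =
  (P (\bigcap_(k in [set` J]) X k @^-1` A k) * P (\bigcap_(k in [set` K]) X k @^-1` A k))%E.
Proof.
move=> mA JK; rewrite -bigcap_setU.
have -> : [set` J] `|` [set` K] = [set` J :|: K].
  by apply/seteqP; split => k /=; rewrite finset.in_setU => /orP.
rewrite !indep_block//; rewrite (@big_setID _ _ _ _ _ J)/=.
congr (_ * _)%E; apply: eq_bigl => k; rewrite !inE.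
  by case: (k \in J); rewrite ?andbF//= orbT.
case kJ : (k \in J) => //=.
by rewrite (disjointFr JK kJ).
Qed.

Lemma pair_block (k l : Ix) (A : Ix -> set R) : k != l ->
  \bigcap_(z in [set` [set k; l]%SET]) X z @^-1` A z = X k @^-1` A k `&` X l @^-1` A l.
Proof.
move=> kl; apply/seteqP; split => t /=.
  by move=> H; split; apply: (H _) => /=; rewrite !inE ?eqxx ?orbT.
by move=> [H1 H2] z /=; rewrite !inE => /orP[] /eqP ->.
Qed.

Lemma indep_two (k l : Ix) (A B : set R) : k != l -> measurable A -> measurable B ->
  P (X k @^-1` A `&` X l @^-1` B) = (P (X k @^-1` A) * P (X l @^-1` B))%E.
Proof.
move=> kl mA mB; pose F z := if z == k then A else B.
have mF z : measurable (F z) by rewrite /F; case: ifP.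
have := indep_block [set k; l]%SET mF.
rewrite pair_block// big_setU1 ?inE// big_set1 /F eqxx.
by rewrite (negbTE (_ : l != k)) 1?eq_sym.
Qed.

(** [mutually_independent] concerns rectangles only. [indep_event_pair] is used twice: first to
    reach C for the first pair against a rectangle for the second, then, with the roles exchanged,
    to reach D. *)
Lemma indep_pairs (k l k' l' : Ix) (C D : set (R * R)) : uniq [:: k; l; k'; l'] ->
  measurable C -> measurable D ->
  P ((fun t => (X k t, X l t)) @^-1` C `&` (fun t => (X k' t, X l' t)) @^-1` D) =
  (P ((fun t => (X k t, X l t)) @^-1` C) * P ((fun t => (X k' t, X l' t)) @^-1` D))%E.
Proof.
rewrite /= !inE !negb_or => /and4P[/and3P[kl kk' kl'] /andP[lk' ll'] k'l' _] mC mD.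
have mpre z A : measurable A -> measurable (X z @^-1` A).
  by move=> mA; rewrite -[_ @^-1` _]setTI; exact: measurable_funP.
have mU z z' (E : set (R * R)) : measurable E -> measurable ((fun t => (X z t, X z' t)) @^-1` E).
  move=> mE; rewrite -[_ @^-1` _]setTI.
  by apply: (measurable_fun_pair (f := X z) (g := X z')).
have step A' B' : measurable A' -> measurable B' ->
    P ((fun t => (X k t, X l t)) @^-1` C `&` (X k' @^-1` A' `&` X l' @^-1` B')) =
    (P ((fun t => (X k t, X l t)) @^-1` C) * P (X k' @^-1` A' `&` X l' @^-1` B'))%E.
  move=> mA' mB'; apply: indep_event_pair => //.
    by apply: measurableI; exact: mpre.
  move=> A B mA mB.
  pose F z := if z == k then A else if z == l then B else if z == k' then A' else B'.
  have mF z : measurable (F z) by rewrite /F; do 3 case: ifP => //.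
  have := @indep_blocks [set k; l]%SET [set k'; l']%SET F mF.
  rewrite !pair_block// /F !eqxx.
  rewrite (eq_sym l k) (eq_sym k' k) (eq_sym k' l) (eq_sym l' k) (eq_sym l' l) (eq_sym l' k').
  rewrite (negbTE kl) (negbTE kk') (negbTE kl') (negbTE lk') (negbTE ll') (negbTE k'l').
  apply; rewrite disjoint_sym -setI_eq0; apply/eqP/setP => z; rewrite !inE.
  apply/negbTE/negP => /andP[] /orP[] /eqP-> /orP[] /eqP E; move: kl kk' kl' lk' ll' k'l';
  by rewrite E ?eqxx.
rewrite setIC muleC; apply: indep_event_pair => //; first exact: mU.
by move=> A B mA mB; rewrite setIC muleC; exact: step.
Qed.

End mutual_independence.

Section Rintegral_sum.
Context d (T : measurableType d) (R : realType) (m : {measure set T -> \bar R}).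

Lemma integrable_sum_Rintegral (I : eqType) (r : seq I) (F : I -> T -> R) :
  (forall i, i \in r -> m.-integrable setT (EFin \o F i)) ->
  m.-integrable setT (EFin \o fun t => \sum_(i <- r) F i t) /\
  \int[m]_t (\sum_(i <- r) F i t) = \sum_(i <- r) \int[m]_t F i t.
Proof.
elim: r => [|i r IH] H.
  split.
    rewrite (_ : _ \o _ = cst 0%E); first exact: integrable0.
    by apply/funext => t /=; rewrite big_nil.
  rewrite big_nil (@eq_Rintegral _ _ _ _ _ (fun=> 0)); last by move=> t _; rewrite big_nil.
  by rewrite Rintegral_cst ?mul0r.
have [i1 e1] := IH (fun j (jr : j \in r) => H j (mem_behead (s := i :: r) jr)).
have i0 := H i (mem_head _ _).
have E : (fun t => \sum_(j <- i :: r) F j t) = (fun t => F i t + \sum_(j <- r) F j t).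
  by apply/funext => t; rewrite big_cons.
rewrite E; split; first by have := integrableD measurableT i0 i1.
by rewrite RintegralD// big_cons e1.
Qed.

End Rintegral_sum.

(** * Mean squared error of averages of uncorrelated variables *)

Section mean_risk.
Context d (T : measurableType d) (R : realType) (P : probability T R).

(** V bounds the second moments rather than the variances. With W = Z - c, products off the diagonal
    have mean (m - c)^2 and those on it at most (m - c)^2 + V - m^2, so averaging divides V - m^2 by
    n; the term -m^2 / n is then dropped. *)
Lemma mean_risk (n : nat) (Z : 'I_n -> T -> R) (m V c : R) : (0 < n)%N ->
  (forall i, P.-integrable setT (EFin \o Z i)) ->
  (forall i, \int[P]_t Z i t = m) ->
  (forall i, P.-integrable setT (EFin \o fun t => Z i t ^+ 2)) ->
  (forall i, \int[P]_t (Z i t ^+ 2) <= V) ->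
  (forall i j, i != j -> P.-integrable setT (EFin \o fun t => Z i t * Z j t) /\
     \int[P]_t (Z i t * Z j t) = m ^+ 2) ->
  P.-integrable setT (EFin \o fun t => (n%:R^-1 * (\sum_(i < n) Z i t) - c) ^+ 2) /\
  \int[P]_t ((n%:R^-1 * (\sum_(i < n) Z i t) - c) ^+ 2) <= V / n%:R + (m - c) ^+ 2.
Proof.
move=> n0 iZ eZ iZ2 eZ2 iZZ.
have nR : n%:R != 0 :> R by rewrite pnatr_eq0 -lt0n.
have i1 : P.-integrable setT (EFin \o cst (c ^+ 2)) by apply: finite_measure_integrable_cst.
have iZZ' i j : P.-integrable setT (EFin \o fun t => Z i t * Z j t).
  have [->|ij] := eqVneq i j; last exact: (iZZ i j ij).1.
  by under [X in _.-integrable _ (_ \o X)]eq_fun do rewrite -expr2.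
pose W i t := Z i t - c.
have WW i j : P.-integrable setT (EFin \o fun t => W i t * W j t) /\
    \int[P]_t (W i t * W j t) = \int[P]_t (Z i t * Z j t) - 2 * c * m + c ^+ 2.
  have E : (fun t => W i t * W j t) = (fun t => (Z i t * Z j t - (c * Z i t + c * Z j t)) + c ^+ 2).
    by apply/funext => t; rewrite /W; ring.
  have j1 : P.-integrable setT (EFin \o fun t => c * Z i t) by have := integrableZl measurableT c (iZ i).
  have j2 : P.-integrable setT (EFin \o fun t => c * Z j t) by have := integrableZl measurableT c (iZ j).
  have j3 : P.-integrable setT (EFin \o fun t => c * Z i t + c * Z j t) by have := integrableD measurableT j1 j2.
  have j4 : P.-integrable setT (EFin \o fun t => Z i t * Z j t - (c * Z i t + c * Z j t)).
    by have := integrableB measurableT (iZZ' i j) j3.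
  rewrite E; split; first by have := integrableD measurableT j4 i1.
  have e1 : \int[P]_t (c * Z i t) = c * m by rewrite RintegralZl// eZ.
  have e2 : \int[P]_t (c * Z j t) = c * m by rewrite RintegralZl// eZ.
  rewrite RintegralD// RintegralB// RintegralD// e1 e2.
  by rewrite Rintegral_cst// [X in fine X](probability_setT P) /=; ring.
have E : (fun t => (n%:R^-1 * (\sum_(i < n) Z i t) - c) ^+ 2) =
    (fun t => n%:R ^- 2 * (\sum_(i < n) \sum_(j < n) W i t * W j t)).
  apply/funext => t.
  have -> : n%:R^-1 * (\sum_(i < n) Z i t) - c = n%:R^-1 * (\sum_(i < n) W i t).
    rewrite /W sumrB sumr_const card_ord mulrBr -[c *+ n]mulr_natr mulrCA mulVf ?mulr1//.
  by rewrite exprMn exprVn [X in _ * X = _]expr2 big_distrlr.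
have inner i : P.-integrable setT (EFin \o fun t => \sum_(j < n) W i t * W j t) /\
    \int[P]_t (\sum_(j < n) W i t * W j t) = \sum_(j < n) \int[P]_t (W i t * W j t).
  by apply: integrable_sum_Rintegral => j _; exact: (WW i j).1.
have [iS eS] : P.-integrable setT (EFin \o fun t => \sum_(i < n) \sum_(j < n) W i t * W j t) /\
    \int[P]_t (\sum_(i < n) \sum_(j < n) W i t * W j t) = \sum_(i < n) \int[P]_t (\sum_(j < n) W i t * W j t).
  by apply: (@integrable_sum_Rintegral _ _ _ P _ _ (fun i t => \sum_(j < n) W i t * W j t)) => i _; exact: (inner i).1.
rewrite E; split; first by have := integrableZl measurableT (n%:R ^- 2) iS.
rewrite RintegralZl// eS.
have B i j : \int[P]_t (W i t * W j t) <= (m - c) ^+ 2 + (if i == j then V - m ^+ 2 else 0).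
  rewrite (WW i j).2; case: eqVneq => [->|ij].
    have := eZ2 j; under eq_Rintegral do rewrite expr2.
    by move=> H; nra.
  by rewrite (iZZ i j ij).2 addr0; apply: le_of_eq; ring.
apply: (@le_trans _ _ (n%:R ^- 2 * \sum_(i < n) \sum_(j < n) ((m - c) ^+ 2 + (if i == j then V - m ^+ 2 else 0)))).
  rewrite ler_wpM2l ?invr_ge0 ?exprn_ge0//.
  by apply: ler_sum => i _; rewrite (inner i).2; apply: ler_sum => j _; exact: B.
rewrite (eq_bigr (fun=> n%:R * (m - c) ^+ 2 + (V - m ^+ 2))); last first.
  move=> i _; rewrite big_split/= sumr_const card_ord mulr_natl -big_mkcond/=.
  by rewrite (big_pred1 i)// => j; rewrite eq_sym.
set Q := n%:R * _ + _; rewrite sumr_const card_ord -(mulr_natl Q) /Q mulrDr mulrDr.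
have -> : n%:R ^- 2 * (n%:R * (n%:R * (m - c) ^+ 2)) = (m - c) ^+ 2 by field.
have -> : n%:R ^- 2 * (n%:R * (V - m ^+ 2)) = V / n%:R - m ^+ 2 / n%:R by field.
by rewrite addrC lerD2r lerBlDr lerDl divr_ge0// sqr_ge0.
Qed.

(** Constants are integrable for P, and |z| <= 1 + z^2. *)
Lemma sqr_integrable_integrable (Z : T -> R) : measurable_fun setT Z ->
  P.-integrable setT (EFin \o fun t => Z t ^+ 2) -> P.-integrable setT (EFin \o Z).
Proof.
move=> mZ iZ2.
have i1 : P.-integrable setT (EFin \o cst (1 : R)) by apply: finite_measure_integrable_cst.
have := integrableD measurableT i1 iZ2; apply: le_integrable => //; first exact/measurable_EFinP.
move=> t _ /=; rewrite lee_fin (le_trans _ (ler_norm _))//.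
rewrite -(real_normK (num_real (Z t))); have := normr_ge0 (Z t).
by move: `|Z t| => x x0; have := sqr_ge0 (x - 2^-1); nra.
Qed.

Lemma sqr_Rintegral_le (Z : T -> R) : measurable_fun setT Z ->
  P.-integrable setT (EFin \o fun t => Z t ^+ 2) ->
  (\int[P]_t Z t) ^+ 2 <= \int[P]_t (Z t ^+ 2).
Proof.
move=> mZ iZ2; have iZ := sqr_integrable_integrable mZ iZ2.
set m := \int[P]_t Z t.
have i1 : P.-integrable setT (EFin \o cst (m ^+ 2)) by apply: finite_measure_integrable_cst.
have j1 : P.-integrable setT (EFin \o fun t => 2 * m * Z t) by have := integrableZl measurableT (2 * m) iZ.
have j2 : P.-integrable setT (EFin \o fun t => Z t ^+ 2 - 2 * m * Z t) by have := integrableB measurableT iZ2 j1.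
have : 0 <= \int[P]_t ((Z t ^+ 2 - 2 * m * Z t) + m ^+ 2).
  apply: Rintegral_ge0 => t _; have := sqr_ge0 (Z t - m); nra.
rewrite RintegralD// RintegralB// RintegralZl// -/m.
rewrite Rintegral_cst// [X in fine X](probability_setT P) /=; nra.
Qed.

End mean_risk.

Section model_risk.
Context d (T : measurableType d) (R : realType) (P : probability T R).
Local Notation mu := (@lebesgue_measure R).
Variables (n : nat) (theta xi : 'I_n -> {RV P >-> R}) (f g : R -> R) (G : R).
Hypotheses (f_pdf : is_pdf f) (g_pdf : is_pdf g) (gG : forall x, g x <= G).
Hypothesis model : deconvolution_model theta xi f g.

Let X (k : 'I_n + 'I_n) : {RV P >-> R} := match k with inl i => theta i | inr i => xi i end.
Let indX : mutually_independent X. Proof. by case: model. Qed.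

Lemma model_indep i A B : measurable A -> measurable B ->
  (P (theta i @^-1` A `&` xi i @^-1` B) = P (theta i @^-1` A) * P (xi i @^-1` B))%E.
Proof. exact: (@indep_two _ _ _ _ _ _ indX (inl i) (inr i)). Qed.

Variables (k : R -> R) (D : R).
Hypotheses (mk : measurable_fun setT k) (kD : (\int[mu]_x (k x ^+ 2)%:E <= D%:E)%E).

Let Y i t : R := theta i t + xi i t.

Let mY i : measurable_fun setT (Y i).
Proof. exact: measurable_funD. Qed.

Lemma model_sqr_le i : (\int[P]_t (k (Y i t) ^+ 2)%:E <= (G * D)%:E)%E.
Proof.
have [th_f xi_g _] := model.
have G0 : 0 <= G by have [_ /(_ 0) g0 _] := g_pdf; exact: le_trans (gG 0).
apply: (le_trans (sum_ge0_integral_le g_pdf (xi_g i) (@model_indep i) gG (k := fun x => (k x ^+ 2)%:E) _ _)).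
- by apply/measurable_EFinP; exact: measurable_funX.
- by move=> x; rewrite lee_fin sqr_ge0.
- by rewrite EFinM lee_wpmul2l// lee_fin.
Qed.

Lemma model_sqr_integrable i : P.-integrable setT (EFin \o fun t => k (Y i t) ^+ 2).
Proof.
apply/integrableP; split.
  apply/measurable_EFinP; apply: measurable_funX; exact: measurableT_comp.
under eq_integral => t _ do rewrite /= ger0_norm ?sqr_ge0//.
exact: (le_lt_trans (model_sqr_le i) (ltry _)).
Qed.

Lemma model_sqr_Rintegral_le i : \int[P]_t (k (Y i t) ^+ 2) <= G * D.
Proof.
rewrite -lee_fin fineK; first exact: model_sqr_le.
exact: (integrable_fin_num measurableT (model_sqr_integrable i)).
Qed.

Lemma model_integrable i : P.-integrable setT (EFin \o (k \o Y i)).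
Proof.
by apply: sqr_integrable_integrable; [exact: measurableT_comp|exact: model_sqr_integrable].
Qed.

Lemma model_uncorrelated i j : i != j ->
  P.-integrable setT (EFin \o fun t => k (Y i t) * k (Y j t)) /\
  \int[P]_t (k (Y i t) * k (Y j t)) = (\int[P]_t k (Y i t)) * (\int[P]_t k (Y j t)).
Proof.
move=> ij; have mYi l : measurable_fun setT (Y l : T -> R) := mY l.
pose V l : {mfun T >-> R} := HB.pack (Y l) (isMeasurableFun.Build _ _ _ _ _ (mYi l)).
apply: (@indep_expectation _ _ _ _ _ _ _ _ (V i) (V j)) => //; try exact: model_integrable.
move=> A B mA mB.
(* That a sum lies in A is an event about the pair (theta_i, xi_i), so independence of the pairs
   yields independence of the sums. *)
have mS (C : set R) : measurable C -> measurable [set z : R * R | C (z.1 + z.2)].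
  move=> mC; rewrite -[[set z | _]]setTI.
  have : measurable_fun setT (fun z : R * R => z.1 + z.2).
    by apply: measurable_funD; [exact: measurable_fst|exact: measurable_snd].
  by apply.
have := @indep_pairs _ _ _ _ _ X indX (inl i) (inr i) (inl j) (inr j) _ _ _ (mS A mA) (mS B mB).
apply; rewrite /= !inE /=.
by rewrite !(inj_eq inl_inj) !(inj_eq inr_inj) (negbTE ij).
Qed.

Lemma model_mean_risk m c : (0 < n)%N -> (forall i, \int[P]_t k (Y i t) = m) ->
  P.-integrable setT (EFin \o fun t => (n%:R^-1 * (\sum_(i < n) k (Y i t)) - c) ^+ 2) /\
  \int[P]_t ((n%:R^-1 * (\sum_(i < n) k (Y i t)) - c) ^+ 2) <= G * D / n%:R + (m - c) ^+ 2.
Proof.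
move=> n0 km; apply: mean_risk => //.
- exact: model_integrable.
- exact: model_sqr_integrable.
- exact: model_sqr_Rintegral_le.
- by move=> i j ij; have := model_uncorrelated ij; rewrite !km expr2.
Qed.

End model_risk.

(** * Complex Fourier integrals *)

Section complex_fourier.
Context {R : realType}.
Local Notation mu := (@lebesgue_measure R).
Implicit Types (z r : R -> R[i]).

Lemma cabs_sqr (z : R[i]) : cabs z ^+ 2 = complex.Re z ^+ 2 + complex.Im z ^+ 2.
Proof. by case: z => a b /=; rewrite sqr_sqrtr// addr_ge0// sqr_ge0. Qed.

Lemma cabs_ge0 (z : R[i]) : 0 <= cabs z.
Proof. by case: z => a b /=; rewrite sqrtr_ge0. Qed.

Lemma cabsM (z1 z2 : R[i]) : cabs (z1 * z2) = cabs z1 * cabs z2.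
Proof. exact: Normc.normcM. Qed.

Lemma cabs_expi (x : R) : cabs (expi x) = 1.
Proof. by rewrite /cabs /= cos2Dsin2 sqrtr1. Qed.

Lemma Re_le_cabs (z : R[i]) : `|complex.Re z| <= cabs z.
Proof.
rewrite -(ler_pXn2r (n := 2)) ?nnegrE ?cabs_ge0// cabs_sqr real_normK ?num_real//.
by rewrite lerDl sqr_ge0.
Qed.

Lemma Im_le_cabs (z : R[i]) : `|complex.Im z| <= cabs z.
Proof.
rewrite -(ler_pXn2r (n := 2)) ?nnegrE ?cabs_ge0// cabs_sqr real_normK ?num_real//.
by rewrite lerDr sqr_ge0.
Qed.

Lemma cabs_le (z : R[i]) : cabs z <= `|complex.Re z| + `|complex.Im z|.
Proof.
rewrite -(ler_pXn2r (n := 2)) ?nnegrE ?cabs_ge0 ?addr_ge0// cabs_sqr.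
rewrite -(real_normK (num_real (complex.Re z))) -(real_normK (num_real (complex.Im z))).
have := normr_ge0 (complex.Re z); have := normr_ge0 (complex.Im z); nra.
Qed.

Lemma measurable_cabs z : cmeasurable z -> measurable_fun setT (cabs \o z).
Proof.
move=> [mr mi].
have -> : cabs \o z = (fun x => Num.sqrt (complex.Re (z x) ^+ 2 + complex.Im (z x) ^+ 2)).
  by apply/funext => x /=; rewrite -cabs_sqr sqrtr_sqr ger0_norm ?cabs_ge0.
apply: (measurableT_comp (f := @Num.sqrt R)).
  by apply: continuous_measurable_fun; exact: sqrt_continuous.
by apply: measurable_funD; apply: measurable_funX.
Qed.

Lemma cintegrable_cmeasurable z : cintegrable z -> cmeasurable z.
Proof. by move=> [i1 i2]; split; apply/measurable_EFinP; [exact: measurable_int i1|exact: measurable_int i2]. Qed.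

Lemma cintegrable_cabs z : cintegrable z -> mu.-integrable setT (EFin \o (cabs \o z)).
Proof.
move=> iz; have [i1 i2] := iz.
have := integrableD measurableT (integrable_norm i1) (integrable_norm i2).
apply: le_integrable => //.
  by apply/measurable_EFinP; apply: measurable_cabs; exact: cintegrable_cmeasurable.
move=> x _ /=; rewrite lee_fin (ger0_norm (cabs_ge0 _)) ger0_norm ?addr_ge0//.
exact: cabs_le.
Qed.

Lemma cabs_integrable z (h : R -> R) : cmeasurable z -> mu.-integrable setT (EFin \o h) ->
  (forall x, cabs (z x) <= h x) -> cintegrable z.
Proof.
move=> [mr mi] ih zh; split; apply: (le_integrable _ _ _ ih) => //.
- exact/measurable_EFinP.
- move=> x _ /=; rewrite lee_fin (le_trans (Re_le_cabs _))// (le_trans (zh x))//; exact: ler_norm.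
- exact/measurable_EFinP.
- move=> x _ /=; rewrite lee_fin (le_trans (Im_le_cabs _))// (le_trans (zh x))//; exact: ler_norm.
Qed.

Lemma cmeasurableM z1 z2 : cmeasurable z1 -> cmeasurable z2 -> cmeasurable (fun x => z1 x * z2 x).
Proof.
move=> [a b] [c e]; split.
  rewrite (_ : (fun x => _) = (fun x => complex.Re (z1 x) * complex.Re (z2 x) - complex.Im (z1 x) * complex.Im (z2 x))).
    by apply: measurable_funB; apply: measurable_funM.
  by apply/funext => x; case: (z1 x) => ? ?; case: (z2 x) => ? ?.
rewrite (_ : (fun x => _) = (fun x => complex.Re (z1 x) * complex.Im (z2 x) + complex.Im (z1 x) * complex.Re (z2 x))).
  by apply: measurable_funD; apply: measurable_funM.
by apply/funext => x; case: (z1 x) => ? ?; case: (z2 x) => ? ? /=.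
Qed.

Lemma cmeasurableB z1 z2 : cmeasurable z1 -> cmeasurable z2 -> cmeasurable (fun x => z1 x - z2 x).
Proof.
move=> [a b] [c e]; split.
  rewrite (_ : (fun x => _) = (fun x => complex.Re (z1 x) - complex.Re (z2 x))); first exact: measurable_funB.
  by apply/funext => x; case: (z1 x) => ? ?; case: (z2 x).
rewrite (_ : (fun x => _) = (fun x => complex.Im (z1 x) - complex.Im (z2 x))); first exact: measurable_funB.
by apply/funext => x; case: (z1 x) => ? ?; case: (z2 x).
Qed.

Lemma fourierE z y : cintegrable z -> fourier z y =
  (fcos (fun x => complex.Re (z x)) y - fsin (fun x => complex.Im (z x)) y) +i*
  (fcos (fun x => complex.Im (z x)) y + fsin (fun x => complex.Re (z x)) y).
Proof.
move=> [i1 i2]; rewrite /fourier /cint /fcos /fsin; congr (_ +i* _).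
  rewrite -RintegralB//; [|exact: integrable_cosM|exact: integrable_sinM].
  by apply: eq_Rintegral => x _ /=; case: (z x) => a b /=; rewrite [y * x]mulrC.
rewrite -RintegralD//; [|exact: integrable_cosM|exact: integrable_sinM].
by apply: eq_Rintegral => x _ /=; case: (z x) => a b /=; rewrite [y * x]mulrC.
Qed.

Lemma cmeasurable_fourier z : cintegrable z -> cmeasurable (fourier z).
Proof.
move=> iz; have [i1 i2] := iz; split.
  rewrite (_ : (fun x => _) = (fun y => fcos (fun x => complex.Re (z x)) y - fsin (fun x => complex.Im (z x)) y)).
    by apply: measurable_funB; [exact: measurable_fcos|exact: measurable_fsin].
  by apply/funext => y; rewrite fourierE.
rewrite (_ : (fun x => _) = (fun y => fcos (fun x => complex.Im (z x)) y + fsin (fun x => complex.Re (z x)) y)).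
  by apply: measurable_funD; [exact: measurable_fcos|exact: measurable_fsin].
by apply/funext => y; rewrite fourierE.
Qed.

(** Each part of the transform of z is a sum or difference of two real transforms; squaring these
    costs a factor 2, whence 80 pi = 2 * 40 pi. *)
Lemma cplancherel_le z : cintegrable z ->
  (\int[mu]_y (cabs (fourier z y) ^+ 2)%:E <= (80 * pi)%:E * \int[mu]_w (cabs (z w) ^+ 2)%:E)%E.
Proof.
move=> iz; have [i1 i2] := iz; have [m1 m2] := cintegrable_cmeasurable iz.
pose A y := fcos (fun x => complex.Re (z x)) y ^+ 2 + fsin (fun x => complex.Re (z x)) y ^+ 2.
pose B y := fcos (fun x => complex.Im (z x)) y ^+ 2 + fsin (fun x => complex.Im (z x)) y ^+ 2.
have A0 y : 0 <= A y by rewrite addr_ge0// sqr_ge0.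
have B0 y : 0 <= B y by rewrite addr_ge0// sqr_ge0.
have mA : measurable_fun setT A.
  by apply: measurable_funD; apply: measurable_funX; [exact: measurable_fcos|exact: measurable_fsin].
have mB : measurable_fun setT B.
  by apply: measurable_funD; apply: measurable_funX; [exact: measurable_fcos|exact: measurable_fsin].
have mz := measurable_cabs (cintegrable_cmeasurable iz).
have mf := measurable_cabs (cmeasurable_fourier iz).
apply: (@le_trans _ _ (\int[mu]_y (2%:E * ((A y)%:E + (B y)%:E)))%E).
  apply: ge0_le_integral => //.
  - by move=> y _; rewrite lee_fin sqr_ge0.
  - by apply/measurable_EFinP; exact: measurable_funX.
  - by apply: emeasurable_funM => //; apply: emeasurable_funD; exact/measurable_EFinP.
  move=> y _; rewrite -EFinD -EFinM lee_fin cabs_sqr fourierE//= /A /B.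
  move: (fcos _ y) (fsin _ y) (fcos _ y) (fsin _ y) => p q r s.
  have := sqr_ge0 (p + q); have := sqr_ge0 (p - q); have := sqr_ge0 (r - s); have := sqr_ge0 (r + s).
  have := sqr_ge0 (p + s); have := sqr_ge0 (p - s); have := sqr_ge0 (r - q); have := sqr_ge0 (r + q).
  nra.
rewrite ge0_integralZl//; last 2 first.
  by apply: emeasurable_funD; exact/measurable_EFinP.
  by move=> y _; rewrite adde_ge0// lee_fin.
rewrite ge0_integralD//; last 4 first.
- by move=> y _; rewrite lee_fin.
- exact/measurable_EFinP.
- by move=> y _; rewrite lee_fin.
- exact/measurable_EFinP.
under [X in (_ <= _ * X)%E]eq_integral => w _ do rewrite cabs_sqr EFinD.
rewrite ge0_integralD//; last 4 first.
- by move=> y _; rewrite lee_fin sqr_ge0.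
- by apply/measurable_EFinP; exact: measurable_funX.
- by move=> y _; rewrite lee_fin sqr_ge0.
- by apply/measurable_EFinP; exact: measurable_funX.
have -> : 80 * pi = 2 * (40 * pi) :> R by ring.
rewrite EFinM -muleA lee_wpmul2l ?lee_fin//.
rewrite ge0_muleDr; [|by apply: integral_ge0 => w _; rewrite lee_fin sqr_ge0..].
by apply: leeD; exact: plancherel_le.
Qed.

(** Extension by 0, which turns an integral of exp(iyw) z(w) over D into the transform of a function
    on the whole line. *)
Definition trunc (D : set R) z (w : R) : R[i] := if w \in D then z w else 0.

Lemma Re_trunc D z w : complex.Re (trunc D z w) = ((fun w => complex.Re (z w)) \_ D) w.
Proof. by rewrite /trunc patchE; case: ifP. Qed.

Lemma Im_trunc D z w : complex.Im (trunc D z w) = ((fun w => complex.Im (z w)) \_ D) w.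
Proof. by rewrite /trunc patchE; case: ifP. Qed.

Lemma cmeasurable_trunc D z : measurable D -> cmeasurable z -> cmeasurable (trunc D z).
Proof.
move=> mD [m1 m2]; split.
  rewrite (_ : (fun x => _) = (fun w => complex.Re (z w)) \_ D); last by apply/funext => w; rewrite Re_trunc.
  by apply/(measurable_restrictT _ _).1 => //; exact: measurable_funTS.
rewrite (_ : (fun x => _) = (fun w => complex.Im (z w)) \_ D); last by apply/funext => w; rewrite Im_trunc.
by apply/(measurable_restrictT _ _).1 => //; exact: measurable_funTS.
Qed.

Lemma cint_trunc D z : cint D z = cint setT (trunc D z).
Proof.
rewrite /cint; congr (_ +i* _); rewrite Rintegral_mkcond; apply: eq_Rintegral => w _.
  by rewrite Re_trunc.
by rewrite Im_trunc.
Qed.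

Lemma fourier_trunc D z y : cint D (fun w => expi (y * w) * z w) = fourier (trunc D z) y.
Proof.
rewrite cint_trunc /fourier; congr (cint _ _); apply/funext => w.
by rewrite /trunc; case: ifP => // _; rewrite mulr0.
Qed.

Lemma cabs_trunc_sqr D z w : (cabs (trunc D z w) ^+ 2)%:E = ((fun w => (cabs (z w) ^+ 2)%:E) \_ D) w.
Proof.
by rewrite /trunc patchE; case: ifP => // _; rewrite cabs_sqr /= expr0n/= addr0.
Qed.

Lemma integral_trunc_sqr D z :
  (\int[mu]_w (cabs (trunc D z w) ^+ 2)%:E = \int[mu]_(w in D) (cabs (z w) ^+ 2)%:E)%E.
Proof. by rewrite [RHS]integral_mkcond; apply: eq_integral => w _; rewrite cabs_trunc_sqr. Qed.

(** A bounded interval has finite measure, and |z| <= 1 + |z|^2. *)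
Lemma square_integrable_trunc z (T : R) : square_integrable z ->
  cintegrable (trunc `[- T, T] z).
Proof.
move=> [mz zoo].
have mz2 : measurable_fun setT (fun w => cabs (z w) ^+ 2) by apply: measurable_funX; exact: measurable_cabs.
have i2 : mu.-integrable setT (EFin \o fun w => cabs (z w) ^+ 2).
  apply/integrableP; split; first exact/measurable_EFinP.
  by under eq_integral => w _ do rewrite /= ger0_norm ?sqr_ge0//.
have i1 : mu.-integrable setT (EFin \o \1_`[- T, T]).
  by apply: integrable_indic_itv.
have i3 := integrableD measurableT i1 i2.
apply: (cabs_integrable _ i3); first exact: cmeasurable_trunc.
move=> w; rewrite /= /trunc indicE; case: ifP => _ /=; last first.
  by rewrite add0r /cabs/= expr0n/= addr0 sqrtr0 sqr_ge0.
have := cabs_ge0 (z w); move: (cabs _) => x x0; have := sqr_ge0 (x - 2^-1); nra.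
Qed.

End complex_fourier.

(** * The Fourier-Plancherel transform *)

Section L2_limit.
Context {R : realType}.
Local Notation mu := (@lebesgue_measure R).

(** The increments are at most sqrt(S) 2^(-n), so the telescoping series converges absolutely. *)
Lemma cvg_of_sqr_series (u : R^nat) (S : R) :
  (forall n, 4 ^+ n * (u n.+1 - u n) ^+ 2 <= S) -> cvgn u.
Proof.
move=> uS.
have S0 : 0 <= S by rewrite (le_trans _ (uS 0))// mulr_ge0// sqr_ge0.
have inc n : `|u n.+1 - u n| <= geometric (Num.sqrt S) 2^-1 n.
  rewrite /geometric/=.
  rewrite -(ler_pXn2r (n := 2)) ?nnegrE ?mulr_ge0 ?sqrtr_ge0 ?exprn_ge0//.
  rewrite real_normK ?num_real// exprMn sqr_sqrtr// -exprM mulnC exprM.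
  have -> : (2^-1 : R) ^+ 2 = 4^-1 by rewrite exprVn; congr _^-1; rewrite -natrX.
  by rewrite exprVn ler_pdivlMr ?exprn_gt0// mulrC.
have cs : cvgn (series (telescope u)).
  apply: normed_cvg; apply: (series_le_cvg _ _ inc) => //.
  - by move=> n; exact: (le_trans _ (inc n)).
  - by apply: is_cvg_geometric_series; rewrite ger0_norm ?invr_ge0// invf_lt1// ltr1n.
have -> : u = (fun n => u 0%N + series (telescope u) n).
  by apply/funext => n; exact: eq_sum_telescope.
by apply: is_cvgD => //; exact: is_cvg_cst.
Qed.

Lemma limn_einf_le (u : (\bar R)^nat) (c : \bar R) : (forall n, u n <= c)%E -> (limn_einf u <= c)%E.
Proof.
move=> uc; rewrite limn_einf_lim; apply: lime_le; first exact: is_cvg_einfs.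
apply: nearW => n; apply: le_trans (uc n).
by apply: ereal_inf_lbound; exists n => /=.
Qed.

(** Completeness of L^2. Along a sequence on which [tau] is at most 8^(-j), the sum of 4^j times the
    squared increments has finite integral, so the sequence converges almost everywhere; Fatou's
    lemma then bounds the distance from the limit to every [k T]. *)
Lemma L2_cauchy_limit (k : R -> R -> R) (tau : R -> R) :
  (forall T, measurable_fun setT (k T)) ->
  (forall T T', (T <= T')%R -> \int[mu]_y ((k T' y - k T y) ^+ 2)%:E <= (tau T)%:E)%E ->
  tau T @[T --> +oo] --> (0 : R) ->
  exists2 ts : R -> R, measurable_fun setT ts &
    forall T, (\int[mu]_y ((ts y - k T y) ^+ 2)%:E <= (tau T)%:E)%E.
Proof.
move=> mk kc t0.
have [M HM] : exists M : nat -> R, forall j x, M j < x -> tau x <= 8 ^- j.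
  have /choice[M HM] : forall j : nat, exists M, forall x, M < x -> tau x <= 8 ^- j.
    move=> j; have e0 : 0 < 8 ^- j :> R by rewrite invr_gt0 exprn_gt0.
    have /cvgrPdist_le/(_ _ e0)[M [_ HM]] := t0.
    exists M => x /HM; rewrite sub0r normrN; exact/le_trans/ler_norm.
  by exists M.
(* Partial sums of |M i| + 1: nondecreasing, tending to infinity, and above M j at every j. *)
pose t (j : nat) : R := \sum_(i < j.+1) (`|M i| + 1).
have tS j : t j.+1 = t j + (`|M j.+1| + 1) by rewrite /t big_ord_recr.
have t0' j : 0 <= t j by apply: sumr_ge0 => i _; rewrite addr_ge0.
have Mt j : M j < t j.
  case: j => [|j]; first by rewrite /t big_ord1 ltr_pwDr// ler_norm.
  by rewrite tS ltr_wpDl// ltr_pwDr// ler_norm.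
have tle j : t j <= t j.+1 by rewrite tS lerDl addr_ge0.
have tmono i j : (i <= j)%N -> t i <= t j.
  by move=> /subnK <-; elim: (j - i)%N => // m IH; exact: le_trans IH (tle _).
have tj j : j%:R <= t j.
  elim: j => // j IH; rewrite tS -natr1; have := normr_ge0 (M j.+1); lra.
pose D j y := k (t j.+1) y - k (t j) y.
have mD j : measurable_fun setT (fun y => 4 ^+ j * D j y ^+ 2).
  by apply: measurable_funM => //; apply: measurable_funX; exact: measurable_funB.
pose S y := (\sum_(j <oo) (4 ^+ j * D j y ^+ 2)%:E)%E.
have D0 j y : (0 <= (4 ^+ j * D j y ^+ 2)%:E)%E by rewrite lee_fin mulr_ge0// sqr_ge0.
have mS : measurable_fun setT S.
  by apply: ge0_emeasurable_sum => // j _; exact/measurable_EFinP.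
have S0 y : (0 <= S y)%E by exact: nneseries_ge0.
have iS : mu.-integrable setT S.
  apply/integrableP; split => //.
  under eq_integral => y _ do rewrite gee0_abs//.
  have mDE j : measurable_fun setT (fun y => (4 ^+ j * D j y ^+ 2)%:E) by exact/measurable_EFinP.
  rewrite integral_nneseries//.
  apply: (@le_lt_trans _ _ 2%:E); last exact: ltry.
  (* 4^j 8^(-j) = 2 / 2^(j+1), and these terms sum to 2. *)
  apply: le_trans (epsilon_trick0 xpredT (ler0n R 2)).
  apply: lee_nneseries => [*|j *]; first by apply: integral_ge0.
  under eq_integral => y _ do rewrite EFinM.
  rewrite ge0_integralZl//.
  - apply: (@le_trans _ _ ((4 ^+ j)%:E * (8 ^- j)%:E)%E).
      rewrite lee_wpmul2l ?lee_fin ?exprn_ge0//.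
      by apply: (le_trans (kc _ _ (tle j))); rewrite lee_fin; exact: HM.
    rewrite -EFinM lee_fin natrX exprS invfM mulrA mulfV// mul1r.
    by rewrite -exprVn -exprMn -exprVn; apply: le_of_eq; congr (_ ^+ j); field.
  - by apply/measurable_EFinP; apply: measurable_funX; apply: measurable_funB; exact: mk.
  - by move=> y _; rewrite lee_fin sqr_ge0.
have cv y : S y \is a fin_num -> cvgn (fun j => k (t j) y).
  move=> Sfin; apply: (@cvg_of_sqr_series _ (fine (S y))) => j.
  rewrite -lee_fin fineK//.
  rewrite /S (nneseries_split 0 j.+1)//= big_nat_recr//=.
  rewrite -[leLHS]adde0; apply: leeD; last exact: nneseries_ge0.
  by rewrite -[leLHS]add0e; apply: leeD => //; exact: sume_ge0.
(* The upper limit is measurable without any convergence, and it is the limit wherever S is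
   finite. *)
pose ts y := fine (limn_esup (fun j => (k (t j) y)%:E)).
have mts : measurable_fun setT ts.
  apply: measurableT_comp => //; apply: measurable_fun_limn_esup => j; exact/measurable_EFinP.
have tsE y : S y \is a fin_num -> k (t j) y @[j --> \oo] --> ts y.
  move=> /cv c; have cE : (k (t j) y)%:E @[j --> \oo] --> (limn (fun j => k (t j) y))%:E.
    by apply: cvg_EFin => //; exact: nearW.
  rewrite /ts is_cvg_limn_esupE; last by apply/cvg_ex; eexists; exact: cE.
  by rewrite (cvg_lim _ cE).
exists ts => // T.
have [N TN] : exists N, T <= t N.
  by exists (Num.truncn `|T|).+1; apply: le_trans (tj _); rewrite (le_trans (ler_norm _))// ltW// truncnS_gt.
(* The shift by N keeps every index beyond T, so that [kc] applies to all j. *)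
pose F j y := ((k (t (j + N)%N) y - k T y) ^+ 2)%:E.
have mF j : measurable_fun setT (F j).
  by apply/measurable_EFinP; apply: measurable_funX; exact: measurable_funB.
have F0 j y : setT y -> (0 <= F j y)%E by move=> _; rewrite lee_fin sqr_ge0.
rewrite (@ae_eq_integral _ _ _ mu setT (fun y => limn_einf (F ^~ y)))//; last 3 first.
- by apply/measurable_EFinP; apply: measurable_funX; apply: measurable_funB => //; exact: mk.
- apply: (emeasurable_fun_cvg (fun n y => einfs (F ^~ y) n)) => [n|y _]; first exact: measurable_fun_einfs.
  by rewrite limn_einf_lim; exact: is_cvg_einfs.
- apply: filterS (integrable_ae measurableT iS) => y /(_ I) Sfin _.
  have c : (F ^~ y) @ \oo --> ((ts y - k T y) ^+ 2)%:E.
    apply: cvg_EFin; first exact: nearW.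
    have := tsE _ Sfin; rewrite -(cvg_shiftn N) => c.
    apply: (@cvg_comp _ _ _ (fun j => k (t (j + N)%N) y - k T y) (fun x : R => x ^+ 2)); last exact: exprn_continuous.
    by apply: cvgB => //; exact: cvg_cst.
  rewrite is_cvg_limn_einfE; last by apply/cvg_ex; eexists; exact: c.
  exact/esym/cvg_lim.
apply: (le_trans (fatou mu measurableT mF F0)).
apply: limn_einf_le => j; apply: kc; apply: (le_trans TN); apply: tmono; exact: leq_addl.
Qed.

End L2_limit.

(** * Integrals outside [-T, T] *)

Section tails.
Context {R : realType}.
Local Notation mu := (@lebesgue_measure R).

Definition tail_int (p : R -> R) (T : R) : R := \int[mu]_(w in ~` `[- T, T]) p w.

Variable p : R -> R.
Hypotheses (p0 : forall w, 0 <= p w) (ip : mu.-integrable setT (EFin \o p)).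

Let mp : measurable_fun setT (EFin \o p) := measurable_int mu ip.

Let fin D : measurable D -> (\int[mu]_(w in D) (p w)%:E)%E \is a fin_num.
Proof.
move=> mD; apply: integrable_fin_num => //; exact: (integrableS measurableT).
Qed.

Lemma tail_intE T : (tail_int p T)%:E = (\int[mu]_(w in ~` `[(- T)%R, T]) (p w)%:E)%E.
Proof. by rewrite /tail_int /Rintegral fineK//; apply: fin; exact: measurableC. Qed.

Lemma tail_int_ge0 T : 0 <= tail_int p T.
Proof. by apply: Rintegral_ge0. Qed.

Lemma tail_int_le T T' : T <= T' -> tail_int p T' <= tail_int p T.
Proof.
move=> TT; rewrite -lee_fin !tail_intE; apply: ge0_subset_integral => //.
- exact: measurableC.
- exact: measurableC.
- exact: measurable_funTS.
- by move=> w _; rewrite lee_fin.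
apply: subsetC; apply: subset_itv; rewrite bnd_simp//; lra.
Qed.

Lemma split_tail T : \int[mu]_w p w = \int[mu]_(w in `[- T, T]) p w + tail_int p T.
Proof.
rewrite -(setUv (`[- T, T]%classic)) Rintegral_setU//.
- exact: measurableC.
- by rewrite setUv.
- by rewrite disj_set2E setICr.
Qed.

(** Monotone convergence along the integers, then monotonicity of the tail in T. *)
Lemma cvg_tail_int : tail_int p T @[T --> +oo] --> (0 : R).
Proof.
have c : tail_int p n%:R @[n --> \oo] --> (0 : R).
  have := ge0_cvg_integral_itv mp (fun w => p0 w).
  have -> : (\int[mu]_x (EFin \o p) x)%E = (\int[mu]_x p x)%:E by rewrite fineK//; exact: fin.
  move=> /fine_cvg c.
  have -> : (fun n => tail_int p n%:R) = (fun n => \int[mu]_x p x - \int[mu]_(w in `[- n%:R, n%:R]) p w).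
    by apply/funext => n; rewrite (split_tail n%:R); ring.
  by rewrite -(subrr (\int[mu]_x p x)); apply: cvgB => //; exact: cvg_cst.
apply/cvgrPdist_lt => e e0.
have /cvgrPdist_lt/(_ _ e0)[N _ HN] := c.
near=> T; rewrite sub0r normrN ger0_norm ?tail_int_ge0//.
apply: (@le_lt_trans _ _ (tail_int p N%:R)).
  by apply: tail_int_le; near: T; apply: nbhs_pinfty_ge; exact: num_real.
by have := HN N (leqnn N); rewrite /= sub0r normrN ger0_norm ?tail_int_ge0.
Unshelve. all: by end_near. Qed.

Lemma Rintegral_itv_tail_le (h : R -> R) T : measurable_fun setT h -> (forall w, `|h w| <= p w) ->
  `|\int[mu]_w h w - \int[mu]_(w in `[- T, T]) h w| <= tail_int p T.
Proof.
move=> mh hp.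
have ih : mu.-integrable setT (EFin \o h).
  apply: (le_integrable _ _ _ ip) => //; first exact/measurable_EFinP.
  by move=> w _ /=; rewrite lee_fin (le_trans (hp w))// ler_norm.
have mC : measurable (~` `[- T, T]%classic : set (measurableTypeR R)) by exact: measurableC.
rewrite -(setUv (`[- T, T]%classic)) Rintegral_setU//; last 2 first.
- by rewrite setUv.
- by rewrite disj_set2E setICr.
rewrite addrAC subrr add0r.
have ihC : mu.-integrable (~` `[- T, T]) (EFin \o h) by exact: (integrableS measurableT).
apply: (le_trans (le_normr_Rintegral mC ihC)); apply: le_Rintegral => //.
- exact: (integrable_norm ihC).
- exact: (integrableS measurableT).
Qed.

End tails.

Section L2_fourier_existence.
Context {R : realType}.
Local Notation mu := (@lebesgue_measure R).
Variable r : R -> R[i].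
Hypothesis r2 : square_integrable r.

Let mr : cmeasurable r := r2.1.

Let mr2 : measurable_fun setT (fun w => cabs (r w) ^+ 2).
Proof. by apply: measurable_funX; exact: measurable_cabs. Qed.

Lemma square_integrable_integrable : mu.-integrable setT (EFin \o fun w => cabs (r w) ^+ 2).
Proof.
apply/integrableP; split; first exact/measurable_EFinP.
by under eq_integral => w _ do rewrite /= ger0_norm ?sqr_ge0//; exact: r2.2.
Qed.

Let K T := fourier (trunc `[- T, T] r).

Let mK T : cmeasurable (K T).
Proof. by apply: cmeasurable_fourier; exact: square_integrable_trunc. Qed.

Let tau T := 80 * pi * tail_int (fun w => cabs (r w) ^+ 2) T.

Let fourierB (z1 z2 z3 : R -> R[i]) y : cintegrable z1 -> cintegrable z2 -> cintegrable z3 ->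
  (forall w, z3 w = z1 w - z2 w) -> fourier z3 y = fourier z1 y - fourier z2 y.
Proof.
move=> i1 i2 i3 E; rewrite !fourierE//.
have [[a1 b1] [a2 b2]] := (i1, i2).
have ER : (fun w => complex.Re (z3 w)) = (fun w => complex.Re (z1 w) - complex.Re (z2 w)).
  by apply/funext => w; rewrite E; case: (z1 w) => ? ?; case: (z2 w).
have EI : (fun w => complex.Im (z3 w)) = (fun w => complex.Im (z1 w) - complex.Im (z2 w)).
  by apply/funext => w; rewrite E; case: (z1 w) => ? ?; case: (z2 w).
have cB (u v : R -> R) : mu.-integrable setT (EFin \o u) -> mu.-integrable setT (EFin \o v) ->
    fcos (fun w => u w - v w) y = fcos u y - fcos v y.
  move=> iu iv; rewrite /fcos -RintegralB//; [|exact: integrable_cosM|exact: integrable_cosM].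
  by apply: eq_Rintegral => w _; rewrite mulrBr.
have sB (u v : R -> R) : mu.-integrable setT (EFin \o u) -> mu.-integrable setT (EFin \o v) ->
    fsin (fun w => u w - v w) y = fsin u y - fsin v y.
  move=> iu iv; rewrite /fsin -RintegralB//; [|exact: integrable_sinM|exact: integrable_sinM].
  by apply: eq_Rintegral => w _; rewrite mulrBr.
rewrite ER EI !cB// !sB//; apply/eqP; rewrite eq_complex/=; apply/andP; split; apply/eqP; ring.
Qed.

(** The difference of two truncations is the truncation to the annulus between them, to which
    [cplancherel_le] applies. *)
Lemma trunc_fourier_cauchy T T' : T <= T' ->
  (\int[mu]_y (cabs (K T' y - K T y) ^+ 2)%:E <= (tau T)%:E)%E.
Proof.
move=> TT.
pose D : set R := `[- T', T'] `\` `[- T, T].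
have mD : measurable (D : set (measurableTypeR R)) by exact: measurableD.
have iD : cintegrable (trunc D r).
  apply: (cabs_integrable _ (cintegrable_cabs (square_integrable_trunc T' r2))).
    exact: cmeasurable_trunc.
  move=> w; rewrite /trunc; case: ifPn; last by rewrite {1}/cabs/= expr0n/= addr0 sqrtr0 cabs_ge0.
  by rewrite inE => -[wT' _]; rewrite /= mem_set.
have -> : (fun y => (cabs (K T' y - K T y) ^+ 2)%:E) = (fun y => (cabs (fourier (trunc D r) y) ^+ 2)%:E).
  apply/funext => y; rewrite (@fourierB (trunc `[- T', T'] r) (trunc `[- T, T] r))//.
  - exact: square_integrable_trunc.
  - exact: square_integrable_trunc.
  move=> w; rewrite /trunc.
  case: (boolP (w \in `[- T, T]%classic)) => wT; last first.
    rewrite subr0; congr (if _ then _ else _); apply/idP/idP; rewrite !inE.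
      by move=> [].
    by move=> wT'; split => // /mem_set; apply/negP.
  rewrite [w \in D]memNset; last by move=> [_]; apply; exact: set_mem.
  rewrite mem_set ?subrr//; move: wT; rewrite inE; apply: subset_itv; rewrite bnd_simp; lra.
apply: (le_trans (cplancherel_le iD)).
rewrite integral_trunc_sqr /tau [in leRHS]EFinM lee_wpmul2l//; first by rewrite lee_fin mulr_ge0// pi_ge0.
rewrite tail_intE; last exact: square_integrable_integrable.
apply: ge0_subset_integral => //.
- exact: measurableC.
- by apply: measurable_funTS; exact/measurable_EFinP.
- by move=> w _; rewrite lee_fin sqr_ge0.
- by move=> w [].
Qed.

Let tau0 : tau T @[T --> +oo] --> (0 : R).
Proof.
rewrite -(mulr0 (80 * pi)); apply: cvgM; first exact: cvg_cst.
by apply: cvg_tail_int; [move=> w; exact: sqr_ge0|exact: square_integrable_integrable].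
Qed.

Lemma ex_L2_fourier : exists ts, is_L2_fourier r ts.
Proof.
(* [L2_cauchy_limit] concerns real functions. It is applied to the real and to the imaginary part,
   each dominated by the modulus; recombining them gives 2 [tau]. *)
have part (k : R -> R -> R) (H : forall T T' y, (k T' y - k T y) ^+ 2 <= cabs (K T' y - K T y) ^+ 2)
    (mk : forall T, measurable_fun setT (k T)) :
    exists2 ts : R -> R, measurable_fun setT ts &
      forall T, (\int[mu]_y ((ts y - k T y) ^+ 2)%:E <= (tau T)%:E)%E.
  apply: L2_cauchy_limit => // T T' TT; apply: le_trans (trunc_fourier_cauchy TT).
  apply: ge0_le_integral => //.
  - by move=> y _; rewrite lee_fin sqr_ge0.
  - by apply/measurable_EFinP; apply: measurable_funX; apply: measurable_funB; exact: mk.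
  - apply/measurable_EFinP; apply: measurable_funX.
    by apply: (measurable_cabs (z := fun y => K T' y - K T y)); exact: cmeasurableB.
  - by move=> y _; rewrite lee_fin.
have [||tr mtr tr_le] := part (fun T y => complex.Re (K T y)).
- move=> T T' y; rewrite cabs_sqr; case: (K T' y) => a b; case: (K T y) => c e /=; rewrite lerDl sqr_ge0//.
- by move=> T; exact: (mK T).1.
have [||ti mti ti_le] := part (fun T y => complex.Im (K T y)).
- move=> T T' y; rewrite cabs_sqr; case: (K T' y) => a b; case: (K T y) => c e /=; rewrite lerDr sqr_ge0//.
- by move=> T; exact: (mK T).2.
pose ts y := tr y +i* ti y.
have mts : cmeasurable ts by split.
have mtsK T : measurable_fun setT (fun y => (cabs (ts y - K T y) ^+ 2)%:E).
  apply/measurable_EFinP; apply: measurable_funX.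
  by apply: (measurable_cabs (z := fun y => ts y - K T y)); exact: cmeasurableB.
have tsK T : (\int[mu]_y (cabs (ts y - K T y) ^+ 2)%:E <= (2 * tau T)%:E)%E.
  have -> : (fun y => (cabs (ts y - K T y) ^+ 2)%:E) =
      (fun y => ((tr y - complex.Re (K T y)) ^+ 2)%:E + ((ti y - complex.Im (K T y)) ^+ 2)%:E)%E.
    by apply/funext => y; rewrite cabs_sqr EFinD; case: (K T y).
  have [b1 b2] := mK T.
  rewrite ge0_integralD//.
  - by rewrite mulr2n mulrDl mul1r EFinD; apply: leeD.
  - by move=> y _; rewrite lee_fin sqr_ge0.
  - by apply/measurable_EFinP; apply: measurable_funX; exact: measurable_funB.
  - by move=> y _; rewrite lee_fin sqr_ge0.
  - by apply/measurable_EFinP; apply: measurable_funX; exact: measurable_funB.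
exists ts; split => //.
- split => //.
  (* The limit is square integrable by comparison with one truncated transform, here that for T =
     0. *)
  apply: (@le_lt_trans _ _ (\int[mu]_y (2%:E * (cabs (ts y - K 0 y) ^+ 2)%:E + 2%:E * (cabs (K 0 y) ^+ 2)%:E))%E).
    apply: ge0_le_integral => //.
    + by move=> y _; rewrite lee_fin sqr_ge0.
    + by apply/measurable_EFinP; apply: measurable_funX; exact: measurable_cabs.
    + apply: emeasurable_funD; apply: emeasurable_funM => //; first exact: mtsK.
      by apply/measurable_EFinP; apply: measurable_funX; exact: measurable_cabs.
    move=> y _; rewrite -!EFinM -EFinD lee_fin !cabs_sqr; case: (ts y) => a b; case: (K 0 y) => c e /=.
    have := sqr_ge0 (a - 2 * c); have := sqr_ge0 (b - 2 * e); nra.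
  rewrite ge0_integralD//; last 4 first.
  + by move=> y _; rewrite -EFinM lee_fin mulr_ge0// sqr_ge0.
  + by apply: emeasurable_funM => //; exact: mtsK.
  + by move=> y _; rewrite -EFinM lee_fin mulr_ge0// sqr_ge0.
  + by apply: emeasurable_funM => //; apply/measurable_EFinP; apply: measurable_funX; exact: measurable_cabs.
  have mtsK0 := mtsK 0.
  rewrite ge0_integralZl//; last by move=> y _; rewrite lee_fin sqr_ge0.
  rewrite ge0_integralZl//; last 2 first.
  + by apply/measurable_EFinP; apply: measurable_funX; exact: measurable_cabs.
  + by move=> y _; rewrite lee_fin sqr_ge0.
  apply: lte_add_pinfty; apply: lte_mul_pinfty => //.
    exact: (le_lt_trans (tsK 0) (ltry _)).
  apply: (le_lt_trans (cplancherel_le (square_integrable_trunc 0 r2))).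
  apply: lte_mul_pinfty => //; first by rewrite lee_fin mulr_ge0// pi_ge0.
  rewrite integral_trunc_sqr; apply: le_lt_trans r2.2; apply: ge0_subset_integral => //.
    exact/measurable_EFinP.
  by move=> w _; rewrite lee_fin sqr_ge0.
- apply: (@squeeze_cvge _ _ _ _ (cst 0%E) _ (fun T => (2 * tau T)%:E)).
  + apply: nearW => T; apply/andP; split; first by apply: integral_ge0 => y _; rewrite lee_fin sqr_ge0.
    by under eq_integral => y _ do rewrite fourier_trunc; exact: tsK.
  + exact: cvg_cst.
  + apply: cvg_EFin; first exact: nearW.
    by rewrite -(mulr0 (2 : R)); apply: cvgM => //; exact: cvg_cst.
Qed.

Lemma L2_fourierP : is_L2_fourier r (L2_fourier r).
Proof. by have [ts] := ex_L2_fourier; exact: xgetI. Qed.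

End L2_fourier_existence.

(** * Risk of the estimator at a fixed bandwidth *)

Section expectation_fourier.
Context d (T : measurableType d) (R : realType) (P : probability T R).
Local Notation mu := (@lebesgue_measure R).
Variables (X Z : {RV P >-> R}) (f g : R -> R).
Hypotheses (f_pdf : is_pdf f) (X_f : has_pdf X f) (g_pdf : is_pdf g) (Z_g : has_pdf Z g).
Hypothesis indepXZ : forall A B, measurable A -> measurable B ->
  (P (X @^-1` A `&` Z @^-1` B) = P (X @^-1` A) * P (Z @^-1` B))%E.

Let Y t : R := X t + Z t.
Let mY : measurable_fun setT Y. Proof. exact: measurable_funD. Qed.
Let iP1 : P.-integrable setT (EFin \o cst (1 : R)).
Proof. exact: finite_measure_integrable_cst. Qed.

Section real_kernel.
Variables (u c e : R -> R).
Hypotheses (iu : mu.-integrable setT (EFin \o u))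
  (mc : measurable_fun setT c) (c1 : forall x, `|c x| <= 1)
  (cE : forall w, \int[P]_t c (w * Y t) = e w).

Let k t w := c (w * Y t) * u w.

Let mk : measurable_fun setT (fun z : T * R => k z.1 z.2).
Proof.
have mu_u : measurable_fun setT u by apply/measurable_EFinP; exact: measurable_int iu.
apply: measurable_funM; last by apply: measurableT_comp => //; exact: measurable_snd.
apply: (measurableT_comp mc); apply: measurable_funM; first exact: measurable_snd.
by apply: measurableT_comp => //; exact: measurable_fst.
Qed.

Let bk t w : `|k t w| <= cst 1 t * `|u w|.
Proof. by rewrite normrM ler_wpM2r. Qed.

Let kE w : \int[P]_t k t w = u w * e w.
Proof.
rewrite RintegralZr//; first by rewrite cE mulrC.
apply: (@le_integrable _ _ _ _ _ _ _ (EFin \o cst 1)) => //.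
- by apply/measurable_EFinP; apply: (measurableT_comp mc); exact: measurable_funM.
- by move=> t _ /=; rewrite lee_fin normr1.
Qed.

Let ia := integrable_norm iu.

Lemma kernel_integrable : P.-integrable setT (EFin \o fun t => \int[mu]_w (c (w * Y t) * u w)).
Proof. exact: (@dominated_integrable_inner1 _ _ _ _ _ P mu k (cst 1) (fun w => `|u w|)). Qed.

Lemma kernel_expectation_integrable : mu.-integrable setT (EFin \o fun w => u w * e w).
Proof.
have := @dominated_integrable_inner2 _ _ _ _ _ P mu k (cst 1) (fun w => `|u w|) mk iP1 ia bk.
by under [X in _.-integrable _ (_ \o X)]eq_fun do rewrite kE.
Qed.

Lemma kernel_expectation : \int[P]_t \int[mu]_w (c (w * Y t) * u w) = \int[mu]_w (u w * e w).
Proof.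
rewrite [LHS](@dominated_Fubini _ _ _ _ _ P mu k (cst 1) (fun w => `|u w|) mk iP1 ia bk).
by apply: eq_Rintegral => w _; rewrite kE.
Qed.

End real_kernel.

Let ic u iu := @kernel_integrable u _ iu (@measurable_cos R) (@norm_cos_le1 R).
Let is_ u iu := @kernel_integrable u _ iu (@measurable_sin R) (@norm_sin_le1 R).
Let cE := cos_sum_expectation f_pdf X_f g_pdf Z_g indepXZ.
Let sE := sin_sum_expectation f_pdf X_f g_pdf Z_g indepXZ.
Let iC u iu := @kernel_expectation_integrable u _ _ iu (@measurable_cos R) (@norm_cos_le1 R) cE.
Let iS u iu := @kernel_expectation_integrable u _ _ iu (@measurable_sin R) (@norm_sin_le1 R) sE.
Let EC u iu := @kernel_expectation u _ _ iu (@measurable_cos R) (@norm_cos_le1 R) cE.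
Let ES u iu := @kernel_expectation u _ _ iu (@measurable_sin R) (@norm_sin_le1 R) sE.

(** As z is integrable, Fubini moves the expectation inside the Fourier integral, where exp(iwY)
    becomes the product of the two characteristic functions. *)
Lemma expectation_fourier (z : R -> R[i]) : cintegrable z ->
  (\int[P]_t complex.Re (fourier z (Y t))) +i* (\int[P]_t complex.Im (fourier z (Y t))) =
  cint setT (fun w => z w * (rfourier f w * rfourier g w)).
Proof.
move=> iz; have [i1 i2] := iz; rewrite /cint; congr (_ +i* _).
  transitivity (\int[P]_t (fcos (fun x => complex.Re (z x)) (Y t) - fsin (fun x => complex.Im (z x)) (Y t))).
    by apply: eq_Rintegral => t _; rewrite fourierE.
  rewrite RintegralB//; [|exact: ic|exact: is_].
  rewrite EC// ES// -RintegralB//; [|exact: iC|exact: iS].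
  apply: eq_Rintegral => w _; rewrite !rfourierE; case: (z w) => a b /=; ring.
transitivity (\int[P]_t (fcos (fun x => complex.Im (z x)) (Y t) + fsin (fun x => complex.Re (z x)) (Y t))).
  by apply: eq_Rintegral => t _; rewrite fourierE.
rewrite RintegralD//; [|exact: ic|exact: is_].
rewrite EC// ES// -RintegralD//; [|exact: iC|exact: iS].
apply: eq_Rintegral => w _; rewrite !rfourierE; case: (z w) => a b /=; ring.
Qed.

Lemma expectation_fourier_integrable (z : R -> R[i]) : cintegrable z ->
  P.-integrable setT (EFin \o fun t => complex.Re (fourier z (Y t))) /\
  P.-integrable setT (EFin \o fun t => complex.Im (fourier z (Y t))).
Proof.
move=> iz; have [i1 i2] := iz; split.
  rewrite (_ : (fun t => _) = (fun t => fcos (fun x => complex.Re (z x)) (Y t) - fsin (fun x => complex.Im (z x)) (Y t))).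
    by have := integrableB measurableT (ic i1) (is_ i2).
  by apply/funext => t; rewrite fourierE.
rewrite (_ : (fun t => _) = (fun t => fcos (fun x => complex.Im (z x)) (Y t) + fsin (fun x => complex.Re (z x)) (Y t))).
  by have := integrableD measurableT (ic i2) (is_ i1).
by apply/funext => t; rewrite fourierE.
Qed.

End expectation_fourier.

Section kernel_risk.
Context d (T : measurableType d) (R : realType) (P : probability T R).
Local Notation mu := (@lebesgue_measure R).
Variables (n : nat) (theta xi : 'I_n -> {RV P >-> R}) (f g : R -> R) (G : R).
Hypotheses (n0 : (0 < n)%N) (f_pdf : is_pdf f) (g_pdf : is_pdf g) (gG : forall x, g x <= G).
Hypothesis model : deconvolution_model theta xi f g.
Variables (K : R -> R[i]) (D : R).
Hypotheses (mK : cmeasurable K) (KD : (\int[mu]_y (cabs (K y) ^+ 2)%:E <= D%:E)%E).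

Let mK2 : measurable_fun setT (fun y => (cabs (K y) ^+ 2)%:E).
Proof. by apply/measurable_EFinP; apply: measurable_funX; exact: measurable_cabs. Qed.

Lemma Re_kernel_le : (\int[mu]_y ((complex.Re (K y)) ^+ 2)%:E <= D%:E)%E.
Proof.
apply: le_trans KD; apply: ge0_le_integral => //.
- by move=> y _; rewrite lee_fin sqr_ge0.
- by apply/measurable_EFinP; apply: measurable_funX; exact: mK.1.
- by move=> y _; rewrite lee_fin cabs_sqr lerDl sqr_ge0.
Qed.

Lemma Im_kernel_le : (\int[mu]_y ((complex.Im (K y)) ^+ 2)%:E <= D%:E)%E.
Proof.
apply: le_trans KD; apply: ge0_le_integral => //.
- by move=> y _; rewrite lee_fin sqr_ge0.
- by apply/measurable_EFinP; apply: measurable_funX; exact: mK.2.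
- by move=> y _; rewrite lee_fin cabs_sqr lerDr sqr_ge0.
Qed.

(** Real and imaginary parts are empirical means compared with 2 pi times the parts of c. The common
    factor (2 pi)^(-2) is at most 1 and is dropped; G D / n is paid once for each part. *)
Lemma kernel_risk (mr mi : R) (c : R[i]) :
  (forall i, \int[P]_t complex.Re (K (theta i t + xi i t)) = mr) ->
  (forall i, \int[P]_t complex.Im (K (theta i t + xi i t)) = mi) ->
  ('E_P[fun t => ((cabs (((2 * pi)^-1)%:C *
      (((n%:R)^-1)%:C * \sum_(j < n) K (theta j t + xi j t)) - c)) ^+ 2)%R] <=
   (2 * (G * D) / n%:R + ((mr - 2 * pi * complex.Re c) ^+ 2 + (mi - 2 * pi * complex.Im c) ^+ 2))%:E)%E.
Proof.
move=> Emr Emi.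
have [i1 l1] := model_mean_risk g_pdf gG model mK.1 Re_kernel_le (2 * pi * complex.Re c) n0 Emr.
have [i2 l2] := model_mean_risk g_pdf gG model mK.2 Im_kernel_le (2 * pi * complex.Im c) n0 Emi.
have p0 : 0 < 2 * pi :> R by rewrite mulr_gt0// pi_gt0.
have p1 : 1 <= 2 * pi :> R by have := @pihalf_ge1 R; lra.
pose A t := (n%:R^-1 * (\sum_(i < n) complex.Re (K (theta i t + xi i t))) - 2 * pi * complex.Re c) ^+ 2.
pose B t := (n%:R^-1 * (\sum_(i < n) complex.Im (K (theta i t + xi i t))) - 2 * pi * complex.Im c) ^+ 2.
have iAB : P.-integrable setT (EFin \o fun t => A t + B t) by have := integrableD measurableT i1 i2.
have E t : (cabs (((2 * pi)^-1)%:C * (((n%:R)^-1)%:C * \sum_(j < n) K (theta j t + xi j t)) - c)) ^+ 2 =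
    (2 * pi) ^- 2 * (A t + B t).
  rewrite cabs_sqr /A /B -!(raddf_sum (@complex.Re R)) -!(raddf_sum (@complex.Im R)).
  case: (\sum_(j < n) _) => a b; case Ec : c => [c1 c2] /=.
  have alg (p x a' b' c1' c2' : R) : p != 0 ->
      (p^-1 * (x * a' - 0 * b') - 0 * (x * b' + 0 * a') - c1') ^+ 2 +
      (p^-1 * (x * b' + 0 * a') + 0 * (x * a' - 0 * b') - c2') ^+ 2 =
      p ^- 2 * ((x * a' - p * c1') ^+ 2 + (x * b' - p * c2') ^+ 2) by move=> p_neq0; field.
  by apply: alg; rewrite gt_eqF.
rewrite unlock.
have -> : (fun t => (((cabs (((2 * pi)^-1)%:C * (((n%:R)^-1)%:C * \sum_(j < n) K (theta j t + xi j t)) - c)) ^+ 2)%R)%:E) =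
    (fun t => ((2 * pi) ^- 2 * (A t + B t))%:E) by apply/funext => t; rewrite E.
have iAB' : P.-integrable setT (EFin \o fun t => (2 * pi) ^- 2 * (A t + B t)).
  by have := integrableZl measurableT ((2 * pi) ^- 2) iAB.
rewrite -[leLHS]fineK; last exact: (integrable_fin_num measurableT iAB').
rewrite lee_fin -/(Rintegral _ _ _) RintegralZl//.
apply: (@le_trans _ _ (\int[P]_t (A t + B t))).
  rewrite ler_piMl//; first by apply: Rintegral_ge0 => t _; rewrite addr_ge0// sqr_ge0.
  by rewrite invf_le1 ?exprn_gt0// exprn_ege1.
rewrite RintegralD//; have := lerD l1 l2; rewrite -/(A _) => H; apply: (le_trans H).
by apply: le_of_eq; ring.
Qed.

End kernel_risk.

Section complex_linear.
Context {R : realType}.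
Local Notation mu := (@lebesgue_measure R).

Lemma cint_sum (n : nat) (c : R) (z : 'I_n -> R -> R[i]) : (forall j, cintegrable (z j)) ->
  cint setT (fun w => c%:C * \sum_(j < n) z j w) = c%:C * \sum_(j < n) cint setT (z j).
Proof.
move=> iz.
have [i1 e1] : mu.-integrable setT (EFin \o fun w => \sum_(j < n) complex.Re (z j w)) /\
    \int[mu]_w (\sum_(j < n) complex.Re (z j w)) = \sum_(j < n) \int[mu]_w complex.Re (z j w).
  by apply: (@integrable_sum_Rintegral _ _ _ mu _ _ (fun j w => complex.Re (z j w))) => j _; exact: (iz j).1.
have [i2 e2] : mu.-integrable setT (EFin \o fun w => \sum_(j < n) complex.Im (z j w)) /\
    \int[mu]_w (\sum_(j < n) complex.Im (z j w)) = \sum_(j < n) \int[mu]_w complex.Im (z j w).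
  by apply: (@integrable_sum_Rintegral _ _ _ mu _ _ (fun j w => complex.Im (z j w))) => j _; exact: (iz j).2.
have RS : complex.Re (\sum_(j < n) cint setT (z j)) = \sum_(j < n) \int[mu]_w complex.Re (z j w).
  exact: (raddf_sum (@complex.Re R)).
have IS : complex.Im (\sum_(j < n) cint setT (z j)) = \sum_(j < n) \int[mu]_w complex.Im (z j w).
  exact: (raddf_sum (@complex.Im R)).
apply/eqP; rewrite eq_complex; apply/andP; split; apply/eqP.
  transitivity (\int[mu]_w (c * \sum_(j < n) complex.Re (z j w))).
    apply: eq_Rintegral => w _.
    rewrite -(raddf_sum (@complex.Re R)); case: (\sum_(j < n) _) => a b /=; ring.
  rewrite RintegralZl// e1 -RS; case: (\sum_(j < n) _) => a b /=; ring.
transitivity (\int[mu]_w (c * \sum_(j < n) complex.Im (z j w))).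
  apply: eq_Rintegral => w _.
  rewrite -(raddf_sum (@complex.Im R)); case: (\sum_(j < n) _) => a b /=; ring.
rewrite RintegralZl// e2 -IS; case: (\sum_(j < n) _) => a b /=; ring.
Qed.

Lemma cintegrable_expi (z : R -> R[i]) (y : R) : cintegrable z -> cintegrable (fun w => expi (w * y) * z w).
Proof.
move=> iz; apply: (cabs_integrable _ (cintegrable_cabs iz)).
  apply: cmeasurableM; last exact: cintegrable_cmeasurable.
  split => /=; [exact: measurable_cosMr|exact: measurable_sinMr].
by move=> w; rewrite cabsM cabs_expi mul1r.
Qed.

Lemma cint_empirical (D : set R) (n : nat) (gs phis : R -> R[i]) (Y : 'I_n -> R) :
  cintegrable (trunc D (fourier_ratio gs phis)) ->
  cint D (fun w => empirical_cf Y w / gs w * phis (- w)) =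
  ((n%:R)^-1)%:C * \sum_(j < n) fourier (trunc D (fourier_ratio gs phis)) (Y j).
Proof.
move=> iz; rewrite cint_trunc.
rewrite (_ : trunc D _ = fun w => ((n%:R)^-1)%:C * \sum_(j < n) (expi (w * Y j) * trunc D (fourier_ratio gs phis) w)).
  rewrite cint_sum; last by move=> j; exact: cintegrable_expi.
  congr (_ * _); apply: eq_bigr => j _; rewrite /fourier; congr (cint _ _).
  by apply/funext => w; rewrite [w * _]mulrC.
apply/funext => w; rewrite -big_distrl/= /trunc; case: ifP => _; last by rewrite !mulr0.
by rewrite /empirical_cf /fourier_ratio -!mulrA; congr (_ * (_ * _)); rewrite mulrC.
Qed.

End complex_linear.

Section estimator_risk.
Context {R : realType}.
Local Notation mu := (@lebesgue_measure R).
Variables (s B : R) (g phi : R -> R) (phis : R -> R[i]) (G : R).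
Hypotheses (g_pdf : is_pdf g) (gG : forall x, g x <= G) (mphis : cmeasurable phis).
Hypothesis gs_neq0 : forall w, rfourier g w != 0.
Hypothesis Phi_fourier : forall f : R -> R, sobolev_ball s B f ->
       [/\ mu.-integrable setT (fun x => (phi x * f x)%:E),
           cintegrable (fun w => rfourier f w * phis (- w)) &
           (functional phi f)%:C =
             ((2 * pi)^-1)%:C *
               cint setT (fun w => rfourier f w * phis (- w))].

Local Notation r := (fourier_ratio (rfourier g) phis).

Let Phi_Re f : sobolev_ball s B f ->
  complex.Re (cint setT (fun w => rfourier f w * phis (- w))) = 2 * pi * functional phi f.
Proof.
move=> /Phi_fourier[_ _]; case: (cint _ _) => a b /= /eqP; rewrite eq_complex/= => /andP[/eqP -> _].
by rewrite mul0r subr0 mulVKf// mulf_neq0// gt_eqF// pi_gt0.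
Qed.

(** The functional is real, so the identity in [Phi_fourier] forces this part to vanish. *)
Let Phi_Im f : sobolev_ball s B f ->
  complex.Im (cint setT (fun w => rfourier f w * phis (- w))) = 0.
Proof.
move=> /Phi_fourier[_ _]; case: (cint _ _) => a b /= /eqP; rewrite eq_complex/= => /andP[_].
rewrite mul0r addr0 eq_sym mulf_eq0 invr_eq0 mulf_eq0 pnatr_eq0/= => /orP[|/eqP//].
by rewrite gt_eqF// pi_gt0.
Qed.

Lemma trunc_ratioE D f w : trunc D r w * (rfourier f w * rfourier g w) =
  trunc D (fun w => rfourier f w * phis (- w)) w.
Proof.
rewrite /trunc; case: ifP => _; last by rewrite mul0r.
by rewrite /fourier_ratio mulrCA -mulrA mulVf ?mulr1// gs_neq0.
Qed.

(** The transform of g cancels in the mean of the kernel, which is therefore the Fourier integral of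
    the functional cut at 1/h. The constant 80 pi of Plancherel and the squared bias are counted
    once for each of the real and imaginary parts, hence 160 pi and 2. *)
Lemma max_risk_le_trunc (h v bias : R) (n : nat) : (0 < n)%N -> 0 < h ->
  cintegrable (trunc `[- h^-1, h^-1] r) ->
  (\int[mu]_(w in `[(- h^-1)%R, h^-1%R]) (cabs (r w) ^+ 2)%:E <= v%:E)%E ->
  (forall f, sobolev_ball s B f ->
     tail_int (fun w => cabs (rfourier f w * phis (- w))) h^-1 <= bias) ->
  (max_risk s B g phi phis h n <= (160 * pi * G * v / n%:R + 2 * bias ^+ 2)%:E)%E.
Proof.
move=> n0 h0 ir rv fb; have hn0 : h != 0 by rewrite gt_eqF.
apply: ge_ereal_sup => _ [f [Of [d [T [P [theta [xi [model ->]]]]]]]].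
have [f_pdf _] := Of; have [th_f xi_g _] := model.
have [_ iq _] := Phi_fourier Of.
have KD : (\int[mu]_y (cabs (fourier (trunc `[- h^-1, h^-1] r) y) ^+ 2)%:E <= (80 * pi * v)%:E)%E.
  apply: (le_trans (cplancherel_le ir)); rewrite integral_trunc_sqr [in leRHS]EFinM.
  by rewrite lee_wpmul2l// lee_fin mulr_ge0// pi_ge0.
have ef i := expectation_fourier f_pdf (th_f i) g_pdf (xi_g i) (fun A B => @model_indep _ _ _ _ _ _ _ _ _ model i A B) ir.
pose m := cint `[- h^-1, h^-1] (fun w => rfourier f w * phis (- w)).
have mE : cint setT (fun w => trunc `[- h^-1, h^-1] r w * (rfourier f w * rfourier g w)) = m.
  by rewrite /m [RHS]cint_trunc; congr (cint _ _); apply/funext => w; exact: trunc_ratioE.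
rewrite mE in ef.
have := kernel_risk n0 g_pdf gG model (cmeasurable_fourier ir) KD (functional phi f)%:C
  (fun i => congr1 (@complex.Re R) (ef i)) (fun i => congr1 (@complex.Im R) (ef i)).
rewrite (_ : (fun t => _) = (fun x => ((cabs (estimator (rfourier g) phis h (fun i => theta i x + xi i x)
               - (functional phi f)%:C)) ^+ 2)%R)); last first.
  by apply/funext => t; rewrite /estimator hn0 cint_empirical.
move=> /le_trans; apply; rewrite lee_fin.
apply: lerD; first by apply: le_of_eq; ring.
have mq := cintegrable_cmeasurable iq.
have ic := cintegrable_cabs iq.
have b1 : `|complex.Re m - 2 * pi * complex.Re (functional phi f)%:C| <= bias.
  rewrite /= -(Phi_Re Of) distrC; apply: le_trans (fb _ Of).
  apply: Rintegral_itv_tail_le => //; first exact: mq.1.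
  by move=> w; exact: Re_le_cabs.
have b2 : `|complex.Im m - 2 * pi * complex.Im (functional phi f)%:C| <= bias.
  rewrite /= mulr0 -(Phi_Im Of) distrC; apply: le_trans (fb _ Of).
  apply: Rintegral_itv_tail_le => //; first exact: mq.2.
  by move=> w; exact: Im_le_cabs.
rewrite -(real_normK (num_real (_ - 2 * pi * complex.Re _))).
rewrite -[X in _ + X <= _](real_normK (num_real _)).
rewrite [X in _ <= X](_ : _ = bias ^+ 2 + bias ^+ 2); last by ring.
have bias0 := le_trans (normr_ge0 _) b1.
by apply: lerD; apply: lerXn2r; rewrite ?nnegrE.
Qed.

(** Expectations are continuous in the L^2 norm of the kernel: Jensen's inequality, then the bound G
    on the density of X + Z. *)
Lemma model_L2_expectation (u ts : R -> R) (e : \bar R) d (T : measurableType d) (P : probability T R)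
    (X Z : {RV P >-> R}) :
  has_pdf Z g ->
  (forall A B, measurable A -> measurable B ->
    (P (X @^-1` A `&` Z @^-1` B) = P (X @^-1` A) * P (Z @^-1` B))%E) ->
  measurable_fun setT u -> measurable_fun setT ts ->
  P.-integrable setT (EFin \o fun t => ts (X t + Z t)) ->
  P.-integrable setT (EFin \o fun t => u (X t + Z t)) ->
  (\int[mu]_y ((ts y - u y) ^+ 2)%:E <= e)%E -> (e < +oo)%E ->
  (((\int[P]_t ts (X t + Z t) - \int[P]_t u (X t + Z t)) ^+ 2)%:E <= G%:E * e)%E.
Proof.
move=> Zg ind mU mts its iU le_e e_fin.
have G0 : 0 <= G by have [_ /(_ 0) g0 _] := g_pdf; exact: le_trans (gG 0).
have mY : measurable_fun setT (fun t => X t + Z t) by exact: measurable_funD.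
have mk : measurable_fun setT (fun y => ((ts y - u y) ^+ 2)%:E).
  by apply/measurable_EFinP; apply: measurable_funX; exact: measurable_funB.
have H : (\int[P]_t ((ts (X t + Z t) - u (X t + Z t)) ^+ 2)%:E <= G%:E * e)%E.
  apply: (le_trans (sum_ge0_integral_le g_pdf Zg ind gG mk (fun y => _))).
    by move=> y; rewrite lee_fin sqr_ge0.
  by rewrite lee_wpmul2l// lee_fin.
have mD : measurable_fun setT (fun t => ts (X t + Z t) - u (X t + Z t)).
  by apply: measurable_funB; [exact: (measurableT_comp mts mY)|exact: (measurableT_comp mU mY)].
have iD : P.-integrable setT (EFin \o fun t => (ts (X t + Z t) - u (X t + Z t)) ^+ 2).
  apply/integrableP; split; first by apply/measurable_EFinP; exact: measurable_funX.
  under eq_integral => t _ do rewrite /= ger0_norm ?sqr_ge0//.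
  by apply: (le_lt_trans H); exact: lte_mul_pinfty.
rewrite -RintegralB//; apply: le_trans H.
rewrite -[leRHS]fineK; last exact: (integrable_fin_num measurableT iD).
by rewrite lee_fin; exact: sqr_Rintegral_le.
Qed.

(** The kernel is only an L^2 limit of transforms of truncations. Fubini is applied to these; their
    expectations approach that of the kernel by [model_L2_expectation] and the full integral by
    [cvg_tail_int]. *)
Lemma L2_kernel_expectation f d (T : measurableType d) (P : probability T R) (n : nat)
    (theta xi : 'I_n -> {RV P >-> R}) i : square_integrable r -> sobolev_ball s B f ->
  deconvolution_model theta xi f g ->
  (\int[P]_t complex.Re (L2_fourier r (theta i t + xi i t))) +i*
  (\int[P]_t complex.Im (L2_fourier r (theta i t + xi i t))) =
  cint setT (fun w => rfourier f w * phis (- w)).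
Proof.
move=> r2 Of model.
have [f_pdf _] := Of; have [th_f xi_g _] := model.
have [_ iq _] := Phi_fourier Of.
have ind := fun A B => @model_indep _ _ _ _ _ _ _ _ _ model i A B.
have [_ [mts ts_oo] cvK] := L2_fourierP r2.
set ts := L2_fourier r in mts ts_oo cvK *.
pose K (T : R) := fourier (trunc `[- T, T] r).
have iT (M : R) : cintegrable (trunc `[- M, M] r) := square_integrable_trunc M r2.
pose D := fine (\int[mu]_y (cabs (ts y) ^+ 2)%:E)%E.
have DE : (\int[mu]_y (cabs (ts y) ^+ 2)%:E <= D%:E)%E.
  by rewrite /D fineK// ge0_fin_numE//; apply: integral_ge0 => y _; rewrite lee_fin sqr_ge0.
have its1 := model_integrable g_pdf gG model mts.1 (Re_kernel_le mts DE) i.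
have its2 := model_integrable g_pdf gG model mts.2 (Im_kernel_le mts DE) i.
pose q w := rfourier f w * phis (- w).
have mq := cintegrable_cmeasurable iq.
have ic := cintegrable_cabs iq.
have G0 : 0 <= G by have [_ /(_ 0) g0 _] := g_pdf; exact: le_trans (gG 0).
have EK M := expectation_fourier f_pdf (th_f i) g_pdf (xi_g i) ind (iT M).
have EKE M : cint setT (fun w => trunc `[- M, M] r w * (rfourier f w * rfourier g w)) = cint `[- M, M] q.
  by rewrite [RHS]cint_trunc; congr (cint _ _); apply/funext => w; exact: trunc_ratioE.
have small (e : R) : 0 < e -> exists M : R,
    (\int[mu]_y (cabs (ts y - K M y) ^+ 2)%:E <= e%:E)%E /\ tail_int (cabs \o q) M ^+ 2 <= e.
  move=> e0.
  have t0 : tail_int (cabs \o q) M ^+ 2 @[M --> +oo] --> (0 : R).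
    suff : tail_int (cabs \o q) M ^+ 2 @[M --> +oo] --> (0 : R) ^+ 2 by rewrite expr0n.
    apply: (@cvg_comp _ _ _ (tail_int (cabs \o q)) (fun x : R => x ^+ 2)); last exact: exprn_continuous.
    by apply: cvg_tail_int => // w; exact: cabs_ge0.
  have n1 : \forall M \near +oo, (\int[mu]_y (cabs (ts y - K M y) ^+ 2)%:E <= e%:E)%E.
    have := cvK; under eq_fun do under eq_integral do rewrite fourier_trunc.
    move=> c; have e0' : (0 < e%:E)%E by rewrite lte_fin.
    have Hn : nbhs (0%E : \bar R) [set y | (y <= e%:E)%E].
      apply: (@filterS _ _ _ [set y | (y < e%:E)%E]) => [y /ltW//|].
      by apply: open_nbhs_nbhs; split => //; exact: open_ereal_lt_ereal.
    exact: (c _ Hn).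
  have n2 : \forall M \near +oo, tail_int (cabs \o q) M ^+ 2 <= e.
    by apply: (cvgr_le 0).
  near (+oo : set_system R) => M.
  by exists M; split; near: M.
have key (x y : R) : (forall e, 0 < e -> (x - y) ^+ 2 <= (2 * G + 2) * e) -> x = y.
  move=> H; apply/eqP; rewrite -subr_eq0 -sqrf_eq0 eq_le sqr_ge0 andbT.
  apply/ler_addgt0Pl => e e0; rewrite addr0.
  have c0 : 0 < 2 * G + 2 by rewrite ltr_wpDl// mulr_ge0.
  by have := H (e / (2 * G + 2)); rewrite divr_gt0// mulrC divfK ?gt_eqF//; apply.
(* (a - c)^2 <= 2 (a - b)^2 + 2 (c - b)^2, whence the constant 2 G + 2. *)
have comb (a b c e t : R) : (a - b) ^+ 2 <= G * e -> `|c - b| <= t -> t ^+ 2 <= e -> (a - c) ^+ 2 <= (2 * G + 2) * e.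
  move=> h1 h2 h3.
  have h4 : (c - b) ^+ 2 <= e.
    rewrite -(real_normK (num_real _)); apply: le_trans h3.
    by apply: lerXn2r; rewrite ?nnegrE// (le_trans _ h2).
  have := sqr_ge0 ((a - b) + (c - b)); nra.
have mK M := cmeasurable_fourier (iT M).
(* p stands for the real or the imaginary part. *)
have part (p : R[i] -> R) : (forall z, `|p z| <= cabs z) -> (forall z1 z2, p (z1 - z2) = p z1 - p z2) ->
    (forall z : R -> R[i], cmeasurable z -> measurable_fun setT (p \o z)) ->
    P.-integrable setT (EFin \o fun t => p (ts (theta i t + xi i t))) ->
    (forall M, P.-integrable setT (EFin \o fun t => p (K M (theta i t + xi i t)))) ->
    (forall M, \int[P]_t p (K M (theta i t + xi i t)) = \int[mu]_(w in `[- M, M]) p (q w)) ->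
    \int[P]_t p (ts (theta i t + xi i t)) = \int[mu]_w p (q w).
  move=> p_le pB mp its iK EKM; apply: key => e e0; have [M [h1 h2]] := small e e0.
  have hb : (\int[mu]_y ((p (ts y) - p (K M y)) ^+ 2)%:E <= e%:E)%E.
    apply: le_trans h1; apply: ge0_le_integral => //.
    - by move=> y _; rewrite lee_fin sqr_ge0.
    - by apply/measurable_EFinP; apply: measurable_funX; apply: measurable_funB; [exact: (mp _ mts)|exact: (mp _ (mK M))].
    - apply/measurable_EFinP; apply: measurable_funX.
      by apply: (measurable_cabs (z := fun y => ts y - K M y)); apply: cmeasurableB => //; exact: mK.
    - move=> y _; rewrite lee_fin -pB -(real_normK (num_real (p _))).
      by apply: lerXn2r; rewrite ?nnegrE ?cabs_ge0.
  have h3 := model_L2_expectation (xi_g i) ind (mp _ (mK M)) (mp _ mts) its (iK M) hb (ltry _).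
  apply: (comb _ _ _ _ (tail_int (cabs \o q) M) _ _ h2); first by rewrite -lee_fin EFinM; exact: h3.
  by rewrite [X in _ - X](EKM M); apply: Rintegral_itv_tail_le => //; exact: mp.
have iK M := expectation_fourier_integrable (theta i) (xi i) (iT M).
apply/eqP; rewrite eq_complex /=; apply/andP; split; apply/eqP; apply: part => //.
- exact: Re_le_cabs.
- by case=> ? ? [].
- by move=> z [].
- by move=> M; exact: (iK M).1.
- by move=> M; have := congr1 (@complex.Re R) (EK M); rewrite EKE.
- exact: Im_le_cabs.
- by case=> ? ? [].
- by move=> z [].
- by move=> M; exact: (iK M).2.
- by move=> M; have := congr1 (@complex.Im R) (EK M); rewrite EKE.
Unshelve. all: by end_near. Qed.

(** Nothing is cut off, so the kernel has mean 2 pi times the functional and the risk is pure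
    variance. *)
Lemma max_risk_le_untruncated : square_integrable r ->
  exists2 C : R, 0 < C & forall n, (0 < n)%N -> (max_risk s B g phi phis 0 n <= (C * n%:R^-1)%:E)%E.
Proof.
move=> r2.
have G0 : 0 <= G by have [_ /(_ 0) g0 _] := g_pdf; exact: le_trans (gG 0).
(* One kernel for both readings of the estimator at h = 0: square integrable by [cplancherel_le] in
   the first case, by [L2_fourierP] in the second. *)
pose K := if `[< cintegrable r >] then fourier r else L2_fourier r.
have truncT : trunc setT r = r by apply/funext => w; rewrite /trunc in_setT.
have mK : cmeasurable K.
  by rewrite /K; case: asboolP => [/cmeasurable_fourier//|_]; have [_ []] := L2_fourierP r2.
have K_oo : (\int[mu]_y (cabs (K y) ^+ 2)%:E < +oo)%E.
  rewrite /K; case: asboolP => [ir|_]; last by have [_ []] := L2_fourierP r2.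
  apply: (le_lt_trans (cplancherel_le ir)); apply: lte_mul_pinfty => //.
    by rewrite lee_fin mulr_ge0// pi_ge0.
  exact: r2.2.
pose D := fine (\int[mu]_y (cabs (K y) ^+ 2)%:E)%E.
have D0 : 0 <= D by rewrite fine_ge0//; apply: integral_ge0 => y _; rewrite lee_fin sqr_ge0.
have DE : (\int[mu]_y (cabs (K y) ^+ 2)%:E <= D%:E)%E.
  by rewrite /D fineK// ge0_fin_numE//; apply: integral_ge0 => y _; rewrite lee_fin sqr_ge0.
exists (2 * (G * D) + 1); first by rewrite ltr_wpDl// !mulr_ge0.
move=> n n0.
apply: ge_ereal_sup => _ [f [Of [d [T [P [theta [xi [model ->]]]]]]]].
have [f_pdf _] := Of; have [th_f xi_g _] := model.
have EK i : (\int[P]_t complex.Re (K (theta i t + xi i t))) +i*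
    (\int[P]_t complex.Im (K (theta i t + xi i t))) = cint setT (fun w => rfourier f w * phis (- w)).
  rewrite /K; case: asboolP => ir; last exact: L2_kernel_expectation.
  rewrite (expectation_fourier f_pdf (th_f i) g_pdf (xi_g i) (fun A B => @model_indep _ _ _ _ _ _ _ _ _ model i A B) ir).
  congr (cint _ _); apply/funext => w; rewrite -{1}truncT trunc_ratioE /trunc in_setT//.
have := kernel_risk n0 g_pdf gG model mK DE (functional phi f)%:C
  (fun i => congr1 (@complex.Re R) (EK i)) (fun i => congr1 (@complex.Im R) (EK i)).
rewrite (_ : (fun t => _) = (fun x => ((cabs (estimator (rfourier g) phis 0 (fun i => theta i x + xi i x)
               - (functional phi f)%:C)) ^+ 2)%R)); last first.
  apply/funext => t; rewrite /estimator eqxx/= /K; case: asboolP => // ir.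
  by rewrite cint_empirical truncT.
move=> /le_trans; apply; rewrite lee_fin Phi_Re// Phi_Im//= mulr0 !subrr expr0n/= !addr0.
by rewrite ler_wpM2r ?invr_ge0// lerDl.
Qed.

End estimator_risk.

(** * Uniform boundedness on the Sobolev ball *)

Section mixtures.
Context {R : realType}.
Local Notation mu := (@lebesgue_measure R).

Lemma cabsD (z1 z2 : R[i]) : cabs (z1 + z2) <= cabs z1 + cabs z2.
Proof. by rewrite -lecR rmorphD; exact: (ler_normD z1 z2). Qed.

Lemma cabs_real_mul (c : R) (z : R[i]) : 0 <= c -> cabs (c%:C * z) = c * cabs z.
Proof. by move=> c0; rewrite cabsM; congr (_ * _); rewrite /cabs /= expr0n/= addr0 sqrtr_sqr ger0_norm. Qed.

(** If c + i s is the value of the transform, its squared modulus is the integral of (c cos + s sin)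
    f, and c cos + s sin <= sqrt(c^2 + s^2) pointwise. *)
Lemma cabs_rfourier_le1 (f : R -> R) w : is_pdf f -> cabs (rfourier f w) <= 1.
Proof.
move=> f_pdf; have i_f := pdf_integrable f_pdf; have [mf f0 f1] := f_pdf.
have e1 : \int[mu]_x f x = 1 by rewrite /Rintegral f1.
rewrite -(ler_pXn2r (n := 2)) ?nnegrE ?cabs_ge0// expr1n cabs_sqr rfourierE/=.
set c := fcos f w; set sn := fsin f w.
have [->|r0] := eqVneq (c ^+ 2 + sn ^+ 2) 0; first by [].
have rp : 0 < c ^+ 2 + sn ^+ 2 by rewrite lt_neqAle eq_sym r0 addr_ge0// sqr_ge0.
have ic := integrable_cosM i_f w; have is_ := integrable_sinM i_f w.
have E : c ^+ 2 + sn ^+ 2 = \int[mu]_x ((c * cos (x * w) + sn * sin (x * w)) * f x).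
  rewrite !expr2 {2}/c {2}/sn /fcos /fsin -!RintegralZl// -RintegralD//.
  - by apply: eq_Rintegral => x _; ring.
  - by have := integrableZl measurableT c ic.
  - by have := integrableZl measurableT sn is_.
have H : (c ^+ 2 + sn ^+ 2) <= Num.sqrt (c ^+ 2 + sn ^+ 2) * 1.
  rewrite {1}E -e1 -RintegralZl//; apply: le_Rintegral => //.
  - have := integrableD measurableT (integrableZl measurableT c ic) (integrableZl measurableT sn is_).
    by apply: eq_integrable => // x _; rewrite /= -EFinM -EFinD; congr EFin; ring.
  - by have := integrableZl measurableT (Num.sqrt (c ^+ 2 + sn ^+ 2)) i_f.
  - move=> x _; apply: ler_wpM2r => //; apply: (le_trans (ler_norm _)).
    rewrite -sqrtr_sqr; apply: ler_wsqrtr.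
    have := cos2Dsin2 (x * w); have := sqr_ge0 (c * sin (x * w) - sn * cos (x * w)); nra.
have s2 := sqr_sqrtr (ltW rp); have s0 := sqrtr_ge0 (c ^+ 2 + sn ^+ 2).
have : 0 < Num.sqrt (c ^+ 2 + sn ^+ 2) by rewrite sqrtr_gt0.
move: s2 H; rewrite mulr1; move: (Num.sqrt _) => q <-; nra.
Qed.

Lemma integrable_cst_lty (D : set (measurableTypeR R)) (c : R) : measurable D -> (mu D < +oo)%E ->
  mu.-integrable D (EFin \o cst c).
Proof.
move=> mD D_oo; apply/integrableP; split; first exact/measurable_EFinP.
have -> : (\int[mu]_(x in D) `|(EFin \o cst c) x| = `|c|%:E * mu D)%E by rewrite -integral_cst.
exact: lte_mul_pinfty.
Qed.

Section mixture.
Variables (g : nat -> R -> R).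
Hypothesis g_pdf : forall j, is_pdf (g j).

Let term m j x : \bar R := (3 / 4 * 4^-1 ^+ j * g (m + j) x)%:E.
Let S m x : \bar R := (\sum_(j <oo) term m j x)%E.

(* [mixture m] is the mixture of [g m], [g m.+1], ... with weights
   3/4, 3/16, ..., so that mixture m = 3/4 g m + 1/4 mixture m.+1 a.e. *)
Definition mixture m x : R := fine (S m x).

Let term_ge0 m j x : (0 <= term m j x)%E.
Proof. by have [_ g0 _] := g_pdf (m + j); rewrite lee_fin !mulr_ge0// exprn_ge0. Qed.

Let S_ge0 m x : (0 <= S m x)%E.
Proof. by apply: nneseries_ge0. Qed.

Let mterm m j : measurable_fun setT (term m j).
Proof. by have [mg _ _] := g_pdf (m + j); apply/measurable_EFinP; exact: measurable_funM. Qed.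

Let mS m : measurable_fun setT (S m).
Proof. by apply: ge0_emeasurable_sum => [j x _ _|j _]; [exact: term_ge0|exact: mterm]. Qed.

Let S_rec m x : S m x = ((3 / 4 * g m x)%:E + (4^-1)%:E * S m.+1 x)%E.
Proof.
rewrite /S nneseries_recl//; congr (_ + _)%E.
  by rewrite /term expr0 mulr1 addn0.
rewrite -nneseriesZl// -(nneseries_addn 1)//; apply: eq_eseriesr => j _.
by rewrite /term addn1 addSnnS exprS -EFinM; congr EFin; ring.
Qed.

Let S_int m : (\int[mu]_x S m x = 1)%E.
Proof.
rewrite integral_nneseries//; last exact: mterm.
rewrite (eq_eseriesr (g := fun j => (3 / 4 * 4^-1 ^+ j)%:E)); last first.
  move=> j _; have [mg g0 g1] := g_pdf (m + j).
  under eq_integral => x _ do rewrite /term EFinM.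
  rewrite ge0_integralZl//; first by rewrite g1 mule1.
  - exact/measurable_EFinP.
  - by move=> x _; rewrite lee_fin.
apply/cvg_lim => //.
have : series (geometric (3 / 4) 4^-1) @ \oo --> (3 / 4 * (1 - 4^-1)^-1 : R).
  by apply: cvg_geometric_series; rewrite ger0_norm//; lra.
have -> : 3 / 4 * (1 - 4^-1)^-1 = 1 :> R by field.
move=> c; apply: cvg_EFin; first by apply: nearW => n /=; rewrite sumEFin.
by apply: cvg_trans c; apply: near_eq_cvg; apply: nearW => n /=; rewrite /series/= sumEFin.
Qed.

Let S_fin m : {ae mu, forall x, S m x \is a fin_num}.
Proof.
have iS : mu.-integrable setT (S m).
  apply/integrableP; split; first exact: mS.
  have -> : (\int[mu]_x `|S m x|)%E = (\int[mu]_x S m x)%E by apply: eq_integral => x _; rewrite gee0_abs.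
  by rewrite S_int ltry.
by have := integrable_ae measurableT iS; apply: (@filterS _ _ (ae_filter_ringOfSetsType mu)) => x; apply.
Qed.

Let mixture_ae m : {ae mu, forall x, S m x = (mixture m x)%:E}.
Proof. by apply: (@filterS _ _ (ae_filter_ringOfSetsType mu)) (S_fin m) => x xf; rewrite /mixture fineK. Qed.

(** The series has integral 1, hence is finite almost everywhere; on the remaining null set [fine]
    returns 0. *)
Lemma mixture_pdf m : is_pdf (mixture m).
Proof.
have mf : measurable_fun setT (mixture m).
  by apply: measurableT_comp.
split => //; first by move=> x; exact: fine_ge0.
rewrite -(S_int m); apply: ge0_ae_eq_integral => //.
- exact/measurable_EFinP.
- exact: mS.
- by move=> x _; rewrite lee_fin; exact: fine_ge0.
- by apply: (@filterS _ _ (ae_filter_ringOfSetsType mu)) (mixture_ae m) => x E _; rewrite E.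
Qed.

Let mixture_rec m : {ae mu, forall x, mixture m x = 3 / 4 * g m x + 4^-1 * mixture m.+1 x}.
Proof.
apply: (@filterS2 _ _ (ae_filter_ringOfSetsType mu)) (mixture_ae m) (mixture_ae m.+1) => x E1 E2.
by apply: EFin_inj; rewrite -E1 S_rec E2 -EFinM -EFinD.
Qed.

Let mixture_integral m (c : R -> R) : measurable_fun setT c -> (forall x, `|c x| <= 1) ->
  \int[mu]_x (c x * mixture m x) = 3 / 4 * \int[mu]_x (c x * g m x) + 4^-1 * \int[mu]_x (c x * mixture m.+1 x).
Proof.
move=> mc c1.
have i h : is_pdf h -> mu.-integrable setT (EFin \o (fun x => c x * h x)).
  by move=> /pdf_integrable ih; exact: (@integrable_bounded_mul _ _ _ _ _ _ 1).
have i1 := i _ (g_pdf m); have i2 := i _ (mixture_pdf m.+1); have i0 := i _ (mixture_pdf m).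
rewrite -!RintegralZl// -RintegralD//; last 2 first.
- by have := integrableZl measurableT (3 / 4) i1.
- by have := integrableZl measurableT (4^-1) i2.
rewrite /Rintegral; congr fine; apply: ae_eq_integral => //.
- exact: measurable_int i0.
- by have := measurable_int _ (integrableD measurableT (integrableZl measurableT (3/4) i1) (integrableZl measurableT 4^-1 i2)).
apply: (@filterS _ _ (ae_filter_ringOfSetsType mu)) (mixture_rec m) => x E _; congr EFin; rewrite E; ring.
Qed.

Lemma rfourier_mixture m w : rfourier (mixture m) w =
  (3 / 4)%:C * rfourier (g m) w + (4^-1)%:C * rfourier (mixture m.+1) w.
Proof.
rewrite !rfourierE; apply/eqP; rewrite eq_complex; apply/andP; split; apply/eqP => /=.
  rewrite !mul0r !subr0; apply: mixture_integral; first exact: measurable_cosMr.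
  by move=> x; exact: norm_cos_le1.
rewrite !mul0r !addr0; apply: mixture_integral; first exact: measurable_sinMr.
by move=> x; exact: norm_sin_le1.
Qed.

End mixture.

Lemma cmeasurable_rfourier (f : R -> R) : mu.-integrable setT (EFin \o f) -> cmeasurable (rfourier f).
Proof.
move=> i_f; split.
  by rewrite (_ : (fun x => _) = fcos f); [exact: measurable_fcos|apply/funext => w; rewrite rfourierE].
by rewrite (_ : (fun x => _) = fsin f); [exact: measurable_fsin|apply/funext => w; rewrite rfourierE].
Qed.

Lemma measurable_rfourier (f : R -> R) : is_pdf f -> cmeasurable (rfourier f).
Proof. by move=> /pdf_integrable; exact: cmeasurable_rfourier. Qed.

Lemma measurable_sobolev_weight (e : R) : measurable_fun setT (fun w : R => (w ^+ 2 + 1) `^ e).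
Proof.
apply: (@measurableT_comp _ _ _ _ _ _ (fun x : R => x `^ e)); first exact: measurable_powR.
by apply: measurable_funD => //; exact: measurable_funX.
Qed.

(** Convexity is used one step at a time: on a bounded interval the energy I satisfies I(mixture m)
    <= 3/4 B^2 + 1/4 I(mixture (m+1)). Iterating k times leaves B^2 plus 4^(-k) times a bound valid
    for all mixtures on that interval; k and then the interval tend to infinity. *)
Lemma sobolev_ball_mixture (s B : R) (g : nat -> R -> R) m : 0 <= s -> (forall j, sobolev_ball s B (g j)) ->
  sobolev_ball s B (mixture g m).
Proof.
move=> s0 Hg; have g_pdf j : is_pdf (g j) by have [] := Hg j.
have f_pdf := mixture_pdf g_pdf.
split => //.
pose u h w : R := (cabs (rfourier h w)) ^+ 2 * (w ^+ 2 + 1) `^ s.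
have u0 h w : 0 <= u h w by rewrite mulr_ge0 ?powR_ge0 ?exprn_ge0 ?cabs_ge0.
have mu_ h : is_pdf h -> measurable_fun setT (u h).
  move=> hp; apply: measurable_funM; last exact: measurable_sobolev_weight.
  by apply: measurable_funX; apply: measurable_cabs; exact: measurable_rfourier.
apply: (@ge0_integral_le_itv _ (EFin \o u (mixture g m))) => [|w|n].
- by apply/measurable_EFinP; exact: mu_.
- by rewrite lee_fin.
pose D : set (measurableTypeR R) := `[- n%:R, n%:R]%classic.
have mD : measurable D by exact: measurable_itv.
have D_oo : (mu D < +oo)%E by rewrite /D lebesgue_measure_itv; case: ifP => _; rewrite ?ltry// -EFinB ltry.
pose c : R := (n%:R ^+ 2 + 1) `^ s.
have uc h w : is_pdf h -> D w -> u h w <= c.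
  move=> hp; rewrite /D/= in_itv/= => /andP[w1 w2].
  rewrite -[c]mul1r; apply: ler_pM; rewrite ?powR_ge0 ?exprn_ge0 ?cabs_ge0//.
    by rewrite exprn_ile1 ?cabs_ge0//; exact: cabs_rfourier_le1.
  apply: ge0_ler_powR => //; rewrite ?nnegrE ?addr_ge0 ?sqr_ge0//.
  by rewrite lerD2r; nra.
have iu h : is_pdf h -> mu.-integrable D (EFin \o u h).
  move=> hp.
  have ic : mu.-integrable D (EFin \o cst c).
    by exact: integrable_cst_lty.
  apply: (le_integrable _ _ _ ic) => //; first by apply/measurable_EFinP; apply: measurable_funTS; exact: mu_.
  by move=> w Dw /=; rewrite lee_fin !ger0_norm ?powR_ge0//; exact: uc.
pose I h := \int[mu]_(w in D) u h w.
have IB j : I (g j) <= B ^+ 2.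
  have [_ H] := Hg j; rewrite -lee_fin; apply: le_trans H.
  rewrite /I /Rintegral fineK; last exact: integrable_fin_num (iu _ (g_pdf j)).
  apply: ge0_subset_integral => //.
    by apply/measurable_EFinP; exact: mu_.
  by move=> w _; rewrite lee_fin; exact: u0.
(* Crude bound on [-n, n] from transforms of modulus at most 1; it makes the remainder of the
   iteration vanish. *)
have [K' IK] : exists K', forall j, I (mixture g j) <= K'.
  exists (\int[mu]_(w in D) c) => j; apply: le_Rintegral => //; first exact: iu.
    by exact: integrable_cst_lty.
  by move=> w Dw; exact: uc.
have rec j : I (mixture g j) <= 3 / 4 * B ^+ 2 + 4^-1 * I (mixture g j.+1).
  apply: (@le_trans _ _ (3 / 4 * I (g j) + 4^-1 * I (mixture g j.+1))); last by rewrite lerD2r ler_wpM2l.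
  have i1 := iu _ (g_pdf j); have i2 := iu _ (f_pdf j.+1).
  have i1' : mu.-integrable D (EFin \o (fun w => 3 / 4 * u (g j) w)) by have := integrableZl mD (3/4) i1.
  have i2' : mu.-integrable D (EFin \o (fun w => 4^-1 * u (mixture g j.+1) w)) by have := integrableZl mD 4^-1 i2.
  have ptw w : u (mixture g j) w <= 3 / 4 * u (g j) w + 4^-1 * u (mixture g j.+1) w.
    rewrite /u !mulrA -mulrDl; apply: ler_wpM2r; first exact: powR_ge0.
    rewrite rfourier_mixture//.
    have := cabsD ((3 / 4)%:C * rfourier (g j) w) ((4^-1)%:C * rfourier (mixture g j.+1) w).
    rewrite !cabs_real_mul//.
    move: (cabs_ge0 ((3 / 4)%:C * rfourier (g j) w + (4^-1)%:C * rfourier (mixture g j.+1) w)).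
    move: (cabs_ge0 (rfourier (g j) w)) (cabs_ge0 (rfourier (mixture g j.+1) w)).
    move: (cabs _) (cabs _) (cabs _) => z q p p0 q0 z0 H.
    have : z ^+ 2 <= (3 / 4 * p + 4^-1 * q) ^+ 2 by rewrite !expr2; nra.
    by have := sqr_ge0 (p - q); nra.
  have := integrableD mD i1' i2'; have := iu _ (f_pdf j).
  have := RintegralD mD i1' i2'; rewrite (RintegralZl (3 / 4) mD i1) (RintegralZl 4^-1 mD i2) /I => <-.
  by move: i1 i2 i1' i2' ptw => _ _ _ _; move: (u _) (u _) (u _) => u1 u2 u3 ptw ia ib; exact: le_Rintegral.
have it k : I (mixture g m) <= B ^+ 2 + 4^-1 ^+ k * `|K'|.
  have : forall j, I (mixture g j) <= B ^+ 2 + 4^-1 ^+ k * `|K'|.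
    elim: k => [j|k ih j].
      by rewrite expr0 mul1r (le_trans (IK j))// (le_trans (ler_norm _))// lerDr sqr_ge0.
    by apply: (le_trans (rec j)); have := ih j.+1; rewrite [4^-1 ^+ k.+1]exprS -mulrA; lra.
  exact.
rewrite -[leLHS]fineK; last exact: integrable_fin_num (iu _ (f_pdf m)).
rewrite lee_fin -/(Rintegral _ _ _) -/(I _).
have c1 : B ^+ 2 + 4^-1 ^+ k * `|K'| @[k --> \oo] --> B ^+ 2 + 0 * `|K'|.
  apply: cvgD; first exact: cvg_cst.
  by apply: cvgM; [apply: cvg_expr; rewrite ger0_norm//; lra|exact: cvg_cst].
have := limr_ge (cvgP _ c1) (nearW _ it).
by rewrite (cvg_lim _ c1)// mul0r addr0; apply.
Qed.

Section uniform_bound.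
Variables (s B C : R) (psi : R -> R[i]).
Hypotheses (s0 : 0 <= s) (psiC : forall w, cabs (psi w) <= C).
Hypothesis ipsi : forall f, sobolev_ball s B f -> cintegrable (fun w => rfourier f w * psi w).

Let p f w := cabs (rfourier f w * psi w).

Let N f : R := \int[mu]_w p f w.

Let NW W f : R := \int[mu]_(w in `[- W, W]) p f w.

Let ip f : sobolev_ball s B f -> mu.-integrable setT (EFin \o p f).
Proof. by move=> /ipsi/cintegrable_cabs. Qed.

Let p0 f w : 0 <= p f w. Proof. exact: cabs_ge0. Qed.

Let iD W f : sobolev_ball s B f -> mu.-integrable `[- W, W] (EFin \o p f).
Proof. by move=> Of; apply: (@integrableS _ _ _ mu setT) => //; exact: ip. Qed.

Let NW_le W f : sobolev_ball s B f -> NW W f <= N f.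
Proof.
move=> Of; rewrite /N (split_tail (ip Of) W) lerDl; exact: tail_int_ge0.
Qed.

Let NW_bounded W f : sobolev_ball s B f -> NW W f <= \int[mu]_(w in `[- W, W]) C.
Proof.
move=> Of; apply: le_Rintegral => //; first exact: iD.
  apply: integrable_cst_lty => //; rewrite lebesgue_measure_itv; case: ifP => _; rewrite ?ltry// -EFinB ltry.
move=> w _; rewrite /p cabsM; apply: le_trans (psiC w); rewrite ler_piMl ?cabs_ge0//.
by have [/cabs_rfourier_le1] := Of.
Qed.

Let NW_mixture W (c1 c2 : R) f f1 f2 : 0 <= c1 -> 0 <= c2 ->
  sobolev_ball s B f -> sobolev_ball s B f1 -> sobolev_ball s B f2 ->
  (forall w, p f w <= c1 * p f1 w + c2 * p f2 w) ->
  NW W f <= c1 * NW W f1 + c2 * NW W f2.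
Proof.
move=> c10 c20 Of O1 O2 H; have mD : measurable (`[- W, W]%classic : set (measurableTypeR R)) by [].
have i1 := iD W O1; have i2 := iD W O2.
have i1' : mu.-integrable `[- W, W] (EFin \o (fun w => c1 * p f1 w)) by have := integrableZl mD c1 i1.
have i2' : mu.-integrable `[- W, W] (EFin \o (fun w => c2 * p f2 w)) by have := integrableZl mD c2 i2.
have := integrableD mD i1' i2'; have := iD W Of.
have := RintegralD mD i1' i2'; rewrite (RintegralZl c1 mD i1) (RintegralZl c2 mD i2) /NW => <-.
by move: i1 i2 i1' i2' H => _ _ _ _; move: (p _) (p _) (p _) => u1 u2 u3 H ia ib; exact: le_Rintegral.
Qed.

(** Triangle inequality in mixture m = 3/4 g m + 1/4 mixture (m+1), solved for each of the three
    terms. *)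
Let p_mixture (g : nat -> R -> R) : (forall k, is_pdf (g k)) -> forall m w,
    p (mixture g m) w <= 3 / 4 * p (g m) w + 4^-1 * p (mixture g m.+1) w /\
    3 / 4 * p (g m) w <= p (mixture g m) w + 4^-1 * p (mixture g m.+1) w /\
    4^-1 * p (mixture g m.+1) w <= p (mixture g m) w + 3 / 4 * p (g m) w.
Proof.
move=> g_pdf m w.
  have pM f : p f w = cabs (rfourier f w) * cabs (psi w) by exact: cabsM.
  rewrite !pM; have := cabs_ge0 (psi w); have := rfourier_mixture g_pdf m w.
  move: (rfourier _ _) (rfourier _ _) (rfourier _ _) (cabs (psi w)) => c b a q E q0.
  have e1 : (3 / 4)%:C * b = a + (- (4^-1)%:C * c) by rewrite E mulNr addrK.
  have e2 : (4^-1)%:C * c = a + (- (3 / 4)%:C * b) by rewrite E mulNr addrAC subrr add0r.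
  have nN (t : R) z : 0 <= t -> cabs (- t%:C * z) = t * cabs z.
    by move=> t0; rewrite -rmorphN cabsM /cabs/= expr0n/= addr0 sqrtr_sqr normrN ger0_norm.
  have := cabsD ((3 / 4)%:C * b) ((4^-1)%:C * c); rewrite -E !cabs_real_mul//.
  have := cabsD a (- (4^-1)%:C * c); rewrite -e1 nN// cabs_real_mul//.
  have := cabsD a (- (3 / 4)%:C * b); rewrite -e2 nN// cabs_real_mul//.
  by move=> h1 h2 h3; do ![split]; nra.
Qed.

(** Write f_k for [mixture g k]. Solving the recursion backwards, f_(k+1) = 4 f_k - 3 g_k on the
    Fourier side, bounds every window integral of f_k by 4^k (N(f_0) + A_k), where A_k collects the
    masses of the earlier members. On its window g_k is a near-maximizer, so f_(k+1) has at most
    10/9 of its mass there and f_k at least 3/4 - 10/36 = 17/36 of it, more than the quarter that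
    exceeds 4^k (k + A_k). Hence k < N(f_0) for all k. *)
Let hump_absurd (g : nat -> R -> R) (W A : nat -> R) :
  A 0 = 0 -> (forall k, A k.+1 = A k + 3 / 4 * 4^-1 ^+ k * N (g k)) ->
  (forall k, [/\ sobolev_ball s B (g k), 4 ^+ k * (k%:R + A k) * 4 < NW (W k) (g k) &
    forall f, sobolev_ball s B f -> 9 / 10 * NW (W k) f <= NW (W k) (g k)]) -> False.
Proof.
move=> A0 AS Hk.
have c43 : 0 <= 4 / 3 :> R by [].
have c13 : 0 <= 1 / 3 :> R by [].
have ar0 (t u F a n : R) : t * 4 * (3 / 4 * u * n) = 3 * n -> 4 * (t * (F + a)) + 3 * n = t * 4 * (F + (a + 3 / 4 * u * n)).
  by move=> <-; ring.
have ar1 (x y z n t v : R) : x <= 4 * y + 3 * z -> z <= n -> y <= t -> 4 * t + 3 * n = v -> x <= v by lra.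
have ar4 (x y z : R) : 4^-1 * x <= y + 3 / 4 * z -> x <= 4 * y + 3 * z by lra.
have ar2 (x y z : R) : 3 / 4 * x <= y + 4^-1 * z -> x <= 4 / 3 * y + 1 / 3 * z by lra.
have ar3 (t n k a x y z : R) : 0 <= k + a -> 0 < t -> t * (k + a) * 4 < x -> 9 / 10 * z <= x ->
    x <= 4 / 3 * y + 1 / 3 * z -> y <= t * (n + a) -> k < n.
  move=> ka0 t0 h1 h2 h3 h4; have : t * (k + a) < t * (n + a) by have := mulr_ge0 (ltW t0) ka0; lra.
  by rewrite ltr_pM2l// ltrD2r.
have Og k : sobolev_ball s B (g k) by have [] := Hk k.
have g_pdf k : is_pdf (g k) by have [] := Og k.
have Of m := sobolev_ball_mixture m s0 Og.
have pE := p_mixture g_pdf.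
have up k X : NW X (mixture g k) <= 4 ^+ k * (N (mixture g 0) + A k).
  elim: k => [|k ih]; first by rewrite A0 expr0 mul1r addr0; exact: NW_le.
  have h : NW X (mixture g k.+1) <= 4 * NW X (mixture g k) + 3 * NW X (g k).
    have H w : p (mixture g k.+1) w <= 4 * p (mixture g k) w + 3 * p (g k) w.
      by have [_ [_ h]] := pE k w; exact: ar4.
    exact: (@NW_mixture X _ _ _ _ _ (ler0n R 4) (ler0n R 3) (Of k.+1) (Of k) (Og k) H).
  have h2 := NW_le X (Og k).
  have E : 4 ^+ k * 4 * (3 / 4 * 4^-1 ^+ k * N (g k)) = 3 * N (g k).
    rewrite exprVn; field; rewrite expf_neq0//; lra.
  rewrite exprSr AS; exact: (ar1 _ _ _ _ _ _ h h2 ih (ar0 _ _ _ _ _ E)).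
have lo k : k%:R < N (mixture g 0).
  have [_ h1 /(_ _ (Of k.+1)) h2] := Hk k.
  have h : NW (W k) (g k) <= 4 / 3 * NW (W k) (mixture g k) + 1 / 3 * NW (W k) (mixture g k.+1).
    have H w : p (g k) w <= 4 / 3 * p (mixture g k) w + 1 / 3 * p (mixture g k.+1) w.
      by have [_ [h _]] := pE k w; exact: ar2.
    exact: (@NW_mixture (W k) _ _ _ _ _ c43 c13 (Og k) (Of k) (Of k.+1) H).
  have t0 : 0 < 4 ^+ k :> R by rewrite exprn_gt0.
  have kA0 : 0 <= k%:R + A k.
    rewrite addr_ge0//; elim: k {h1 h2 h t0} => [|k ih]; first by rewrite A0.
    by rewrite AS addr_ge0// !mulr_ge0 ?exprn_ge0//; apply: Rintegral_ge0 => w _; exact: p0.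
  exact: (ar3 _ _ _ _ _ _ _ kA0 t0 h1 h2 h (up k (W k))).
have [k hk] : exists k : nat, N (mixture g 0) < k%:R.
  by exists (Num.truncn `|N (mixture g 0)|).+1; apply: le_lt_trans (ler_norm _) _; exact: truncnS_gt.
by have := lo k; rewrite ltNge (ltW hk).
Qed.

(* Gliding hump: if the integrals were unbounded on the ball, some mixture of
   members chosen adaptively would have an infinite one. *)
Lemma uniform_Fourier_bound : exists M : R, forall f, sobolev_ball s B f -> N f <= M.
Proof.
have ar1 (n x y z : R) : 0 <= n -> 2 * n < x -> x <= y -> y - y / 10 < z -> n < z by lra.
have ar2 (x y z : R) : x <= y -> y - y / 10 < z -> 9 / 10 * x <= z by lra.
apply: contrapT => /forallNP unbounded.
(* Beyond any level M there are a window and a member of the ball that exceeds M on it and comes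
   within a tenth of the supremum over the ball. The supremum is finite by [NW_bounded]. *)
have pick (M : R) : {Wg : R * (R -> R) | [/\ sobolev_ball s B Wg.2, M < NW Wg.1 Wg.2 &
    forall f, sobolev_ball s B f -> 9 / 10 * NW Wg.1 f <= NW Wg.1 Wg.2]}.
  apply: cid; have /existsNP[g0 /not_implyP[Og0 /negP]] := unbounded (2 * `|M| + 1).
  rewrite -ltNge => g0M.
  have [W hW] : exists W, 2 * `|M| < NW W g0.
    have /cvgrPdist_lt/(_ _ ltr01)[W [_ HW]] := cvg_tail_int (p0 g0) (ip Og0).
    exists (W + 1); have := HW (W + 1); rewrite ltrDl ltr01 => /(_ isT).
    rewrite /= sub0r normrN ger0_norm ?tail_int_ge0//.
    by move: g0M; rewrite /N (split_tail (ip Og0) (W + 1)) /NW; lra.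
  pose A := [set NW W f | f in sobolev_ball s B].
  have supA : has_sup A.
    split; first by exists (NW W g0); exists g0.
    by exists (\int[mu]_(w in `[- W, W]) C) => _ [f Of <-]; exact: NW_bounded.
  have g0A : NW W g0 <= sup A by apply: ub_le_sup; [exact: supA.2|exists g0].
  have e0 : 0 < sup A / 10 by have := normr_ge0 M; lra.
  have [_ [g Og <-] hg] := sup_adherent e0 supA.
  have hM := ler_norm M; have M0 := normr_ge0 M.
  exists (W, g); split; [exact: Og|exact: (le_lt_trans hM (ar1 _ _ _ _ M0 hW g0A hg))|].
  by move=> f Of; apply: (ar2 _ _ _ _ hg); apply: ub_le_sup; [exact: supA.2|exists f].
pose next (k : nat) (A : R) := sval (pick (4 ^+ k * (k%:R + A) * 4)).
(* The level for the k-th member depends on the masses of all earlier ones, so A and the choices are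
   defined by one recursion. *)
pose fix A (k : nat) : R := if k is j.+1 then A j + 3 / 4 * 4^-1 ^+ j * N (next j (A j)).2 else 0.
pose g k := (next k (A k)).2.
pose W k := (next k (A k)).1.
have Hk k : [/\ sobolev_ball s B (g k), 4 ^+ k * (k%:R + A k) * 4 < NW (W k) (g k) &
    forall f, sobolev_ball s B f -> 9 / 10 * NW (W k) f <= NW (W k) (g k)].
  exact: (svalP (pick (4 ^+ k * (k%:R + A k) * 4))).
exact: (@hump_absurd g W A).
Qed.

End uniform_bound.

End mixtures.

(** * Integrals of power-exponential weights *)

Section primitive_bounds.
Context {R : realType}.
Local Notation mu := (@lebesgue_measure R).

Lemma ge0_integral_le_primitive (F f u : R -> R) (x y : R) : x <= y ->
  {in `[x, y], forall w : R, is_derive w (1 : R) F (f w)} ->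
  {in `[x, y], forall w : R, {for w, continuous f}} ->
  measurable_fun setT u -> (forall w, 0 <= u w) -> {in `[x, y], forall w, u w <= f w} ->
  (\int[mu]_(w in `[x, y]) (u w)%:E <= (F y - F x)%:E)%E.
Proof.
move=> xy dF cf mu_ u0 uf; have [i_f <-] := FTC2_is_derive xy dF cf.
have mD : measurable (`[x, y]%classic : set (measurableTypeR R)) by exact: measurable_itv.
rewrite /Rintegral fineK; last exact: (integrable_fin_num mD i_f).
apply: ge0_le_integral => //.
- by move=> w _; rewrite lee_fin.
- by apply: measurable_funTS; exact/measurable_EFinP.
- exact: measurable_int i_f.
Qed.

Lemma ge0_integral_setU_le (A B : set (measurableTypeR R)) (u : R -> R) : measurable A -> measurable B ->
  measurable_fun setT u -> (forall w, 0 <= u w) ->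
  (\int[mu]_(w in A `|` B) (u w)%:E <= \int[mu]_(w in A) (u w)%:E + \int[mu]_(w in B) (u w)%:E)%E.
Proof.
move=> mA mB mu_ u0; rewrite -(setDUK (@subsetUl _ A B)).
have mBA : measurable ((A `|` B) `\` A) by apply: measurableD => //; exact: measurableU.
rewrite ge0_integral_setU//.
- apply: leeD => //; apply: ge0_subset_integral => //.
  + by apply: measurable_funTS; exact/measurable_EFinP.
  + by move=> w _; rewrite lee_fin.
  + by move=> w [[]].
- by apply: measurable_funTS; exact/measurable_EFinP.
- by move=> w _; rewrite lee_fin.
- by apply/disj_setPS => w [? []].
Qed.

Variable u : R -> R.
Hypotheses (mu_ : measurable_fun setT u) (u0 : forall w, 0 <= u w).
Variables (F f : R -> R) (x0 : R).
Hypotheses (x0_gt0 : 0 < x0)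
  (dF : forall w : R, x0 <= w -> is_derive w (1 : R) F (f w))
  (cf : forall w : R, x0 <= w -> {for w, continuous f})
  (uf : forall w, x0 <= `|w| -> u w <= f `|w|).

Lemma integral_annulus_le (x y : R) : x0 <= x -> x <= y ->
  (\int[mu]_(w in `[x, y]) (u w)%:E <= (F y - F x)%:E)%E /\
  (\int[mu]_(w in `[(- y)%R, (- x)%R]) (u w)%:E <= (F y - F x)%:E)%E.
Proof.
move=> x0x xy; split.
  apply: (@ge0_integral_le_primitive F f) => // w; rewrite in_itv/= => /andP[xw wy].
  - by apply: dF; lra.
  - by apply: cf; lra.
  - have w0 : 0 <= w by have := x0_gt0; lra.
    by have := @uf w; rewrite ger0_norm//; apply; lra.
rewrite (_ : F y - F x = (- F (- - x)) - (- F (- - y))); last by rewrite !opprK addrC.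
apply: (@ge0_integral_le_primitive (fun w => - F (- w)) (fun w => f (- w))) => //.
- by rewrite lerN2.
- move=> w; rewrite in_itv/= => /andP[xw wy].
  have w0 : x0 <= - w by lra.
  have dFw := dF w0.
  have dN : is_derive w (1 : R) -%R (- 1 : R) by apply: is_deriveN.
  have := is_deriveN (@is_derive1_comp _ F -%R _ _ _ dFw dN).
  by rewrite mulrN1 opprK.
- move=> w; rewrite in_itv/= => /andP[xw wy].
  apply: (@continuous_comp _ _ _ -%R f); first exact: oppr_continuous.
  by apply: cf; lra.
- move=> w; rewrite in_itv/= => /andP[xw wy].
  have w0 : w <= 0 by have := x0_gt0; lra.
  by have := @uf w; rewrite ler0_norm//; apply; lra.
Qed.

(** The constant K serves on [-x0, x0]; outside it the primitive F, taken at |w|, serves both signs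
    of w. *)
Lemma integral_head_le (K x : R) : (forall w, `|w| <= x0 -> u w <= K) -> x0 <= x ->
  (\int[mu]_(w in `[(- x)%R, x]) (u w)%:E <= (2 * x0 * K + 2 * (F x - F x0))%:E)%E.
Proof.
move=> uK x0x.
have [h1 h2] := integral_annulus_le (lexx x0) x0x.
have h3 : (\int[mu]_(w in `[(- x0)%R, x0]) (u w)%:E <= (2 * x0 * K)%:E)%E.
  apply: (@le_trans _ _ (\int[mu]_(w in `[(- x0)%R, x0]) (K%:E))%E).
    apply: ge0_le_integral => //.
    - by move=> w _; rewrite lee_fin.
    - by apply: measurable_funTS; exact/measurable_EFinP.
    - by move=> w; rewrite /= in_itv/= => ?; rewrite lee_fin uK// ler_norml.
  have mI : mu `[- x0, x0]%classic = (2 * x0)%:E.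
    rewrite lebesgue_measure_itv/= lte_fin ifT; last by rewrite gtrN.
    by rewrite -EFinB; congr EFin; ring.
  have -> : (\int[mu]_(w in `[(- x0)%R, x0]) (K%:E) = K%:E * mu `[(- x0)%R, x0]%classic)%E by rewrite -integral_cst.
  by rewrite mI -EFinM mulrC.
have sub : (`[- x, x]%classic : set R) `<=` `[- x, - x0] `|` (`[- x0, x0] `|` `[x0, x]).
  move=> w; rewrite /= !in_itv/= => /andP[w1 w2].
  by case: (leP w (- x0)) => w3; [left|right; case: (leP w x0) => w4; [left|right]]; apply/andP; split; lra.
apply: (@le_trans _ _ (\int[mu]_(w in `[(- x)%R, (- x0)%R] `|` (`[(- x0)%R, x0] `|` `[x0, x])) (u w)%:E)%E).
  apply: ge0_subset_integral => //.
  - by apply: measurableU => //; exact: measurableU.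
  - by apply: measurable_funTS; exact/measurable_EFinP.
  - by move=> w _; rewrite lee_fin.
apply: le_trans (ge0_integral_setU_le _ _ mu_ u0) _ => //; first exact: measurableU.
have h4 := ge0_integral_setU_le (A := `[- x0, x0]%classic) (B := `[x0, x]%classic) (measurable_itv _) (measurable_itv _) mu_ u0.
apply: (@le_trans _ _ ((F x - F x0)%:E + ((2 * x0 * K)%:E + (F x - F x0)%:E))%E).
  by apply: leeD => //; apply: (le_trans h4); exact: leeD.
by rewrite -!EFinD lee_fin; lra.
Qed.

(** Each sign of w contributes F(y) - F(x) <= -F(x) up to any y, uniformly in y. *)
Lemma integral_tail_le (x : R) : x0 <= x -> (forall y, x <= y -> F y <= 0) ->
  (\int[mu]_(w in ~` `[(- x)%R, x]) (u w)%:E <= (- (2 * F x))%:E)%E.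
Proof.
move=> x0x F0; pose D : set (measurableTypeR R) := ~` `[- x, x]%classic.
have mD : measurable D by apply: measurableC; exact: measurable_itv.
rewrite -/D integral_mkcond.
have mUD : measurable_fun setT ((fun w : R => (u w)%:E) \_ D).
  by apply/(measurable_restrictT _ mD); apply: measurable_funTS; exact/measurable_EFinP.
apply: ge0_integral_le_itv => // [w|n].
  by rewrite patchE; case: ifP => //; rewrite lee_fin.
pose y : R := Num.max x n%:R.
have xy : x <= y by rewrite le_max lexx.
have ny : n%:R <= y by rewrite le_max lexx orbT.
have [h1 h2] := integral_annulus_le x0x xy.
rewrite -integral_mkcondr.
apply: (@le_trans _ _ (\int[mu]_(w in `[(- y)%R, (- x)%R] `|` `[x, y]) (u w)%:E)%E).
  apply: ge0_subset_integral => //.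
  - by apply: measurableI => //; exact: measurable_itv.
  - by apply: measurableU; exact: measurable_itv.
  - by apply: measurable_funTS; exact/measurable_EFinP.
  - by move=> w _; rewrite lee_fin.
  - move=> w [/=]; rewrite !in_itv/= => /andP[w1 w2] /negP; rewrite negb_and -!ltNge => /orP[|]; rewrite ?bnd_simp => w3.
      by left; apply/andP; split; lra.
    by right; apply/andP; split; lra.
apply: le_trans (ge0_integral_setU_le (measurable_itv _) (measurable_itv _) mu_ u0) _.
apply: (le_trans (leeD h2 h1)); rewrite -EFinD lee_fin.
by have := F0 _ xy; lra.
Qed.

End primitive_bounds.

Section weights.
Context {R : realType}.
Local Notation mu := (@lebesgue_measure R).
Implicit Types (A c e q beta b w x : R).

Definition weight A c e beta b w : R :=
  (w ^+ 2 + 1) `^ A * expR (c * `|w| `^ beta - e * `|w| `^ b).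

Definition power_exp q c e beta b w : R := w `^ q * expR (c * w `^ beta - e * w `^ b).

Lemma weight_ge0 A c e beta b w : 0 <= weight A c e beta b w.
Proof. by rewrite mulr_ge0 ?powR_ge0 ?expR_ge0. Qed.

Lemma power_exp_gt0 q c e beta b w : 0 < w -> 0 < power_exp q c e beta b w.
Proof. by move=> w0; rewrite mulr_gt0 ?powR_gt0 ?expR_gt0. Qed.

Lemma measurable_weight A c e beta b : measurable_fun setT (weight A c e beta b).
Proof.
have mp r : measurable_fun setT (fun w : R => `|w| `^ r).
  by apply: (@measurableT_comp _ _ _ _ _ _ (fun x : R => x `^ r)); [exact: measurable_powR|exact: normr_measurable].
apply: measurable_funM; first exact: measurable_sobolev_weight.
by apply: measurableT_comp => //; apply: measurable_funB; apply: measurable_funM.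
Qed.

Lemma is_derive_power_exp q c e beta b w : 0 < w ->
  is_derive w (1 : R) (power_exp q c e beta b)
    (power_exp (q - 1) c e beta b w * (q + c * beta * w `^ beta - e * b * w `^ b)).
Proof.
move=> w0.
have dp r : is_derive w (1 : R) (@powR R ^~ r) (r * w `^ (r - 1)) by exact: is_derive1_powR.
have dpsi : is_derive w (1 : R) (fun w => c * w `^ beta - e * w `^ b)
    (c * (beta * w `^ (beta - 1)) - e * (b * w `^ (b - 1))).
  by apply: is_deriveB; exact: is_deriveZ.
have dE := @is_derive1_comp _ expR (fun w => c * w `^ beta - e * w `^ b) w _ _ (is_derive_expR _) dpsi.
apply: is_derive_eq (is_deriveM (dp q) dE) _.
rewrite /power_exp /= -![_ *: _]/(_ * _).
have pE r : w `^ r = w `^ (r - 1) * w.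
  by rewrite -{3}(powRr1 (ltW w0)) -powRD ?(gt_eqF w0) ?implybT// subrK.
move: (expR _) => E; rewrite (pE q) [in RHS](pE beta) [in RHS](pE b); ring.
Qed.

Lemma continuous_power_exp q c e beta b k1 k2 k3 w : 0 < w ->
  {for w, continuous (fun w => power_exp q c e beta b w * (k1 + k2 * w `^ beta - k3 * w `^ b))}.
Proof.
move=> w0.
have cp r : {for w, continuous (@powR R ^~ r)}.
  by apply/differentiable_continuous/derivable1_diffP; have [] := is_derive1_powR r w0.
have cP : {for w, continuous (power_exp q c e beta b)}.
  by apply/differentiable_continuous/derivable1_diffP; have [] := is_derive_power_exp q c e beta b w0.
apply: continuousM => //; apply: continuousB; last by apply: continuousM; [exact: cst_continuous|exact: cp].
by apply: continuousD; [exact: cst_continuous|apply: continuousM; [exact: cst_continuous|exact: cp]].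
Qed.

(** For w >= 1, w^2 <= w^2 + 1 <= 2 w^2; which of the two inequalities matters depends on the sign
    of A. *)
Lemma sobolev_weight_le A w : 1 <= w -> (w ^+ 2 + 1) `^ A <= 2 `^ `|A| * w `^ (2 * A).
Proof.
move=> w1; have w0 : 0 <= w by lra.
rewrite powRrM (_ : w `^ 2 = w ^+ 2); last by rewrite -powR_mulrn.
have w2 : 1 <= w ^+ 2 by rewrite exprn_ege1.
have [A0|A0] := leP 0 A.
  rewrite ger0_norm// -powRM ?sqr_ge0//.
  by apply: ge0_ler_powR => //; rewrite ?nnegrE; lra.
rewrite ltr0_norm// -[leLHS]mul1r; apply: ler_pM; rewrite ?powR_ge0//.
  apply: (@le_trans _ _ (1 `^ (- A))); first by rewrite powR1.
  by apply: ge0_ler_powR; rewrite ?nnegrE; lra.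
rewrite -[A]opprK powRN [leRHS]powRN lef_pV2 ?posrE ?powR_gt0//; [|lra|lra].
by apply: ge0_ler_powR; rewrite ?nnegrE; lra.
Qed.

Lemma weight_le_const A c e beta b x w : 0 <= c -> 0 <= e -> 0 <= beta -> `|w| <= x ->
  weight A c e beta b w <= (x ^+ 2 + 1) `^ `|A| * expR (c * x `^ beta).
Proof.
move=> c0 e0 beta0 wx; have x_ge0 : 0 <= x by exact: le_trans wx.
apply: ler_pM; rewrite ?powR_ge0 ?expR_ge0//.
  apply: (@le_trans _ _ ((w ^+ 2 + 1) `^ `|A|)).
    by apply: ler_powR; [rewrite lerDr sqr_ge0|exact: ler_norm].
  apply: ge0_ler_powR => //; rewrite ?nnegrE ?addr_ge0 ?sqr_ge0//.
  by rewrite lerD2r -(real_normK (num_real w)); apply: lerXn2r => //; rewrite nnegrE.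
rewrite ler_expR; apply: (@le_trans _ _ (c * `|w| `^ beta)).
  by rewrite gerBl mulr_ge0 ?powR_ge0.
by rewrite ler_wpM2l//; apply: ge0_ler_powR => //; rewrite nnegrE.
Qed.

Lemma weight_total_fin A c e beta b x (C : \bar R) : 0 <= c -> 0 <= e -> 0 <= beta -> (C < +oo)%E ->
  (\int[mu]_(w in ~` `[(- x)%R, x]) (weight A c e beta b w)%:E <= C)%E ->
  (\int[mu]_w (weight A c e beta b w)%:E < +oo)%E.
Proof.
move=> c0 e0 beta0 C_oo H; pose D : set (measurableTypeR R) := `[- x, x]%classic.
have mD : measurable D by exact: measurable_itv.
have mW := measurable_weight A c e beta b.
rewrite -(setUv D).
apply: le_lt_trans (ge0_integral_setU_le mD (measurableC mD) mW (weight_ge0 A c e beta b)) _.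
apply: lte_add_pinfty; last exact: le_lt_trans H C_oo.
pose K : R := (x ^+ 2 + 1) `^ `|A| * expR (c * x `^ beta).
apply: (@le_lt_trans _ _ (\int[mu]_(w in D) K%:E)%E).
  apply: ge0_le_integral => //.
  - by move=> w _; rewrite lee_fin; exact: weight_ge0.
  - by apply: measurable_funTS; exact/measurable_EFinP.
  - by move=> w; rewrite /D /= in_itv/= => ?; rewrite lee_fin weight_le_const// ler_norml.
have -> : (\int[mu]_(w in D) K%:E = K%:E * mu D)%E by rewrite -integral_cst.
apply: lte_mul_pinfty => //; first by rewrite lee_fin mulr_ge0 ?powR_ge0 ?expR_ge0.
by rewrite /D lebesgue_measure_itv; case: ifP => _; rewrite ?ltry// -EFinB ltry.
Qed.

(** The contribution Z of the bounded core is absorbed because p stays above p0 > 0. *)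
Let head_arith (Z K p0 p : R) : 0 <= Z -> 0 < K -> 0 < p0 -> p0 <= p ->
  Z + 2 * (K * p - K * p0) <= (Z / p0 + 2 * K) * p.
Proof.
move=> Z0 K0 p00 p0p; have : Z <= Z / p0 * p.
  by rewrite mulrAC ler_pdivlMr// ler_wpM2l.
by have := mulr_gt0 K0 p00; lra.
Qed.

Section primitive.
Variables (A c e beta b q K x0 : R).
Hypotheses (x01 : 1 <= x0)
  (HK : forall w, x0 <= w -> 2 `^ `|A| * w `^ (2 * A) <=
     K * (w `^ (q - 1) * (q + c * beta * w `^ beta - e * b * w `^ b))).

(** By [HK] the derivative of this function dominates the weight beyond x0. K <= 0 serves the tails
    of decaying weights, K > 0 the heads of growing ones. *)
Let F w := K * power_exp q c e beta b w.

Let f w := K * (power_exp (q - 1) c e beta b w * (q + c * beta * w `^ beta - e * b * w `^ b)).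

Let x0_gt0 : 0 < x0. Proof. by apply: lt_le_trans x01. Qed.

Let dF w : x0 <= w -> is_derive w (1 : R) F (f w).
Proof.
by move=> w0; apply: is_deriveZ; apply: is_derive_power_exp; exact: lt_le_trans x0_gt0 w0.
Qed.

Let cf w : x0 <= w -> {for w, continuous f}.
Proof.
move=> w0; apply: continuousM; first exact: cst_continuous.
by apply: continuous_power_exp; exact: lt_le_trans x0_gt0 w0.
Qed.

Let uf w : x0 <= `|w| -> weight A c e beta b w <= f `|w|.
Proof.
move=> w0; rewrite /weight /f /power_exp -(real_normK (num_real w)).
have w1 := le_trans x01 w0.
have := ler_wpM2r (expR_ge0 (c * `|w| `^ beta - e * `|w| `^ b)) (le_trans (sobolev_weight_le A w1) (HK w0)).
by move/le_trans; apply; apply: le_of_eq; ring.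
Qed.

Lemma weight_tail_le x : K <= 0 -> x0 <= x ->
  (\int[mu]_(w in ~` `[(- x)%R, x]) (weight A c e beta b w)%:E <= (- 2 * K * power_exp q c e beta b x)%:E)%E.
Proof.
move=> K0 x0x.
apply: (le_trans (integral_tail_le (measurable_weight A c e beta b) (weight_ge0 A c e beta b) x0_gt0 dF cf uf x0x _)).
  move=> y xy; rewrite /F mulr_le0_ge0// ltW// power_exp_gt0//.
  exact: lt_le_trans (lt_le_trans x0_gt0 x0x) xy.
by rewrite lee_fin /F; apply: le_of_eq; ring.
Qed.

Lemma weight_head_le : 0 < K -> 0 <= c -> 0 <= e -> 0 <= beta ->
  exists2 C, 0 < C & forall x, x0 <= x ->
  (\int[mu]_(w in `[(- x)%R, x]) (weight A c e beta b w)%:E <= (C * power_exp q c e beta b x)%:E)%E.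
Proof.
move=> K0 c0 e0 beta0.
pose K0' : R := (x0 ^+ 2 + 1) `^ `|A| * expR (c * x0 `^ beta).
have K0'_ge0 : 0 <= K0' by rewrite mulr_ge0 ?powR_ge0 ?expR_ge0.
have uK w : `|w| <= x0 -> weight A c e beta b w <= K0' by exact: weight_le_const.
have P0 : 0 < power_exp q c e beta b x0 by exact: power_exp_gt0.
exists (2 * x0 * K0' / power_exp q c e beta b x0 + 2 * K).
  have h : 0 <= 2 * x0 * K0' / power_exp q c e beta b x0 
    by apply: divr_ge0; [apply: mulr_ge0 => //; apply: mulr_ge0 => //; exact: ltW|exact: ltW].
  by apply: (ltr_wpDl h); rewrite mulr_gt0.
move=> x x0x.
have H := integral_head_le (measurable_weight A c e beta b) (weight_ge0 A c e beta b) x0_gt0 dF cf uf uK x0x.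
have [H1 _] := integral_annulus_le (measurable_weight A c e beta b) (weight_ge0 A c e beta b) x0_gt0 dF cf uf (lexx x0) x0x.
have FF : F x0 <= F x.
  rewrite -subr_ge0 -lee_fin; apply: le_trans H1; apply: integral_ge0 => w _; rewrite lee_fin; exact: weight_ge0.
apply: (le_trans H); rewrite lee_fin.
move: FF; rewrite /F (ler_pM2l K0) => FF; apply: head_arith K0 P0 FF.
by apply: mulr_ge0 => //; apply: mulr_ge0 => //; exact: ltW.
Qed.

End primitive.

Lemma powR_dominates (delta K : R) : 0 < delta -> exists2 x0 : R, 1 <= x0 & forall w, x0 <= w -> K <= w `^ delta.
Proof.
move=> d0; exists (Num.max 1 (`|K| `^ delta^-1)); first by rewrite le_max lexx.
move=> w; rewrite ge_max => /andP[w1 wK]; apply: (le_trans (ler_norm K)).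
rewrite -[leLHS](powRr1 (normr_ge0 _)) -(mulVf (lt0r_neq0 d0)) powRrM.
by apply: ge0_ler_powR => //; rewrite ?nnegrE ?powR_ge0//; lra.
Qed.

(** Half of e w^b eventually absorbs the lower order terms. For growing weights it is used with the
    two exponents exchanged. *)
Lemma dominant_power q c e beta b : 0 <= beta -> beta < b -> 0 <= c -> 0 < e ->
  exists2 x0 : R, 1 <= x0 & forall w, x0 <= w -> q + c * w `^ beta - e * w `^ b <= - (e / 2) * w `^ b.
Proof.
move=> beta0 bb c0 e0.
have d0 : 0 < b - beta by lra.
have [x0 x01 H] := powR_dominates ((`|q| + c) / (e / 2)) d0.
exists x0 => // w w0; have w1 := le_trans x01 w0; have wp : 0 < w by lra.
have E : w `^ b = w `^ (b - beta) * w `^ beta.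
  by rewrite -powRD ?(gt_eqF wp) ?implybT// subrK.
have pb : 1 <= w `^ beta by rewrite -(powRr0 w); exact: ler_powR.
have e2 : 0 < e / 2 by lra.
have h1 : (`|q| + c) * w `^ beta <= e / 2 * w `^ b.
  rewrite E mulrA ler_wpM2r ?powR_ge0//.
  by have := H w w0; rewrite ler_pdivrMr// mulrC.
have h2 : `|q| <= `|q| * w `^ beta by rewrite ler_peMr.
have := ler_norm q; lra.
Qed.

(** The derivative of w^q exp(c w^beta - e w^b) has leading term -e b w^(q - 1 + b) times the
    exponential, which matches w^(2 A) for q = 2 A + 1 - b. *)
Lemma weight_tail A c e beta b : 0 <= beta -> beta < b -> 0 <= c -> 0 < e ->
  exists2 C, 0 < C & exists2 x0 : R, 1 <= x0 & forall x, x0 <= x ->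
  (\int[mu]_(w in ~` `[(- x)%R, x]) (weight A c e beta b w)%:E <=
    (C * power_exp (2 * A + 1 - b) c e beta b x)%:E)%E.
Proof.
move=> beta0 bb c0 e0; have b0 : 0 < b by lra.
have eb0 : 0 < e * b by rewrite mulr_gt0.
have [x0 x01 H] := dominant_power (2 * A + 1 - b) beta0 bb (mulr_ge0 c0 beta0) eb0.
pose k := e * b / 2; have k0 : 0 < k by rewrite divr_gt0.
pose K : R := - (2 `^ `|A| / k).
have K0 : K < 0 by rewrite oppr_lt0 divr_gt0// powR_gt0.
exists (- 2 * K); first by lra.
exists x0 => // x x0x; apply: (@weight_tail_le _ _ _ _ _ _ K x0) => //; last exact: ltW.
move=> w w0; have wp : 0 < w by lra.
have E : w `^ (2 * A) = w `^ (2 * A + 1 - b - 1) * w `^ b.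
  by rewrite -powRD ?(gt_eqF wp) ?implybT//; congr (_ `^ _); ring.
rewrite E mulrCA [leRHS]mulrCA; apply: ler_wpM2l; first exact: powR_ge0.
have := ler_wnM2l (ltW K0) (H w w0); apply: le_trans.
rewrite /K -/k; apply: le_of_eq; field; exact: lt0r_neq0.
Qed.

Lemma weight_tail_power A : 2 * A + 1 < 0 ->
  exists2 C, 0 < C & forall x, 1 <= x ->
  (\int[mu]_(w in ~` `[(- x)%R, x]) (weight A 0 0 0 0 w)%:E <= (C * power_exp (2 * A + 1) 0 0 0 0 x)%:E)%E.
Proof.
move=> A0; pose K : R := 2 `^ `|A| / (2 * A + 1).
have K0 : K < 0 by rewrite pmulr_rlt0 ?invr_lt0// powR_gt0.
exists (- 2 * K); first by lra.
move=> x x1; apply: (@weight_tail_le _ _ _ _ _ _ K 1) => //; last exact: ltW.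
move=> w w1; rewrite !mul0r subr0 addr0 addrK /K; apply: le_of_eq.
by field; lra.
Qed.

(** Now the growing term leads: c beta w^(q - 1 + beta) matches w^(2 A) for q = 2 A + 1 - beta. *)
Lemma weight_head A c e beta b : 0 <= b -> b < beta -> 0 < c -> 0 <= e ->
  exists2 C, 0 < C & exists2 x0 : R, 1 <= x0 & forall x, x0 <= x ->
  (\int[mu]_(w in `[(- x)%R, x]) (weight A c e beta b w)%:E <=
    (C * power_exp (2 * A + 1 - beta) c e beta b x)%:E)%E.
Proof.
move=> b0 bb c0 e0; have beta0 : 0 < beta by lra.
have cb0 : 0 < c * beta by rewrite mulr_gt0.
have [x0 x01 H] := dominant_power (- (2 * A + 1 - beta)) b0 bb (mulr_ge0 e0 b0) cb0.
pose k := c * beta / 2; have k0 : 0 < k by rewrite divr_gt0.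
pose K : R := 2 `^ `|A| / k.
have K0 : 0 < K by rewrite divr_gt0// powR_gt0.
have [|C C0 HC] := @weight_head_le A c e beta b (2 * A + 1 - beta) K x0 x01 _ K0 (ltW c0) e0 (ltW beta0).
  move=> w w0; have wp : 0 < w by lra.
  have E : w `^ (2 * A) = w `^ (2 * A + 1 - beta - 1) * w `^ beta.
    by rewrite -powRD ?(gt_eqF wp) ?implybT//; congr (_ `^ _); ring.
  rewrite E mulrCA [leRHS]mulrCA; apply: ler_wpM2l; first exact: powR_ge0.
  have h : k * w `^ beta <= 2 * A + 1 - beta + c * beta * w `^ beta - e * b * w `^ b.
    by have := H w w0; rewrite -/k; lra.
  have := ler_wpM2l (ltW K0) h; apply: le_trans.
  rewrite /K; apply: le_of_eq; field; exact: lt0r_neq0.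
by exists C => //; exists x0.
Qed.

Lemma weight_head_power A : 0 < 2 * A + 1 ->
  exists2 C, 0 < C & forall x, 1 <= x ->
  (\int[mu]_(w in `[(- x)%R, x]) (weight A 0 0 0 0 w)%:E <= (C * power_exp (2 * A + 1) 0 0 0 0 x)%:E)%E.
Proof.
move=> A0; pose K : R := 2 `^ `|A| / (2 * A + 1).
have K0 : 0 < K by rewrite divr_gt0// powR_gt0.
apply: (@weight_head_le A 0 0 0 0 (2 * A + 1) K 1) => //.
move=> w w1; rewrite !mul0r subr0 addr0 addrK /K; apply: le_of_eq.
by field; lra.
Qed.

(** Borderline 2 A + 1 = 0: (w^2 + 1)^(-1/2) <= 1/|w|, so the primitive is ln. *)
Lemma weight_head_log : exists2 C, 0 < C & forall x, 1 <= x ->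
  (\int[mu]_(w in `[(- x)%R, x]) (weight (- 2^-1) 0 0 0 0 w)%:E <= (C * (1 + ln x))%:E)%E.
Proof.
have wE w : weight (- 2^-1) 0 0 0 0 w = (w ^+ 2 + 1) `^ (- 2^-1).
  by rewrite /weight !mul0r subr0 expR0 mulr1.
exists 2 => // x x1.
have H := @integral_head_le R (weight (- 2^-1) 0 0 0 0) (measurable_weight _ _ _ _ _) (weight_ge0 _ _ _ _ _)
  (@ln R) (fun w => w^-1) 1 ltr01 _ _ _ 1 x _ x1.
apply: le_trans (H _ _ _ _) _.
- by move=> w w1; apply: is_derive1_ln; lra.
- by move=> w w1; apply: inv_continuous; apply: lt0r_neq0; lra.
- move=> w w1; rewrite wE -(real_normK (num_real w)) powRN.
  have wp : 0 < (`|w| ^+ 2 + 1) `^ 2^-1 by rewrite powR_gt0// ltr_wpDl ?sqr_ge0.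
  have w0 : 0 < `|w| by lra.
  rewrite lef_pV2 ?posrE//.
  rewrite powR12_sqrt; last by rewrite addr_ge0 ?sqr_ge0.
  apply: (@le_trans _ _ (Num.sqrt (`|w| ^+ 2))); first by rewrite sqrtr_sqr normr_id.
  by apply: ler_wsqrtr; rewrite lerDl.
- move=> w w1; rewrite wE powRN invf_le1; last by rewrite powR_gt0// ltr_wpDl ?sqr_ge0.
  apply: (@le_trans _ _ (1 `^ 2^-1)); first by rewrite powR1.
  by apply: ge0_ler_powR; rewrite ?nnegrE ?addr_ge0 ?sqr_ge0// lerDr sqr_ge0.
by rewrite ln1 lee_fin; lra.
Qed.

End weights.

(** * Rates of convergence *)

Section measurability.
Context {R : realType}.
Local Notation mu := (@lebesgue_measure R).

Lemma cmeasurable_inv (z : R -> R[i]) : cmeasurable z -> cmeasurable (fun x => (z x)^-1).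
Proof.
move=> [m1 m2].
have mV : measurable_fun setT (fun x => (complex.Re (z x) ^+ 2 + complex.Im (z x) ^+ 2)^-1).
  rewrite (_ : (fun x => _) = (fun x => (complex.Re (z x) ^+ 2 + complex.Im (z x) ^+ 2) `^ (- 1))).
    apply: (@measurableT_comp _ _ _ _ _ _ (fun x : R => x `^ (- 1))); first exact: measurable_powR.
    by apply: measurable_funD; exact: measurable_funX.
  by apply/funext => x; rewrite powR_inv1// addr_ge0// sqr_ge0.
split.
  rewrite (_ : (fun x => _) = (fun x => complex.Re (z x) * (complex.Re (z x) ^+ 2 + complex.Im (z x) ^+ 2)^-1)).
    exact: measurable_funM.
  by apply/funext => x; case: (z x).
rewrite (_ : (fun x => _) = (fun x => - (complex.Im (z x) * (complex.Re (z x) ^+ 2 + complex.Im (z x) ^+ 2)^-1))).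
  by apply: measurableT_comp => //; exact: measurable_funM.
by apply/funext => x; case: (z x).
Qed.

Lemma cmeasurable_opp_arg (z : R -> R[i]) : cmeasurable z -> cmeasurable (fun x => z (- x)).
Proof.
by move=> [m1 m2]; split; [exact: (measurableT_comp m1 (@oppr_measurable R setT))|exact: (measurableT_comp m2 (@oppr_measurable R setT))].
Qed.

Lemma cmeasurable_is_fourier (t : R -> R) (ts : R -> R[i]) : is_fourier t ts -> cmeasurable ts.
Proof. by move=> [[it ->]|[_ [mts _] _]//]; exact: cmeasurable_rfourier. Qed.

End measurability.

Section asymptotics.
Context {R : realType}.
Implicit Types (c L U p x : R).

Lemma near_ln_ge L : \forall n \near \oo, L <= ln (n%:R : R).
Proof.
have := nbhs_infty_ger (expR L); apply: filterS => n Ln.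
by rewrite -(expRK L) ler_ln// posrE ?expR_gt0//; exact: lt_le_trans (expR_gt0 L) Ln.
Qed.

Lemma ln_gt0_nat (n : nat) : 0 < ln (n%:R : R) -> (0 < n)%N.
Proof. by case: n => //; rewrite ln0// ltxx. Qed.

(** The upper bound on U decides for p >= 0, the lower one for p < 0; the sum of the constants
    covers both signs. *)
Lemma powR_between c1 c2 L U p : 0 < c1 -> 0 < L -> c1 * L <= U -> U <= c2 * L ->
  U `^ p <= (c1 `^ p + c2 `^ p) * L `^ p.
Proof.
move=> c1_gt0 L0 LU UL; have U0 : 0 < U by apply: lt_le_trans LU; exact: mulr_gt0.
have c2_gt0 : 0 < c2 by rewrite -(pmulr_lgt0 _ L0); exact: lt_le_trans UL.
have := powR_ge0 c1 p; have := powR_ge0 c2 p; have := powR_ge0 L p => l0 q2 q1.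
have [p0|p0] := leP 0 p.
  apply: (@le_trans _ _ ((c2 * L) `^ p)).
    by apply: ge0_ler_powR => //; rewrite nnegrE ?mulr_ge0// ltW.
  by rewrite powRM ?ler_wpM2r ?lerDr// ltW.
apply: (@le_trans _ _ ((c1 * L) `^ p)); last by rewrite powRM ?ler_wpM2r ?lerDl// ltW.
rewrite -[p]opprK !(powRN _ (- p)) lef_pV2 ?posrE ?powR_gt0 ?mulr_gt0//.
by apply: ge0_ler_powR => //; rewrite ?nnegrE ?mulr_ge0 ?oppr_ge0// ltW.
Qed.

(** ln L = 2 ln(sqrt L) <= 2 sqrt(L), and 4 |c| <= sqrt(L). *)
Lemma ln_half_le c L : 1 <= L -> 16 * c ^+ 2 <= L -> `|c * ln L| <= L / 2.
Proof.
move=> L1 cL; have L0 : 0 < L by lra.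
have q0 : 0 < Num.sqrt L by rewrite sqrtr_gt0.
have LE := sqr_sqrtr (ltW L0).
have lnE : ln L = 2 * ln (Num.sqrt L).
  by rewrite -{1}LE expr2 lnM ?posrE//; ring.
have := ln_sublinear q0; have q1 : 0 <= ln L by exact: ln_ge0.
rewrite normrM (ger0_norm q1) => h.
have cq : 4 * `|c| <= Num.sqrt L.
  rewrite -[leLHS]ger0_norm ?mulr_ge0// -sqrtr_sqr; apply: ler_wsqrtr.
  by rewrite exprMn real_normK ?num_real//; lra.
have k0 := normr_ge0 c; rewrite lnE.
have := mulr_ge0 (ltW q0) (_ : 0 <= Num.sqrt L - 4 * `|c|); rewrite subr_ge0 => /(_ cq).
have := mulr_ge0 k0 (_ : 0 <= Num.sqrt L - ln (Num.sqrt L)); rewrite subr_ge0 => /(_ (ltW h)).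
move: LE; move: (Num.sqrt L) (ln (Num.sqrt L)) `|c| => q l k; rewrite expr2 => <-; lra.
Qed.

Lemma expR_ln_nat (n : nat) : (0 < n)%N -> expR (ln n%:R) = n%:R :> R.
Proof. by move=> n0; rewrite lnK// posrE ltr0n. Qed.

(** With L = log n, U is the power -beta of h*. The correction kap ln L is at most L / 2, so U lies
    between L / (4 gamma) and L / gamma and powers of 1/h* are powers of L up to constants; the last
    summand in the threshold for L ensures 1/h* >= x0. *)
Lemma bandwidth_asymptotics (beta gamma kap x0 q : R) : 0 < beta -> 0 < gamma -> 0 <= x0 ->
  exists2 M : R, 0 <= M & forall L, 1 + 16 * kap ^+ 2 + 4 * gamma * x0 `^ beta <= L ->
    let U := (2 * gamma)^-1 * (L - kap * ln L) in
    [/\ 0 < L, 0 < U, x0 <= U `^ beta^-1, expR (2 * gamma * U) = expR L * L `^ (- kap) &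
        (U `^ beta^-1) `^ q <= M * L `^ (q / beta)].
Proof.
move=> beta0 gamma0 x00.
exists ((4 * gamma)^-1 `^ (q / beta) + gamma^-1 `^ (q / beta)); first by rewrite addr_ge0 ?powR_ge0.
move=> L Ln U.
have kap0 : 0 <= 16 * kap ^+ 2 by rewrite mulr_ge0// sqr_ge0.
have xb0 : 0 <= 4 * gamma * x0 `^ beta by rewrite mulr_ge0 ?powR_ge0// mulr_ge0// ltW.
have L1 : 1 <= L by lra.
have L0 : 0 < L by lra.
have kL : `|kap * ln L| <= L / 2 by apply: ln_half_le; lra.
have g2 : 0 <= (2 * gamma)^-1 by rewrite invr_ge0 mulr_ge0// ltW.
have U_ge : (4 * gamma)^-1 * L <= U.
  have -> : (4 * gamma)^-1 * L = (2 * gamma)^-1 * (L / 2) by field; exact: lt0r_neq0.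
  by rewrite ler_wpM2l//; have := ler_norm (kap * ln L); lra.
have U_le : U <= gamma^-1 * L.
  have -> : gamma^-1 * L = (2 * gamma)^-1 * (2 * L) by field; exact: lt0r_neq0.
  by rewrite ler_wpM2l//; have := ler_norm (- (kap * ln L)); rewrite normrN; lra.
have c10 : 0 < (4 * gamma)^-1 by rewrite invr_gt0 mulr_gt0.
have U0 : 0 < U by apply: lt_le_trans U_ge; exact: mulr_gt0.
split => //.
- have -> : x0 = (x0 `^ beta) `^ beta^-1 by rewrite -powRrM mulfV ?(lt0r_neq0 beta0)// powRr1.
  apply: ge0_ler_powR; rewrite ?nnegrE ?invr_ge0 ?powR_ge0 ?(ltW beta0) ?(ltW U0)//.
  by apply: le_trans U_ge; rewrite mulrC ler_pdivlMr ?mulr_gt0//; lra.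
- rewrite /powR (gt_eqF L0) -expRD; congr expR; rewrite /U; field; exact: lt0r_neq0.
- by rewrite -powRrM [beta^-1 * q]mulrC; exact: powR_between.
Qed.

End asymptotics.

(** * Bias, variance and the risk in each regime *)

Section risk_bounds.
Context {R : realType}.
Local Notation mu := (@lebesgue_measure R).
Variables (s B : R) (g phi : R -> R) (phis : R -> R[i]).
Variables (Cg1 Cphi2 alpha beta gamma a b d : R).
Hypotheses (s_ge0 : 0 <= s) (B_gt0 : 0 < B)
    (g_pdf : is_pdf g) (g_bounded : has_ubound (range g))
    (mphis : cmeasurable phis)
    (Phi_fourier : forall f : R -> R, sobolev_ball s B f ->
       [/\ mu.-integrable setT (fun x => (phi x * f x)%:E),
           cintegrable (fun w => rfourier f w * phis (- w)) &
           (functional phi f)%:C =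
             ((2 * pi)^-1)%:C *
               cint setT (fun w => rfourier f w * phis (- w))])
    (Cg1_gt0 : 0 < Cg1) (Cphi2_gt0 : 0 < Cphi2)
    (gs_lower : forall w : R,
       Cg1 * (w ^+ 2 + 1) `^ (- (alpha / 2)) * expR (- gamma * `|w| `^ beta)
         <= cabs (rfourier g w))
    (phis_upper : forall w : R,
       cabs (phis w) <=
         Cphi2 * (w ^+ 2 + 1) `^ (- (a / 2)) * expR (- d * `|w| `^ b)).

Local Notation r := (fourier_ratio (rfourier g) phis).

Let sobolev_gt0 w (e : R) : 0 < (w ^+ 2 + 1) `^ e :> R.
Proof. by rewrite powR_gt0// ltr_wpDl ?sqr_ge0. Qed.

Let base_neq0 w : w ^+ 2 + 1 != 0 :> R.
Proof. by rewrite gt_eqF// ltr_wpDl ?sqr_ge0. Qed.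

Let gs_neq0 w : rfourier g w != 0.
Proof.
apply/eqP => gs0; have := gs_lower w; rewrite gs0 leNgt => /negP; apply.
by rewrite /cabs /= expr0n/= addr0 sqrtr0 !mulr_gt0 ?expR_gt0.
Qed.

Let phis_sqr_le w : cabs (phis (- w)) ^+ 2 <= Cphi2 ^+ 2 * ((w ^+ 2 + 1) `^ (- a) * expR (- (2 * d * `|w| `^ b))).
Proof.
have := phis_upper (- w); rewrite sqrrN normrN => H.
have P0 : 0 <= cabs (phis (- w)) by exact: cabs_ge0.
apply: (@le_trans _ _ ((Cphi2 * (w ^+ 2 + 1) `^ (- (a / 2)) * expR (- d * `|w| `^ b)) ^+ 2)).
  by apply: lerXn2r; rewrite ?nnegrE// (le_trans P0).
rewrite !exprMn -expRM_natl -mulrA; apply: ler_wpM2l; first exact: sqr_ge0.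
rewrite -powR_mulrn ?powR_ge0// -powRrM; apply: ler_pM; rewrite ?powR_ge0 ?expR_ge0//.
  by apply: le_of_eq; congr (_ `^ _); field.
by rewrite ler_expR; apply: le_of_eq; ring.
Qed.

Let ratio_sqr_le w : cabs (r w) ^+ 2 <=
  (Cphi2 / Cg1) ^+ 2 * weight (alpha - a) (2 * gamma) (2 * d) beta b w.
Proof.
rewrite /fourier_ratio cabsM exprMn.
have -> : cabs (rfourier g w)^-1 = (cabs (rfourier g w))^-1 by exact: Normc.normcV.
pose L := Cg1 * (w ^+ 2 + 1) `^ (- (alpha / 2)) * expR (- gamma * `|w| `^ beta).
have L0 : 0 < L by rewrite !mulr_gt0 ?expR_gt0.
have H : (cabs (rfourier g w))^-1 ^+ 2 <= L^-1 ^+ 2.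
  have gL : (cabs (rfourier g w))^-1 <= L^-1.
    by rewrite lef_pV2 ?posrE//; [exact: gs_lower|exact: lt_le_trans (gs_lower w)].
  by apply: lerXn2r; rewrite ?nnegrE ?invr_ge0 ?cabs_ge0// ltW.
apply: (le_trans (ler_pM (sqr_ge0 _) (sqr_ge0 _) (phis_sqr_le w) H)).
have LE : L^-1 ^+ 2 = Cg1 ^- 2 * ((w ^+ 2 + 1) `^ alpha * expR (2 * gamma * `|w| `^ beta)).
  have PE : ((w ^+ 2 + 1) `^ (- (alpha / 2)))^-1 ^+ 2 = (w ^+ 2 + 1) `^ alpha.
    rewrite -powRN opprK expr2 -powRD; first by congr (_ `^ _); field.
    by rewrite base_neq0 implybT.
  have EE : (expR (- gamma * `|w| `^ beta))^-1 ^+ 2 = expR (2 * gamma * `|w| `^ beta).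
    by rewrite -expRN -expRM_natl; congr expR; ring.
  have gen (x y z : R) : (x * y * z)^-1 ^+ 2 = x ^- 2 * (y^-1 ^+ 2 * z^-1 ^+ 2).
    by rewrite -(exprVn x) !invfM !exprMn mulrA.
  by rewrite /L gen PE EE.
rewrite LE /weight powRB; last by rewrite base_neq0 implybT.
rewrite powRN expRD; apply: le_of_eq.
have g0 := lt0r_neq0 Cg1_gt0; have s0 := lt0r_neq0 (sobolev_gt0 w a).
by move: (expR _) (expR _) ((w ^+ 2 + 1) `^ _) ((w ^+ 2 + 1) `^ _) g0 s0 => E1 E2 p q g0 s0; field; rewrite g0 s0.
Qed.

Let mr : cmeasurable r.
Proof.
apply: cmeasurableM; first exact: cmeasurable_opp_arg.
by apply: cmeasurable_inv; exact: measurable_rfourier.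
Qed.

Let mr2 : measurable_fun setT (fun w => (cabs (r w) ^+ 2)%:E).
Proof. by apply/measurable_EFinP; apply: measurable_funX; exact: measurable_cabs. Qed.

Lemma ratio_integral_le (D : set (measurableTypeR R)) : measurable D ->
  (\int[mu]_(w in D) (cabs (r w) ^+ 2)%:E <=
    ((Cphi2 / Cg1) ^+ 2)%:E * \int[mu]_(w in D) (weight (alpha - a) (2 * gamma) (2 * d) beta b w)%:E)%E.
Proof.
move=> mD; have mW := measurable_weight (alpha - a) (2 * gamma) (2 * d) beta b.
rewrite -ge0_integralZl//.
- apply: ge0_le_integral => //.
  + by move=> w _; rewrite lee_fin sqr_ge0.
  + exact: measurable_funTS.
  + by apply: measurable_funTS; apply/measurable_EFinP; exact: measurable_funM.
  + by move=> w _; rewrite -EFinM lee_fin; exact: ratio_sqr_le.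
- by apply: measurable_funTS; exact/measurable_EFinP.
- by move=> w _; rewrite lee_fin; exact: weight_ge0.
- by rewrite lee_fin sqr_ge0.
Qed.

Lemma ratio_square_integrable :
  (\int[mu]_w (weight (alpha - a) (2 * gamma) (2 * d) beta b w)%:E < +oo)%E -> square_integrable r.
Proof.
move=> H; split; first exact: mr.
apply: le_lt_trans (ratio_integral_le measurableT) _.
by apply: lte_mul_pinfty => //; rewrite lee_fin sqr_ge0.
Qed.

(** Cauchy-Schwarz in pointwise form: p q <= (l / 2) p^2 S + q^2 / (2 l S) with S = (w^2 + 1)^s. The
    first term integrates to at most l B^2 / 2 on the ball. *)
Lemma tail_bias_le (x Q : R) : 0 < Q ->
  (\int[mu]_(w in ~` `[(- x)%R, x]) (weight (- s - a) 0 (2 * d) 0 b w)%:E <= Q%:E)%E ->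
  forall f, sobolev_ball s B f ->
    tail_int (fun w => cabs (rfourier f w * phis (- w))) x ^+ 2 <= (B * Cphi2) ^+ 2 * Q.
Proof.
move=> Q0 HQ f Of; have [f_pdf fB] := Of; have [_ iq _] := Phi_fourier Of.
have ip := cintegrable_cabs iq.
have p0 w : 0 <= cabs (rfourier f w * phis (- w)) by exact: cabs_ge0.
pose D : set (measurableTypeR R) := ~` `[- x, x]%classic.
have mD : measurable D by apply: measurableC; exact: measurable_itv.
pose u w : R := cabs (rfourier f w) ^+ 2 * (w ^+ 2 + 1) `^ s.
pose v w : R := weight (- s - a) 0 (2 * d) 0 b w.
have u0 w : 0 <= u w by rewrite mulr_ge0 ?sqr_ge0 ?powR_ge0.
have v0 w : 0 <= v w by exact: weight_ge0.
have mu_ : measurable_fun setT u.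
  apply: measurable_funM; last exact: measurable_sobolev_weight.
  by apply: measurable_funX; apply: measurable_cabs; exact: measurable_rfourier.
have mv : measurable_fun setT v by exact: measurable_weight.
(* The value of l that balances the two terms, each becoming B Cphi2 sqrt(Q) / 2. *)
pose l : R := Cphi2 * Num.sqrt Q / B.
have sQ : 0 < Num.sqrt Q by rewrite sqrtr_gt0.
have l0 : 0 < l by rewrite divr_gt0// mulr_gt0.
have ptw w : cabs (rfourier f w * phis (- w)) <= l / 2 * u w + Cphi2 ^+ 2 / (2 * l) * v w.
  rewrite cabsM /u /v /weight.
  have := phis_sqr_le w.
  have -> : (w ^+ 2 + 1) `^ (- s - a) = (w ^+ 2 + 1) `^ (- a) / (w ^+ 2 + 1) `^ s.
    rewrite (_ : - s - a = - a - s); last by ring.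
    by rewrite powRB// base_neq0 implybT.
  rewrite mul0r sub0r; have := sobolev_gt0 w s; have := cabs_ge0 (rfourier f w); have := cabs_ge0 (phis (- w)).
  move: (cabs _) (cabs _) => p q; move: (expR _) (_ `^ s) (_ `^ (- a)) => E S A q0 p0' S0 H.
  have -> : Cphi2 ^+ 2 / (2 * l) * (A / S * E) = (2 * l)^-1 * (Cphi2 ^+ 2 * (A * E)) / S.
    by field; rewrite (lt0r_neq0 S0) (lt0r_neq0 l0).
  apply: (@le_trans _ _ (l / 2 * (p ^+ 2 * S) + (2 * l)^-1 * q ^+ 2 / S)); last first.
    by rewrite lerD2l ler_wpM2r ?invr_ge0 ?(ltW S0)// ler_wpM2l// invr_ge0 mulr_ge0// ltW.
  rewrite -subr_ge0.
  have -> : l / 2 * (p ^+ 2 * S) + (2 * l)^-1 * q ^+ 2 / S - p * q = (2 * l * S)^-1 * (l * S * p - q) ^+ 2.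
    by field; rewrite (lt0r_neq0 S0) (lt0r_neq0 l0).
  apply: mulr_ge0; last exact: sqr_ge0.
  by rewrite invr_ge0; apply: mulr_ge0; [apply: mulr_ge0 => //|]; exact: ltW.
have c1 : 0 <= l / 2 by rewrite divr_ge0// ltW.
have c2 : 0 <= Cphi2 ^+ 2 / (2 * l) by rewrite divr_ge0 ?sqr_ge0// mulr_ge0// ltW.
have H : tail_int (fun w => cabs (rfourier f w * phis (- w))) x <= l / 2 * B ^+ 2 + Cphi2 ^+ 2 / (2 * l) * Q.
  rewrite -lee_fin tail_intE// -/D EFinD !EFinM.
  apply: (@le_trans _ _ (\int[mu]_(w in D) ((l / 2)%:E * (u w)%:E + (Cphi2 ^+ 2 / (2 * l))%:E * (v w)%:E))%E).
    apply: ge0_le_integral => //.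
    + by move=> w _; rewrite lee_fin.
    + by apply: measurable_funTS; exact: measurable_int ip.
    + by apply: measurable_funTS; apply/measurable_EFinP; apply: measurable_funD; exact: measurable_funM.
    + by move=> w _; rewrite -!EFinM -EFinD lee_fin.
  rewrite ge0_integralD//; last first.
  - by apply: measurable_funTS; apply/measurable_EFinP; exact: measurable_funM.
  - by move=> w _; rewrite -EFinM lee_fin mulr_ge0.
  - by apply: measurable_funTS; apply/measurable_EFinP; exact: measurable_funM.
  - by move=> w _; rewrite -EFinM lee_fin mulr_ge0.
  rewrite !ge0_integralZl//; last first.
  - by move=> w _; rewrite lee_fin.
  - by apply: measurable_funTS; exact/measurable_EFinP.
  - by move=> w _; rewrite lee_fin.
  - by apply: measurable_funTS; exact/measurable_EFinP.
  apply: leeD; apply: lee_wpmul2l => //.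
  apply: le_trans fB; apply: ge0_subset_integral => //; first exact/measurable_EFinP.
  by move=> w _; rewrite lee_fin; exact: u0.
have t0 := tail_int_ge0 (fun w => p0 w) x.
have E : l / 2 * B ^+ 2 + Cphi2 ^+ 2 / (2 * l) * Q = B * Cphi2 * Num.sqrt Q.
  have := sqr_sqrtr (ltW Q0); have := sQ; rewrite /l; move: (Num.sqrt Q) => q q0 <-; field.
  by rewrite !lt0r_neq0.
rewrite E in H.
apply: (@le_trans _ _ ((B * Cphi2 * Num.sqrt Q) ^+ 2)); first by apply: lerXn2r; rewrite ?nnegrE// (le_trans t0).
by rewrite exprMn sqr_sqrtr// ltW.
Qed.

(* [V] and [Q] bound the variance integral and the squared bias as functions
   of the inverse bandwidth. *)
Lemma max_risk_le (V Q : R -> R) (CV CQ x0 : R) : 0 < x0 -> 0 <= CV -> 0 <= CQ ->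
  (forall x, x0 <= x -> 0 <= V x) -> (forall x, x0 <= x -> 0 <= Q x) ->
  (forall x, x0 <= x -> (\int[mu]_(w in `[(- x)%R, x])
     (weight (alpha - a) (2 * gamma) (2 * d) beta b w)%:E <= (CV * V x)%:E)%E) ->
  (forall x, x0 <= x -> forall f, sobolev_ball s B f ->
     tail_int (fun w => cabs (rfourier f w * phis (- w))) x ^+ 2 <= CQ * Q x) ->
  exists2 K, 0 < K & forall x n, x0 <= x -> (0 < n)%N ->
    (max_risk s B g phi phis x^-1 n <= (K * (V x / n%:R + Q x))%:E)%E.
Proof.
move=> x0_gt0 CV0 CQ0 V0 Q0 HV HQ.
have [G gG] := g_bounded; have gG' x : g x <= G by apply: gG; exists x.
have G0 : 0 <= G by have [_ /(_ 0) g0 _] := g_pdf; exact: le_trans (gG' 0).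
pose K1 := (Cphi2 / Cg1) ^+ 2; have K10 : 0 <= K1 by exact: sqr_ge0.
have pi0 := @pi_ge0 R.
have k0 : 0 <= 160 * pi * G * (K1 * CV).
  by apply: mulr_ge0; [apply: mulr_ge0 => //; apply: mulr_ge0|exact: mulr_ge0].
exists (160 * pi * G * (K1 * CV) + 2 * CQ + 1).
  by apply: ltr_wpDl => //; apply: addr_ge0 => //; exact: mulr_ge0.
move=> x n xx0 n0.
have xp : 0 < x by exact: lt_le_trans xx0.
have rV : (\int[mu]_(w in `[(- x)%R, x]) (cabs (r w) ^+ 2)%:E <= (K1 * CV * V x)%:E)%E.
  apply: (le_trans (ratio_integral_le (measurable_itv _))).
  by rewrite -[in leRHS]mulrA [leRHS]EFinM; apply: lee_wpmul2l; [rewrite lee_fin|exact: HV].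
have ir : cintegrable (trunc `[- x, x] r).
  have r2 : square_integrable (trunc `[- x, x] r).
    split; first by apply: cmeasurable_trunc.
    by rewrite integral_trunc_sqr; apply: (le_lt_trans rV); exact: ltry.
  (* Truncation is idempotent, so a square integrable truncation is integrable by
     [square_integrable_trunc]. *)
  rewrite (_ : trunc _ r = trunc `[- x, x] (trunc `[- x, x] r)); first exact: square_integrable_trunc.
  by apply/funext => w; rewrite /trunc; case: (w \in _).
have Hb f : sobolev_ball s B f ->
    tail_int (fun w => cabs (rfourier f w * phis (- w))) x <= Num.sqrt (CQ * Q x).
  move=> Of; have [_ /cintegrable_cabs ip _] := Phi_fourier Of.
  rewrite -[leLHS]ger0_norm; last by apply: tail_int_ge0 => w; exact: cabs_ge0.
  by rewrite -sqrtr_sqr; apply: ler_wsqrtr; exact: HQ.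
have := @max_risk_le_trunc R s B g phi phis G g_pdf gG' gs_neq0 Phi_fourier x^-1
  (K1 * CV * V x) (Num.sqrt (CQ * Q x)) n n0.
rewrite invrK invr_gt0 => /(_ xp ir rV Hb) H; apply: (le_trans H).
rewrite lee_fin sqr_sqrtr; last by rewrite mulr_ge0// Q0.
have v0 : 0 <= V x / n%:R by rewrite divr_ge0// V0.
have -> : 160 * pi * G * (K1 * CV * V x) / n%:R = 160 * pi * G * (K1 * CV) * (V x / n%:R).
  by rewrite -!mulrA.
have q0 := Q0 x xx0.
by move: (160 * pi * G * (K1 * CV)) (V x / n%:R) (Q x) k0 v0 q0 => k v q k0 v0 q0; nra.
Qed.

Hypothesis a_ge0 : 0 <= a.

Let A1 := s + a + (b - 1) / 2.
Let A2 := alpha - a.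

(** For b, d > 0 the exponent 2 (-s - a) + 1 - b supplied by [weight_tail] is -2 A_1. For b = d = 0
    the weight (w^2 + 1)^(-s - a) is integrable exactly when A_1 > 0; otherwise x^(-2 A_1) >= 1 and
    the bound uniform over the ball is enough. *)
Lemma bias_le : (b = 0 /\ d = 0) \/ (0 < b /\ 0 < d) ->
  exists2 C : R, 0 <= C & exists2 x0 : R, 1 <= x0 & forall x, x0 <= x -> forall f, sobolev_ball s B f ->
    tail_int (fun w => cabs (rfourier f w * phis (- w))) x ^+ 2 <=
    C * (x `^ (- (2 * A1)) * expR (- (2 * d * x `^ b))).
Proof.
case=> [[b0 d0]|[b0 d0]]; last first.
  have d20 : 0 < 2 * d by rewrite mulr_gt0.
  have [C C0 [x0 x01 H]] := @weight_tail R (- s - a) 0 (2 * d) 0 b (lexx 0) b0 (lexx 0) d20.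
  exists ((B * Cphi2) ^+ 2 * C); first by rewrite mulr_ge0 ?sqr_ge0 ?(ltW C0).
  exists x0 => // x xx0 f Of; have x_gt0 : 0 < x by lra.
  have P0 : 0 < C * power_exp (2 * (- s - a) + 1 - b) 0 (2 * d) 0 b x.
    by rewrite mulr_gt0// power_exp_gt0.
  have E : 2 * (- s - a) + 1 - b = - (2 * A1) by rewrite /A1; field.
  by rewrite -mulrA; have := tail_bias_le P0 (H x xx0) Of; rewrite /power_exp mul0r sub0r E.
have A1E : A1 = s + a - 2^-1 by rewrite /A1 b0; field.
have expE x : expR (- (2 * d * x `^ b)) = 1 by rewrite d0 mulr0 mul0r oppr0 expR0.
have [A1_gt0|A1_le0] := ltP 0 A1.
  have lt0 : 2 * (- s - a) + 1 < 0 by lra.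
  have [C C0 H] := weight_tail_power lt0.
  exists ((B * Cphi2) ^+ 2 * C); first by rewrite mulr_ge0 ?sqr_ge0 ?(ltW C0).
  exists 1 => // x x1 f Of; have x_gt0 : 0 < x by lra.
  have P0 : 0 < C * power_exp (2 * (- s - a) + 1) 0 0 0 0 x by rewrite mulr_gt0// power_exp_gt0.
  have Hx : (\int[mu]_(w in ~` `[(- x)%R, x]) (weight (- s - a) 0 (2 * d) 0 b w)%:E <=
      (C * power_exp (2 * (- s - a) + 1) 0 0 0 0 x)%:E)%E by rewrite d0 b0 mulr0; exact: H.
  have := tail_bias_le P0 Hx Of; rewrite expE mulr1 /power_exp !mul0r subr0 expR0 mulr1 mulrA.
  by rewrite (_ : 2 * (- s - a) + 1 = - (2 * A1))// A1E; field.
have psiC w : cabs (phis (- w)) <= Cphi2.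
  apply: (le_trans (phis_upper (- w))); rewrite d0 oppr0 mul0r expR0 mulr1 sqrrN.
  rewrite ler_piMr ?(ltW Cphi2_gt0)// powRN invf_le1//.
  by rewrite -[leLHS](powRr0 (w ^+ 2 + 1)); apply: ler_powR; rewrite ?lerDr ?sqr_ge0// divr_ge0.
have [|M HM] := @uniform_Fourier_bound R s B Cphi2 (fun w => phis (- w)) s_ge0 psiC.
  by move=> f /Phi_fourier[].
exists (M ^+ 2); first exact: sqr_ge0.
exists 1 => // x x1 f Of; rewrite expE mulr1.
have [_ /cintegrable_cabs ip _] := Phi_fourier Of.
have p0 w : 0 <= cabs (rfourier f w * phis (- w)) by exact: cabs_ge0.
have t0 := tail_int_ge0 (fun w => p0 w) x.
have tM : tail_int (fun w => cabs (rfourier f w * phis (- w))) x <= M.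
  apply: le_trans (HM f Of); rewrite (split_tail ip x) lerDr.
  by apply: Rintegral_ge0 => w _; exact: p0.
apply: (@le_trans _ _ (M ^+ 2)); first by apply: lerXn2r; rewrite ?nnegrE// (le_trans t0).
have h1 : 1 <= x `^ (- (2 * A1)) by rewrite -[leLHS](powRr0 x); apply: ler_powR => //; lra.
by apply: ler_peMr => //; exact: sqr_ge0.
Qed.

(** When b = beta the two exponentials merge into one with the positive rate 2 gamma - 2 d, so
    [weight_head] still applies. *)
Lemma variance_le : 0 < gamma -> 0 < beta -> 0 <= d -> 0 <= b -> b < beta \/ (b = beta /\ d < gamma) ->
  exists2 C : R, 0 < C & exists2 x0 : R, 1 <= x0 & forall x, x0 <= x ->
  (\int[mu]_(w in `[(- x)%R, x]) (weight A2 (2 * gamma) (2 * d) beta b w)%:E <=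
    (C * power_exp (2 * A2 + 1 - beta) (2 * gamma) (2 * d) beta b x)%:E)%E.
Proof.
move=> gamma0 beta0 d0 b0 [bb|[bE dg]].
  by apply: weight_head => //; rewrite ?mulr_gt0 ?mulr_ge0.
have c0 : 0 < 2 * gamma - 2 * d by lra.
have [C C0 [x0 x01 H]] := weight_head A2 (lexx 0) beta0 c0 (lexx 0).
exists C; first exact: C0.
exists x0; first exact: x01.
move=> x xx0; move: (H x xx0).
have -> : power_exp (2 * A2 + 1 - beta) (2 * gamma - 2 * d) 0 beta 0 x =
    power_exp (2 * A2 + 1 - beta) (2 * gamma) (2 * d) beta b x.
  by rewrite /power_exp bE; congr (_ * expR _); ring.
by under eq_integral => w _ do rewrite /weight mul0r subr0 mulrBl -{2}bE.
Qed.

(** At x = 1/h* the factor exp(2 gamma x^beta) / n is L^(-kap) with L = log n, and x^(2 A_2 + 1 -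
    beta) is of order L^((2 A_2 + 1 - beta) / beta). Their product is L^(-2 A_1 / beta), the order
    of the power factor of the squared bias. *)
Lemma max_risk_hstar : 0 < gamma -> 0 < beta -> b < beta \/ (b = beta /\ d < gamma) ->
  (b = 0 /\ d = 0) \/ (0 < b /\ 0 < d) ->
  exists2 C : R, 0 < C & \forall n \near \oo,
    (max_risk s B g phi phis (hstar A1 A2 beta gamma n) n <=
      (C * ((ln n%:R) `^ (- (2 * A1) / beta) *
        expR (- 2 * d * (hstar A1 A2 beta gamma n) `^ (- b))))%:E)%E.
Proof.
move=> gamma0 beta0 bb bd.
have b0 : 0 <= b by lra.
have d0 : 0 <= d by lra.
have [CQ CQ0 [x1 x11 HQ]] := bias_le bd.
have [CV CV0 [x2 x21 HV]] := variance_le gamma0 beta0 d0 b0 bb.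
pose x0 := Num.max x1 x2.
have x01 : 1 <= x0 by rewrite le_max x11.
have [|||||||K K0 HK] := @max_risk_le
  (power_exp (2 * A2 + 1 - beta) (2 * gamma) (2 * d) beta b)
  (fun x => x `^ (- (2 * A1)) * expR (- (2 * d * x `^ b))) CV CQ x0.
- by lra.
- exact: ltW.
- by [].
- by move=> x xx0; apply/ltW/power_exp_gt0; lra.
- by move=> x xx0; rewrite mulr_ge0 ?powR_ge0 ?expR_ge0.
- by move=> x; rewrite ge_max => /andP[_ xx0]; exact: HV.
- by move=> x; rewrite ge_max => /andP[xx0 _]; exact: HQ.
pose kap := (2 * A1 + 2 * A2 + 1 - beta) / beta.
have x00 : 0 <= x0 by exact: le_trans x01.
have [M1 M10 H1] := bandwidth_asymptotics kap (2 * A2 + 1 - beta) beta0 gamma0 x00.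
have [M2 M20 H2] := bandwidth_asymptotics kap (- (2 * A1)) beta0 gamma0 x00.
exists (K * (M1 + M2 + 1)); first by rewrite mulr_gt0// ltr_wpDl// addr_ge0.
have n1 := near_ln_ge (1 + 16 * kap ^+ 2 + 4 * gamma * x0 `^ beta : R).
apply: filterS n1 => n Ln.
have {H1}[L1 U0 xx0 UE h1] := H1 _ Ln; have {H2}[_ _ _ _ h2] := H2 _ Ln.
have n0 : (0 < n)%N by exact: (@ln_gt0_nat R).
have nE := @expR_ln_nat R n n0.
rewrite /hstar -/kap; move: U0 xx0 UE h1 h2 L1; rewrite nE.
set L := ln n%:R; set U := _ * (L - _) => U0 xx0 UE h1 h2 L1.
set x := U `^ beta^-1 in xx0 h1 h2.
have xE : U `^ (- beta^-1) = x^-1 by rewrite powRN.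
have xb : x `^ beta = U by rewrite /x -powRrM mulVf ?(lt0r_neq0 beta0)// powRr1// ltW.
have hb : x^-1 `^ (- b) = x `^ b by rewrite /x -powRN -!powRrM; congr (_ `^ _); ring.
rewrite xE hb; apply: (le_trans (HK x n xx0 n0)); rewrite lee_fin -[leRHS]mulrA (ler_pM2l K0).
have -> : - (2 * d * x `^ b) = - 2 * d * x `^ b by rewrite !mulNr.
set E := expR (- 2 * d * x `^ b).
have Vn : power_exp (2 * A2 + 1 - beta) (2 * gamma) (2 * d) beta b x / n%:R =
    x `^ (2 * A2 + 1 - beta) * L `^ (- kap) * E.
  rewrite /power_exp expRD xb UE -!mulNr -/E.
  by field; rewrite pnatr_eq0 -lt0n.
have LE : L `^ (- (2 * A1) / beta) = L `^ ((2 * A2 + 1 - beta) / beta) * L `^ (- kap).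
  rewrite -powRD; last by rewrite (gt_eqF L1) implybT.
  by congr (_ `^ _); rewrite /kap; field; exact: lt0r_neq0.
rewrite Vn -mulrDl [leRHS]mulrA; apply: ler_wpM2r; first exact: expR_ge0.
have h1' := ler_wpM2r (powR_ge0 L (- kap)) h1; rewrite -mulrA -LE in h1'.
apply: (le_trans (lerD h1' h2)).
by rewrite -mulrDl; apply: ler_wpM2r; [exact: powR_ge0|rewrite lerDl ler01].
Qed.

(** With b = beta the power -b of h* is U itself, and exp(-2 d U) = n^(-d / gamma) L^(d kap / gamma)
    for L = log n; the power of L shifts -2 A_1 / beta to -V_1. *)
Lemma max_risk_same_exponent : b = beta -> 0 < beta -> 0 < d < gamma ->
  exists2 C : R, 0 < C & \forall n \near \oo,
    (max_risk s B g phi phis (hstar A1 A2 beta gamma n) n <=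
      (C * ((ln n%:R) `^ (- V1 A1 A2 d beta gamma) * n%:R `^ (- (d / gamma))))%:E)%E.
Proof.
move=> bE beta0 /andP[d0 dg]; have gamma0 : 0 < gamma by exact: lt_trans dg.
have bd : (b = 0 /\ d = 0) \/ (0 < b /\ 0 < d) by right; rewrite bE.
have [C C0 H] := max_risk_hstar gamma0 beta0 (or_intror (conj bE dg)) bd.
exists C => //; pose kap := (2 * A1 + 2 * A2 + 1 - beta) / beta.
have n1 := near_ln_ge (1 + 16 * kap ^+ 2 : R).
apply: filterS2 H n1 => n H Ln; apply: (le_trans H).
have kap0 : 0 <= 16 * kap ^+ 2 by rewrite mulr_ge0// sqr_ge0.
have L1 : 1 <= ln n%:R :> R by lra.
have n0 : (0 < n)%N by apply: (@ln_gt0_nat R); lra.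
have kL : `|kap * ln (ln n%:R)| <= ln n%:R / 2 by apply: ln_half_le; lra.
have nE := @expR_ln_nat R n n0.
rewrite /hstar -/kap; set L := ln n%:R in L1 kL nE *; rewrite -nE.
pose U := (2 * gamma)^-1 * (L - kap * ln L); rewrite -/U.
have U0 : 0 <= U.
  by rewrite mulr_ge0 ?invr_ge0 ?mulr_ge0 ?(ltW gamma0)//; have := ler_norm (kap * ln L); lra.
have -> : (U `^ (- beta^-1)) `^ (- b) = U.
  by rewrite -powRrM bE mulrNN mulVf ?(lt0r_neq0 beta0)// powRr1.
rewrite lee_fin ler_pM2l//; apply: le_of_eq.
have L_neq0 : L == 0 = false by apply: gt_eqF; lra.
have g_neq0 := lt0r_neq0 gamma0; have b_neq0 := lt0r_neq0 beta0.
rewrite /powR L_neq0 (gt_eqF (expR_gt0 L)) expRK -!expRD; congr expR.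
by rewrite /U /V1 /kap; field; rewrite g_neq0 b_neq0.
Qed.

(** The exponentials cancel in the ratio, leaving a pure power in the variance, while at this
    bandwidth the factor exp(-2 d x^b) of the squared bias is exactly 1/n. *)
Lemma max_risk_critical (V : R -> R) CV : b = beta -> 0 < beta -> d = gamma -> 0 < gamma -> 0 <= CV ->
  (forall x, 1 <= x -> 0 <= V x) ->
  (forall x, 1 <= x -> (\int[mu]_(w in `[(- x)%R, x]) (weight A2 0 0 0 0 w)%:E <= (CV * V x)%:E)%E) ->
  exists2 C : R, 0 < C & \forall n \near \oo,
    1 <= (ln n%:R / (2 * gamma)) `^ beta^-1 /\
    (max_risk s B g phi phis ((ln n%:R / (2 * gamma)) `^ (- beta^-1)) n <=
      (C * (n%:R^-1 * (V ((ln n%:R / (2 * gamma)) `^ beta^-1) +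
         ((ln n%:R / (2 * gamma)) `^ beta^-1) `^ (- (2 * A1)))))%:E)%E.
Proof.
move=> bE beta0 dE gamma0 CV0 V0 HV.
have bd : (b = 0 /\ d = 0) \/ (0 < b /\ 0 < d) by right; rewrite bE dE.
have [CQ CQ0 [x0 x01 HQ]] := bias_le bd.
have W0 w : weight (alpha - a) (2 * gamma) (2 * d) beta b w = weight A2 0 0 0 0 w.
  by rewrite /weight bE dE !mul0r !subrr.
have [|||||||K K0 HK] := @max_risk_le V (fun x => x `^ (- (2 * A1)) * expR (- (2 * d * x `^ b))) CV CQ x0.
- by lra.
- by [].
- by [].
- by move=> x xx0; apply: V0; lra.
- by move=> x xx0; rewrite mulr_ge0 ?powR_ge0 ?expR_ge0.
- by move=> x xx0; under eq_integral => w _ do rewrite W0; apply: HV; lra.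
- exact: HQ.
exists K => //; have n1 := near_ln_ge (1 + 2 * gamma * x0 `^ beta : R).
apply: filterS n1 => n Ln.
have xb0 : 0 <= 2 * gamma * x0 `^ beta by rewrite mulr_ge0 ?powR_ge0// mulr_ge0// ltW.
have n0 : (0 < n)%N by apply: (@ln_gt0_nat R); lra.
have nE := @expR_ln_nat R n n0.
set L := ln n%:R in Ln nE *; pose U := L / (2 * gamma); rewrite -/U.
have U0 : 0 < U by rewrite divr_gt0 ?mulr_gt0//; lra.
pose x := U `^ beta^-1; rewrite -/x.
have xb : x `^ beta = U by rewrite /x -powRrM mulVf ?(lt0r_neq0 beta0)// powRr1// ltW.
have xx0 : x0 <= x.
  have -> : x0 = (x0 `^ beta) `^ beta^-1.
    by rewrite -powRrM mulfV ?(lt0r_neq0 beta0)// powRr1//; lra.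
  apply: ge0_ler_powR; rewrite ?nnegrE ?invr_ge0 ?powR_ge0 ?(ltW beta0) ?(ltW U0)//.
  by rewrite ler_pdivlMr ?mulr_gt0//; lra.
split; first exact: le_trans xx0.
have xE : U `^ (- beta^-1) = x^-1 by rewrite powRN.
rewrite xE; apply: (le_trans (HK x n xx0 n0)); rewrite lee_fin; apply: ler_wpM2l; first exact: ltW.
have -> : expR (- (2 * d * x `^ b)) = n%:R^-1.
  rewrite bE dE xb -nE -expRN; congr expR; rewrite /U; field; exact: lt0r_neq0.
by rewrite mulrDr; apply: le_of_eq; ring.
Qed.

Lemma max_risk_loglog : b = beta -> 0 < beta -> d = gamma -> 0 < gamma -> A2 = - 2^-1 -> 0 <= alpha ->
  exists2 C : R, 0 < C & \forall n \near \oo,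
    (max_risk s B g phi phis ((ln n%:R / (2 * gamma)) `^ (- beta^-1)) n <=
      (C * (n%:R^-1 * ln (ln n%:R)))%:E)%E.
Proof.
move=> bE beta0 dE gamma0 A2E alpha0.
have [CV CV0 HV] := @weight_head_log R; rewrite -A2E in HV.
have lx (x : R) : 1 <= x -> 0 <= 1 + ln x by move=> x1; rewrite addr_ge0// ln_ge0.
have [K K0 HK] := max_risk_critical bE beta0 dE gamma0 (ltW CV0) lx HV.
(* A_2 = -1/2 means a = alpha + 1/2, so A_1 = s + alpha + b / 2 and the bias factor stays below
   1. *)
have A10 : 0 <= A1 by have := s_ge0; move: A2E beta0; rewrite -bE /A1 /A2; lra.
exists (K * (2 + beta^-1 * (1 + `|ln (2 * gamma)|))).
  by rewrite mulr_gt0// ltr_wpDr// mulr_ge0 ?invr_ge0 ?(ltW beta0)// addr_ge0.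
(* Ensures ln (ln n) >= 1, so that additive constants are absorbed. *)
have n1 := near_ln_ge (expR 1 : R).
apply: filterS2 HK n1 => n [x1 HK] Ln; apply: (le_trans HK); rewrite lee_fin -[leRHS]mulrA ler_pM2l//.
have L0 : 0 < ln n%:R :> R by exact: lt_le_trans (expR_gt0 1) Ln.
have LL1 : 1 <= ln (ln n%:R) :> R by rewrite -[leLHS](expRK 1) ler_ln// posrE expR_gt0.
rewrite mulrCA; apply: ler_wpM2l; first by rewrite invr_ge0.
have h1 : ((ln n%:R / (2 * gamma)) `^ beta^-1) `^ (- (2 * A1)) <= 1.
  by rewrite -[leRHS](powRr0 ((ln n%:R / (2 * gamma)) `^ beta^-1)); apply: ler_powR => //; lra.
have g2 : 0 < 2 * gamma by rewrite mulr_gt0.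
rewrite ln_powR ln_div ?posrE// in x1 *.
have := ler_norm (- ln (2 * gamma)); rewrite normrN => h2.
have h3 : ln (ln n%:R) - ln (2 * gamma) <= (1 + `|ln (2 * gamma)|) * ln (ln n%:R).
  by have := ler_peMr (normr_ge0 (ln (2 * gamma))) LL1; lra.
have h4 := ler_wpM2l (_ : 0 <= beta^-1) h3; rewrite invr_ge0 (ltW beta0) in h4.
by have := h4 isT; rewrite mulrA; lra.
Qed.

Lemma max_risk_parametric_log : b = beta -> 0 < beta -> d = gamma -> 0 < gamma -> - 2^-1 < A2 -> 0 <= alpha ->
  exists2 C : R, 0 < C & \forall n \near \oo,
    (max_risk s B g phi phis ((ln n%:R / (2 * gamma)) `^ (- beta^-1)) n <=
      (C * (n%:R^-1 * (ln n%:R) `^ ((2 * A2 + 1) / b)))%:E)%E.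
Proof.
move=> bE beta0 dE gamma0 A2_gt alpha0.
have q0 : 0 < 2 * A2 + 1 by lra.
have [CV CV0 HV] := weight_head_power q0.
have V0 x : 1 <= x -> 0 <= power_exp (2 * A2 + 1) 0 0 0 0 x by move=> x1; apply/ltW/power_exp_gt0; lra.
have [K K0 HK] := max_risk_critical bE beta0 dE gamma0 (ltW CV0) V0 HV.
have g2 : 0 < 2 * gamma by rewrite mulr_gt0.
exists (K * (2 * (2 * gamma)^-1 `^ ((2 * A2 + 1) / beta))).
  by rewrite mulr_gt0// mulr_gt0// powR_gt0 ?invr_gt0.
have n1 := near_ln_ge (1 : R).
apply: filterS2 HK n1 => n [x1 HK] Ln; apply: (le_trans HK); rewrite lee_fin -[leRHS]mulrA ler_pM2l//.
rewrite mulrCA; apply: ler_wpM2l; first by rewrite invr_ge0.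
set x := (ln n%:R / (2 * gamma)) `^ beta^-1 in x1 *.
(* 2 A_1 + 2 A_2 + 1 = 2 s + 2 alpha + b >= 0, so the variance term dominates. *)
have h1 : x `^ (- (2 * A1)) <= x `^ (2 * A2 + 1).
  by apply: ler_powR => //; have := s_ge0; move: beta0 alpha0; rewrite -bE /A1 /A2; lra.
have xE : x `^ (2 * A2 + 1) = (ln n%:R) `^ ((2 * A2 + 1) / b) * (2 * gamma)^-1 `^ ((2 * A2 + 1) / beta).
  rewrite /x -powRrM powRM ?invr_ge0 ?(ltW g2)//; last by lra.
  by rewrite bE mulrC [(2 * A2 + 1) / beta]mulrC mulrC.
rewrite /power_exp !mul0r subr0 expR0 mulr1 in HK *.
by rewrite -mulrA [_ * _ `^ _ in leRHS]mulrC -xE; lra.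
Qed.

(** The inverse bandwidth is n^(1/D). D is 2 A_1 for A_2 = -1/2 and 2 A_1 + 2 A_2 + 1 for A_2 >
    -1/2. *)
Lemma max_risk_power (V : R -> R) CV D : b = 0 -> beta = 0 -> d = 0 -> gamma = 0 -> 0 < D -> 0 <= CV ->
  (forall x, 1 <= x -> 0 <= V x) ->
  (forall x, 1 <= x -> (\int[mu]_(w in `[(- x)%R, x]) (weight A2 0 0 0 0 w)%:E <= (CV * V x)%:E)%E) ->
  exists2 C : R, 0 < C & \forall n \near \oo,
    (max_risk s B g phi phis (n%:R `^ (- D^-1)) n <=
      (C * (V (n%:R `^ D^-1) / n%:R + n%:R `^ (- (2 * A1) / D)))%:E)%E.
Proof.
move=> bE betaE dE gammaE D0 CV0 V0 HV.
have [CQ CQ0 [x0 x01 HQ]] := bias_le (or_introl (conj bE dE)).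
have W0 w : weight (alpha - a) (2 * gamma) (2 * d) beta b w = weight A2 0 0 0 0 w.
  by rewrite /weight bE dE betaE gammaE !mulr0.
have [|||||||K K0 HK] := @max_risk_le V (fun x => x `^ (- (2 * A1)) * expR (- (2 * d * x `^ b))) CV CQ x0.
- by lra.
- by [].
- by [].
- by move=> x xx0; apply: V0; lra.
- by move=> x xx0; rewrite mulr_ge0 ?powR_ge0 ?expR_ge0.
- by move=> x xx0; under eq_integral => w _ do rewrite W0; apply: HV; lra.
- exact: HQ.
exists K => //; have := nbhs_infty_ger (1 + x0 `^ D : R); apply: filterS => n Ln.
have xD0 : 0 <= x0 `^ D by exact: powR_ge0.
have n_gt0 : 0 < n%:R :> R by lra.
have n0 : (0 < n)%N by rewrite -(ltr_nat R).
pose x : R := n%:R `^ D^-1.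
have xx0 : x0 <= x.
  have -> : x0 = (x0 `^ D) `^ D^-1.
    by rewrite -powRrM mulfV ?(lt0r_neq0 D0)// powRr1//; lra.
  apply: ge0_ler_powR; rewrite ?nnegrE ?invr_ge0 ?powR_ge0 ?(ltW D0) ?(ltW n_gt0)//; lra.
rewrite powRN -/x; apply: (le_trans (HK x n xx0 n0)); rewrite lee_fin ler_pM2l//.
rewrite dE mulr0 mul0r oppr0 expR0 mulr1 lerD2l; apply: le_of_eq.
by rewrite /x -powRrM mulrC.
Qed.

Lemma max_risk_log : b = 0 -> beta = 0 -> d = 0 -> gamma = 0 -> A2 = - 2^-1 -> 0 < alpha ->
  exists2 C : R, 0 < C & \forall n \near \oo,
    (max_risk s B g phi phis (n%:R `^ (- (2 * A1)^-1)) n <= (C * (n%:R^-1 * ln n%:R))%:E)%E.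
Proof.
move=> bE betaE dE gammaE A2E alpha0.
have [CV CV0 HV] := @weight_head_log R; rewrite -A2E in HV.
have lx (x : R) : 1 <= x -> 0 <= 1 + ln x by move=> x1; rewrite addr_ge0// ln_ge0.
(* With a = alpha + 1/2 and b = 0 this is 2 s + 2 alpha, positive because alpha is. *)
have D0 : 0 < 2 * A1 by have := s_ge0; move: A2E; rewrite /A1 /A2 bE; lra.
have [K K0 HK] := max_risk_power bE betaE dE gammaE D0 (ltW CV0) lx HV.
exists (K * (2 + (2 * A1)^-1)); first by rewrite mulr_gt0// addr_gt0// invr_gt0.
have n1 := near_ln_ge (1 : R).
apply: filterS2 HK n1 => n HK Ln; apply: (le_trans HK); rewrite lee_fin -[leRHS]mulrA ler_pM2l//.
have -> : n%:R `^ (- (2 * A1) / (2 * A1)) = n%:R^-1 :> R.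
  by rewrite mulNr divff ?lt0r_neq0// powR_inv1.
rewrite ln_powR mulrCA [leLHS](_ : _ = n%:R^-1 * (2 + (2 * A1)^-1 * ln n%:R)); last by ring.
by apply: ler_wpM2l; [rewrite invr_ge0|rewrite [leRHS]mulrDl lerD2r; lra].
Qed.

Lemma max_risk_polynomial : b = 0 -> beta = 0 -> d = 0 -> gamma = 0 -> - 2^-1 < A2 -> 0 < alpha ->
  exists2 C : R, 0 < C & \forall n \near \oo,
    (max_risk s B g phi phis (n%:R `^ (- (2 * A1 + 2 * A2 + 1)^-1)) n <=
      (C * n%:R `^ (- (2 * A1) / (2 * A1 + 2 * A2 + 1)))%:E)%E.
Proof.
move=> bE betaE dE gammaE A2_gt alpha0.
have q0 : 0 < 2 * A2 + 1 by lra.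
have [CV CV0 HV] := weight_head_power q0.
have V0 x : 1 <= x -> 0 <= power_exp (2 * A2 + 1) 0 0 0 0 x by move=> x1; apply/ltW/power_exp_gt0; lra.
(* Here too the quantity equals 2 s + 2 alpha. *)
have D0 : 0 < 2 * A1 + 2 * A2 + 1 by have := s_ge0; rewrite /A1 /A2 bE; lra.
have [K K0 HK] := max_risk_power bE betaE dE gammaE D0 (ltW CV0) V0 HV.
exists (K * 2); first by rewrite mulr_gt0.
have := nbhs_infty_ger (1 : R); move: HK; apply: filterS2 => n HK Ln.
apply: (le_trans HK); rewrite lee_fin -[leRHS]mulrA ler_pM2l//.
have n_neq0 : n%:R != 0 :> R by apply: lt0r_neq0; lra.
have -> : power_exp (2 * A2 + 1) 0 0 0 0 (n%:R `^ (2 * A1 + 2 * A2 + 1)^-1) / n%:R =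
    n%:R `^ (- (2 * A1) / (2 * A1 + 2 * A2 + 1)) :> R.
  rewrite /power_exp !mul0r subr0 expR0 mulr1 -powRrM -(powR_inv1 (ler0n _ n)) -powRD ?n_neq0 ?implybT//.
  by congr (_ `^ _); field; exact: lt0r_neq0.
by rewrite [leRHS]mulr_natl [leRHS]mulr2n.
Qed.

Lemma max_risk_parametric : 0 <= beta -> 0 <= gamma -> 0 <= b -> 0 <= d -> (d = 0 -> b = 0) ->
  (b = 0 -> beta = 0 -> 0 < gamma < d -> square_integrable r) ->
  beta < b \/ (b = beta /\ 0 < gamma < d) \/ [/\ b = beta, d = gamma & A2 < - 2^-1] ->
  exists2 C : R, 0 < C & \forall n \near \oo, (max_risk s B g phi phis 0 n <= (C * n%:R^-1)%:E)%E.
Proof.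
move=> beta0 gamma0 b0 d0 db ratio_L2 regime.
have [G gG] := g_bounded; have gG' x : g x <= G by apply: gG; exists x.
have r2 : square_integrable r.
  case: regime => [bb|[[bE dg]|[bE dE A2_lt]]].
  (* d = 0 would force b = 0, against 0 <= beta < b. *)
  - have d_gt0 : 0 < d.
      rewrite lt_neqAle d0 andbT eq_sym; apply/eqP => /db b_eq0; lra.
    apply: ratio_square_integrable.
    have [||C C0 [x x1 H]] := @weight_tail R A2 (2 * gamma) (2 * d) beta b beta0 bb.
    + by rewrite mulr_ge0.
    + by rewrite mulr_gt0.
    by apply: (weight_total_fin _ _ _ (ltry _) (H x (lexx x))); rewrite ?mulr_ge0.
  - have /andP[gamma_gt0 dg'] := dg.
    (* For b = beta = 0 the exponentials are constants and the bound on the ratio is only a power,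
       so square integrability is taken from the hypothesis. *)
    have [beta_eq0|beta_neq0] := eqVneq beta 0; first by apply: ratio_L2; rewrite ?bE.
    have beta_gt0 : 0 < beta by rewrite lt_neqAle eq_sym beta_neq0.
    apply: ratio_square_integrable.
    have WE w : weight (alpha - a) (2 * gamma) (2 * d) beta b w = weight A2 0 (2 * d - 2 * gamma) 0 beta w.
      by rewrite /weight bE; congr (_ * expR _); ring.
    under eq_integral => w _ do rewrite WE.
    have [|C C0 [x x1 H]] := @weight_tail R A2 0 (2 * d - 2 * gamma) 0 beta (lexx 0) beta_gt0 (lexx 0).
    + by lra.
    by apply: (weight_total_fin _ _ _ (ltry _) (H x (lexx x))) => //; lra.
  - apply: ratio_square_integrable.
    have WE w : weight (alpha - a) (2 * gamma) (2 * d) beta b w = weight A2 0 0 0 0 w.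
      by rewrite /weight bE dE !mul0r !subrr.
    under eq_integral => w _ do rewrite WE.
    have lt0 : 2 * A2 + 1 < 0 by lra.
    have [C C0 H] := weight_tail_power lt0.
    exact: (weight_total_fin _ _ _ (ltry _) (H 1 (lexx 1))).
have [C C0 H] := max_risk_le_untruncated g_pdf gG' gs_neq0 Phi_fourier r2.
by exists C => //; exists 1%N => // n; exact: H.
Qed.

End risk_bounds.

Unset Implicit Arguments.

Theorem theorem1 (R : realType) (g phi : R -> R) (phis : R -> R[i])
    (s B Cg1 Cphi2 alpha beta gamma a b d : R)
    (s_ge0 : 0 <= s) (B_gt0 : 0 < B)
    (g_pdf : is_pdf g) (g_bounded : has_ubound (range g))
    (phis_fourier : is_fourier phi phis)
    (Phi_fourier : forall f : R -> R, sobolev_ball s B f ->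
       [/\ (@lebesgue_measure R).-integrable setT (fun x => (phi x * f x)%:E),
           cintegrable (fun w => rfourier f w * phis (- w)) &
           (functional phi f)%:C =
             ((2 * pi)^-1)%:C *
               cint setT (fun w => rfourier f w * phis (- w))])
    (Cg1_gt0 : 0 < Cg1) (Cphi2_gt0 : 0 < Cphi2)
    (alpha_ge0 : 0 <= alpha) (beta_ge0 : 0 <= beta) (gamma_ge0 : 0 <= gamma)
    (a_ge0 : 0 <= a) (b_ge0 : 0 <= b) (d_ge0 : 0 <= d)
    (gamma_eq0 : gamma = 0 -> 0 < alpha /\ beta = 0)
    (d_eq0 : d = 0 -> b = 0)
    (gs_lower : forall w : R,
       Cg1 * (w ^+ 2 + 1) `^ (- (alpha / 2)) * expR (- gamma * `|w| `^ beta)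
         <= cabs (rfourier g w))
    (phis_upper : forall w : R,
       cabs (phis w) <=
         Cphi2 * (w ^+ 2 + 1) `^ (- (a / 2)) * expR (- d * `|w| `^ b))
    (* The untruncated estimator presupposes this; the bounds above imply it
       in every regime with h = 0 except b = beta = 0 < gamma < d. *)
    (ratio_L2 : b = 0 -> beta = 0 -> 0 < gamma < d ->
       square_integrable (fourier_ratio (rfourier g) phis))
    (h Delta : nat -> R)
    (h_Delta : bandwidth_rate (s + a + (b - 1) / 2) (alpha - a)
                 b d beta gamma h Delta) :
  exists2 C : R, 0 < C &
    \forall n \near \oo,
      (max_risk s B g phi phis (h n) n <= (C * Delta n)%:E)%E.
Proof.
have mphis := cmeasurable_is_fourier phis_fourier.
have alpha_gt0 : gamma = 0 -> 0 < alpha by move=> /gamma_eq0[].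
case: h_Delta => [regime|bE be0 dE ga0 A2E|bE be0 dE ga0 A2_gt|bE beE dE gaE A2E|bE beE dE gaE A2_gt|bE be0 dg|/andP[b0 bb] d0 ga0|bE dE be0 ga0].
- exact: (max_risk_parametric g_pdf g_bounded mphis Phi_fourier Cg1_gt0 gs_lower phis_upper).
- exact: (max_risk_loglog s_ge0 B_gt0 g_pdf g_bounded mphis Phi_fourier Cg1_gt0 Cphi2_gt0 gs_lower phis_upper a_ge0).
- exact: (max_risk_parametric_log s_ge0 B_gt0 g_pdf g_bounded mphis Phi_fourier Cg1_gt0 Cphi2_gt0 gs_lower phis_upper a_ge0).
- exact: (max_risk_log s_ge0 B_gt0 g_pdf g_bounded mphis Phi_fourier Cg1_gt0 Cphi2_gt0 gs_lower phis_upper a_ge0 bE beE dE gaE A2E (alpha_gt0 gaE)).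
- exact: (max_risk_polynomial s_ge0 B_gt0 g_pdf g_bounded mphis Phi_fourier Cg1_gt0 Cphi2_gt0 gs_lower phis_upper a_ge0 bE beE dE gaE A2_gt (alpha_gt0 gaE)).
- exact: (max_risk_same_exponent s_ge0 B_gt0 g_pdf g_bounded mphis Phi_fourier Cg1_gt0 Cphi2_gt0 gs_lower phis_upper a_ge0).
- exact: (max_risk_hstar s_ge0 B_gt0 g_pdf g_bounded mphis Phi_fourier Cg1_gt0 Cphi2_gt0 gs_lower phis_upper a_ge0 ga0 (lt_trans b0 bb) (or_introl bb) (or_intror (conj b0 d0))).
- have [C C0 H] := max_risk_hstar s_ge0 B_gt0 g_pdf g_bounded mphis Phi_fourier Cg1_gt0 Cphi2_gt0 gs_lower phis_upper a_ge0 ga0 be0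
    (or_introl (eq_ind_r (fun t => t < beta) be0 bE)) (or_introl (conj bE dE)).
  exists C => //; apply: filterS H => n /le_trans; apply.
  (* d = 0 turns the exponential factor of [max_risk_hstar] into 1. *)
  by rewrite [X in -2 * X]dE mulr0 mul0r expR0 mulr1.
Qed.
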